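(* Let $(T_t)$ and $(S_t)$ be weakly mixing flows on $(X,\mathcal{B},\mu,d_1)$ and $(Y,\mathcal{C},\nu,d_2)$, respectively. Let $P=\{p_0,-p_0\}$ with $p_0\neq0$, and let $0<c<1$. Assume that there are sets $X_k\in\mathcal{B}$ with $\mu(X_k)\to\mu(X)$ and automorphisms $A_k\in\mathrm{Aut}(X_k,\mathcal{B}|_{X_k},\mu|_{X_k})$, $k\ge1$, with $A_k\to Id$ uniformly. Assume moreover that for every $0<\epsilon<1$ and $N\in\mathbb{N}$ there exist - a sequence $(E_k)=(E_k(\epsilon))\subset\mathcal{B}$ with $\mu(E_k)\ge c\,\mu(X)$, - numbers $0<\kappa=\kappa(\epsilon)<\epsilon$ and $\delta=\delta(\epsilon,N)>0$, - a set $Z=Z(\epsilon,N)\subset Y$ with $\nu(Z)\ge(1-\epsilon)\nu(Y)$, such that for all $y,y'\in Z$ with $d_2(y,y')<\delta$, every $k$ such that $d_1(A_k,Id)<\delta$, and every $x\in E_k\cap X_k$, setting $x':=A_kx$, there are $M\ge N$, $L\ge1$ with $\frac LM\ge\kappa$, an element $p\in P$, a function $a=a_{x,x',y,y'}:[M,M+L]\to\mathbb{R}$, extended to $[-M-L,-M]$ by $a(-t)=-a(t)$, and a set $U\subset[M,M+L]$ such that $(a,U,c)$ is $\epsilon$-good and at least one of the following holds: $$\max\left(d_1(T_tx,T_{a(t)+p}x'),\,d_2(S_ty,S_{a(t)}y')\right)<\epsilon\quad\text{for all } t\in U,$$ or $$\max\left(d_1(T_tx,T_{a(t)+p}x'),\,d_2(S_ty,S_{a(t)}y')\right)<\epsilon\quad\text{for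 all } t \text{ with } -t\in U.$$ Then the flows $(T_t)$ and $(S_t)$ are disjoint.
   Context: Flows are (essentially free) measurable measure-preserving $\mathbb{R}$-actions on probability standard Borel spaces; here $(X,d_1)$, $(Y,d_2)$ are $\sigma$-compact metric spaces with Borel $\sigma$-algebras $\mathcal B,\mathcal C$ and Borel probability measures $\mu,\nu$. $\mathrm{Aut}$ denotes the group of bi-measurable measure-preserving (a.e.) bijections. ''$A_k\to Id$ uniformly'' means: for each $\delta'>0$, $d_1(A_kx,x)<\delta'$ for all $k$ large enough and all $x\in X_k$. ''$d_1(A_k,Id)<\delta$'' means $d_1(A_kx,x)<\delta$ for all $x\in X_k$. Two flows are disjoint if their only joining (probability measure on the product space invariant under the product flow with marginals $\mu,\nu$) is $\mu\otimes\nu$. Good triples. Let $I=[u_1,u_2]$ be an interval, $a:I\to\mathbb{R}$ measurable, $U\subset I$ measurable, and $0<d,\xi<1$; $|\cdot|$ denotes Lebesgue measure. The triple $(a,U,d)$ is $\xi$-good (and $a$ is called almost linear) if at least one of the following holds: (PAL) $U=\bigcup_{i=1}^v(c_i,d_i)$ is a union of disjoint intervals listed in increasing order, with $v\le|I|/d$ and $|U|>(1-\xi)|I|$, and for each $i=1,\dots,v$ there is $R_i\in\mathbb{R}$ with $a(t)=t+R_i$ for $t\in(c_i,d_i)$, where $|R_1|\le\xi|I|$ and $|R_{i+1}-R_i|<\xi$ for $i=1,\dots,v-1$; (SAL) $a\in C^1(I)$, $U=I$, $|a(u_i)-u_i|\le\xi|I|$ for $i=1,2$, and $1-\xi<a'(t)\le1+\xi$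 for every $t\in I$. *)

(* Defs.v *)
From HB Require Import structures.
From mathcomp Require Import all_boot all_order all_algebra.
From mathcomp Require Import all_classical all_reals all_analysis.

Set Implicit Arguments.
Unset Strict Implicit.
Unset Printing Implicit Defensive.

Import Order.TTheory GRing.Theory Num.Theory.
Import numFieldNormedType.Exports.

Local Open Scope classical_set_scope.
Local Open Scope ring_scope.

(** [g_sigma_algebraType] needs a pointed carrier, which [metricType] does not
    provide.  A space carrying a probability measure is nonempty. *)
#[short(type="pointedMetricType")]
HB.structure Definition PointedMetric (R : numDomainType) :=
  {M of Metric R M & Pointed M}.

Notation borel X := (g_sigma_algebraType (@open X)).

Definition sigma_compact (X : topologicalType) : Prop :=
  exists2 K : (set X)^nat, (forall n, compact (K n)) & \bigcup_n K n = setT.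

Record is_flow (R : realType) (d : measure_display) (X : measurableType d)
    (mu : probability X R) (T : R -> X -> X) : Prop := IsFlow {
  flow0 : forall x, T 0 x = x ;
  flowD : forall s t x, T (s + t) x = T s (T t x) ;
  flow_measurable :
    measurable_fun [set: measurableTypeR R * X] (fun p => T p.1 p.2) ;
  flow_preserving :
    forall t A, measurable A -> mu (T t @^-1` A) = mu A ;
  flow_essentially_free :
    {ae mu, forall x, forall t, T t x = x -> t = 0} }.

(** [T s @^-1` B] is the set usually written [T_{-s} B]. *)
Definition weakly_mixing (R : realType) (d : measure_display)
    (X : measurableType d) (mu : probability X R) (T : R -> X -> X) : Prop :=
  forall A B, measurable A -> measurable B ->
    (t^-1 * \int[lebesgue_measure]_(s in `[0, t])
       `|fine (mu (A `&` T s @^-1` B)) - fine (mu A) * fine (mu B)|)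
      @[t --> +oo] --> (0 : R).

Record is_joining (R : realType) (d1 d2 : measure_display)
    (X : measurableType d1) (Y : measurableType d2)
    (mu : probability X R) (nu : probability Y R)
    (T : R -> X -> X) (S : R -> Y -> Y)
    (rho : probability (X * Y)%type R) : Prop := IsJoining {
  joining_fst : forall A, measurable A -> rho (A `*` setT) = mu A ;
  joining_snd : forall B, measurable B -> rho (setT `*` B) = nu B ;
  joining_invariant : forall t C, measurable C ->
    rho ((fun z => (T t z.1, S t z.2)) @^-1` C) = rho C }.

Definition disjoint_flows (R : realType) (d1 d2 : measure_display)
    (X : measurableType d1) (Y : measurableType d2)
    (mu : probability X R) (nu : probability Y R)
    (T : R -> X -> X) (S : R -> Y -> Y) : Prop :=
  forall rho : probability (X * Y)%type R, is_joining mu nu T S rho ->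
    forall C, measurable C -> rho C = (mu \x nu)%E C.

(** [A] represents an element of Aut(D, B|_D, mu|_D): it is bijective only up
    to null sets, and its values outside [D] are irrelevant. *)
Record is_aut (R : realType) (d : measure_display) (X : measurableType d)
    (mu : probability X R) (D : set X) (A : X -> X) : Prop := IsAut {
  aut_fun : set_fun D D A ;
  aut_measurable : measurable_fun D A ;
  aut_preserving : forall B, measurable B -> B `<=` D ->
    mu (D `&` A @^-1` B) = mu B ;
  aut_bij : exists D1 D2 : set X,
    [/\ [/\ measurable D1, D1 `<=` D & mu (D `\` D1) = 0%E],
        [/\ measurable D2, D2 `<=` D & mu (D `\` D2) = 0%E],
        set_bij D1 D2 A &
        forall B, measurable B -> B `<=` D1 -> measurable (A @` B)] }.

(** Piecewise almost linear.  Indices start at 0, so the intervals are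
    []lo i, hi i[] for [i < v]. *)
Definition PAL (R : realType) (u1 u2 : R) (a : R -> R) (U : set R)
    (d xi : R) : Prop :=
  exists (v : nat) (lo hi r : nat -> R),
    [/\ forall i, (i < v)%N -> lo i < hi i,
        forall i, (i.+1 < v)%N -> hi i <= lo i.+1,
        U = \bigcup_(i in `I_v) `]lo i, hi i[%classic,
        v%:R <= (u2 - u1) / d &
        (((1 - xi) * (u2 - u1))%:E < lebesgue_measure U)%E]
    /\
    [/\ forall i t, (i < v)%N -> lo i < t < hi i -> a t = t + r i,
        `|r 0%N| <= xi * (u2 - u1) &
        forall i, (i.+1 < v)%N -> `|r i.+1 - r i| < xi].

(** [a] is of class C^1 on the closed interval with derivative [a'], one-sided
    at the endpoints; only the values of [a] on the interval matter. *)
Definition C1_itv (R : realType) (u1 u2 : R) (a a' : R -> R) : Prop :=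
  (forall t, t \in `[u1, u2] ->
     (a s - a t) / (s - t) @[s --> within `[u1, u2] t^'] --> a' t)
  /\ {within `[u1, u2], continuous a'}.

(** Smooth almost linear *)
Definition SAL (R : realType) (u1 u2 : R) (a : R -> R) (U : set R)
    (xi : R) : Prop :=
  exists a' : R -> R,
    [/\ C1_itv u1 u2 a a',
        U = `[u1, u2]%classic,
        `|a u1 - u1| <= xi * (u2 - u1) /\ `|a u2 - u2| <= xi * (u2 - u1) &
        forall t, t \in `[u1, u2] -> 1 - xi < a' t <= 1 + xi].

Definition good_triple (R : realType) (u1 u2 : R) (a : R -> R) (U : set R)
    (d xi : R) : Prop :=
  [/\ measurable_fun `[u1, u2] a, measurable U, U `<=` `[u1, u2] &
      PAL u1 u2 a U d xi \/ SAL u1 u2 a U xi].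

(* Main.v *)
Require Import Defs.
From HB Require Import structures.
From mathcomp Require Import all_boot all_order all_algebra.
From mathcomp Require Import all_classical all_reals all_analysis.
From mathcomp Require Import measurable_realfun.
From mathcomp Require Import ring lra.

(** Let [rho] be a joining of the two flows that is not the product measure;
    the idea is to produce two points of the product space whose orbits must
    have clearly different averages and yet shadow each other.

    Flow-invariant subsets [W] of the product replace the ergodic components of
    [rho].  Weak mixing makes every map [T q], [q != 0], ergodic
    ([weakly_mixing_ergodic_map]), and a finite measure that is invariant under
    an ergodic map and absolutely continuous with respect to [mu] is a multiple
    of [mu] ([ergodic_proportional]).  Hence an invariant [W] is independent of
    both coordinates, and if the restriction of [rho] to [W] were invariant
    under [fst_shift p : (x, y) |-> (T p x, y)], it would be a product
    ([shift_invariant_product]).  As [rho] is not a product, some invariant set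
    of positive measure has no invariant subset of positive measure on which
    [rho] is a product ([nonproduct_nowhere_product]).  Inside such a set, for
    every [p != 0] and both directions of time, some Lipschitz function [f] has
    different integrals before and after the shift, so on a smaller invariant
    set of positive measure its time means stay below [q] while those of
    [f \o fst_shift p] stay above some [r > q] ([refine_separated]).  Doing this
    for the two values of [p] and the two directions leaves one set [W] on which
    all these separations hold, between any two of its points.

    The assumption of the theorem contradicts this.  Choose [e] small compared
    with the gaps [r - q] and with the measure of [W]; it gives [kappa], and only
    then is the time fixed after which averages are close to time means, up to
    a small part of [W].  Inside the rest lies a compact set [G] of almost full
    measure, above the points [y] of [Z].  Since [A k] preserves the measure and
    is uniformly close to the identity, it nearly maps compact sets into
    themselves; applied to thin slices of [G], this gives [(x, y)] and
    [(A k x, y')] in [G] with [x] in [E k] and [y'] close to [y]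
    ([compact_fibre_returns]).  On a window [[M, M + L]], the orbit of the first
    point then shadows that of the second one, shifted by [p], along an almost
    linear change of time [a].  Such a change of time alters an average by at
    most a constant times [e / c] ([good_triple_compare]), and since [L] is at
    least [kappa * M] the averages over the window are close to the time means
    ([window_mean]), which differ by [r - q]: too much for small [e]
    ([separated_orbits_far]). *)

Set Implicit Arguments.
Unset Strict Implicit.
Unset Printing Implicit Defensive.

Import Order.TTheory GRing.Theory Num.Theory.
Import numFieldNormedType.Exports.

Local Open Scope classical_set_scope.
Local Open Scope ring_scope.

(** * Functions with values in the unit interval *)

Section Unit.
Context {d : measure_display} {T : measurableType d} {R : realType}.

Lemma unit_integrable (mu : {measure set T -> \bar R}) (D : set T) (g : T -> R) :
  measurable D -> (mu D < +oo)%E -> measurable_fun setT g ->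
  (forall t, 0 <= g t <= 1) -> mu.-integrable D (EFin \o g).
Proof.
move=> mD muD mg g01; apply: measurable_bounded_integrable => //.
  exact: measurable_funS mg.
exists 1; split => // M M1 x _ /=.
by have /andP[g0 g1] := g01 x; rewrite ger0_norm// (le_trans g1)// ltW.
Qed.

Lemma unit_Rintegral (mu : {measure set T -> \bar R}) (D : set T) (g : T -> R) :
  measurable D -> (mu D < +oo)%E -> measurable_fun setT g ->
  (forall t, 0 <= g t <= 1) ->
  0 <= \int[mu]_(t in D) g t <= fine (mu D).
Proof.
move=> mD muD mg g01; apply/andP; split.
  by apply: Rintegral_ge0 => x _; case/andP: (g01 x).
have -> : fine (mu D) = \int[mu]_(t in D) 1 by rewrite Rintegral_cst// mul1r.
apply: le_Rintegral => //.
- exact: unit_integrable.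
- by apply: unit_integrable => // t; rewrite ler01 lexx.
- by move=> x _; case/andP: (g01 x).
Qed.

Lemma unit_onem (g : T -> R) : (forall t, 0 <= g t <= 1) ->
  forall t, 0 <= 1 - g t <= 1.
Proof. by move=> g01 t; have := g01 t; lra. Qed.

Lemma measurable_onem (g : T -> R) : measurable_fun setT g ->
  measurable_fun setT (fun t => 1 - g t).
Proof. by move=> mg; apply: measurable_funB. Qed.

Lemma Rintegral_onem (mu : {measure set T -> \bar R}) (D : set T) (g : T -> R) :
  measurable D -> (mu D < +oo)%E -> measurable_fun setT g ->
  (forall t, 0 <= g t <= 1) ->
  \int[mu]_(t in D) (1 - g t) = fine (mu D) - \int[mu]_(t in D) g t.
Proof.
move=> mD muD mg g01; rewrite RintegralB//; last first.
- exact: unit_integrable.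
- by apply: (@unit_integrable _ _ (cst 1)) => // t; rewrite /= ler01 lexx.
by rewrite Rintegral_cst// mul1r.
Qed.

End Unit.

Section Itv.
Context {R : realType}.
Local Notation leb := (@lebesgue_measure R).

Lemma leb_itvcc (a b : R) : a <= b -> leb `[a, b]%classic = (b - a)%:E.
Proof.
move=> ab; rewrite lebesgue_measure_itv/= lte_fin; case: ltgtP ab => //= -> _.
by rewrite subrr.
Qed.

Lemma leb_itvcc_lty (a b : R) : (leb `[a, b]%classic < +oo)%E.
Proof.
by rewrite lebesgue_measure_itv/=; case: ifPn => // _; rewrite -EFinB ltry.
Qed.

Variable g : R -> R.
Hypothesis mg : measurable_fun setT g.
Hypothesis g01 : forall t, 0 <= g t <= 1.

Lemma unit_Rintegral_itv (a b : R) : a <= b ->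
  0 <= \int[leb]_(t in `[a, b]) g t <= b - a.
Proof.
move=> ab; have := @unit_Rintegral _ _ _ leb `[a, b]%classic g (measurable_itv _) (leb_itvcc_lty a b) mg g01.
by rewrite (_ : fine _ = b - a)// -[RHS]/(fine (b - a)%:E) -leb_itvcc.
Qed.

Lemma Rintegral_itv_split (a b c : R) : a <= b -> b <= c ->
  \int[leb]_(t in `[a, c]) g t =
  \int[leb]_(t in `[a, b]) g t + \int[leb]_(t in `[b, c]) g t.
Proof.
move=> ab bc; rewrite -(@Rintegral_itv_obnd_cbnd _ b).
  rewrite -(@Rintegral_itvB _ g (BLeft a) (BRight c) b) ?bnd_simp//.
    by rewrite addrC subrK.
  by apply: unit_integrable => //; apply: leb_itvcc_lty.
apply: unit_integrable => //.
by rewrite /= lebesgue_measure_itv/=; case: ifPn => // _; rewrite -EFinB ltry.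
Qed.

Definition primitive (s : R) : R :=
  \int[leb]_(t in `[0, s]) g t - \int[leb]_(t in `[s, 0]) g t.

Lemma Rintegral_itvaa (a : R) : \int[leb]_(t in `[a, a]) g t = 0.
Proof. by rewrite set_itv1 Rintegral_set1. Qed.

Lemma Rintegral_itv_empty (a b : R) : b < a -> \int[leb]_(t in `[a, b]) g t = 0.
Proof. by move=> ba; rewrite set_itv_ge ?bnd_simp -?ltNge// Rintegral_set0. Qed.

(** One formula for the integrals over all intervals: estimates on intervals with
    moving endpoints become increments of a 1-Lipschitz function. *)
Lemma primitiveB (a b : R) : a <= b ->
  primitive b - primitive a = \int[leb]_(t in `[a, b]) g t.
Proof.
move=> ab; rewrite /primitive.
have [b0|b0] := ltP b 0.
  have a0 : a < 0 by apply: le_lt_trans b0.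
  rewrite (@Rintegral_itv_empty 0 b)// (@Rintegral_itv_empty 0 a)//.
  by rewrite (@Rintegral_itv_split a b 0) ?(ltW b0)//; ring.
have -> : \int[leb]_(t in `[b, 0]) g t = 0.
  have [b00|b00] := eqVneq b 0; first by rewrite b00 Rintegral_itvaa.
  by rewrite Rintegral_itv_empty// lt_neqAle eq_sym b00.
have [a0|a0] := ltP a 0.
  rewrite (@Rintegral_itv_empty 0 a)// (@Rintegral_itv_split a 0 b)// ?(ltW a0)//.
  ring.
have -> : \int[leb]_(t in `[a, 0]) g t = 0.
  have [b00|b00] := eqVneq a 0; first by rewrite b00 Rintegral_itvaa.
  by rewrite Rintegral_itv_empty// lt_neqAle eq_sym b00.
by rewrite (@Rintegral_itv_split 0 a b)//; ring.
Qed.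

Lemma primitive_lip (a b : R) : `|primitive b - primitive a| <= `|b - a|.
Proof.
wlog ab : a b / a <= b.
  move=> H; have [ab|/ltW ab] := leP a b; first exact: H.
  by rewrite distrC [leRHS]distrC; apply: H.
rewrite primitiveB//.
have /andP[i0 i1] := unit_Rintegral_itv ab.
by rewrite !ger0_norm// subr_ge0.
Qed.

End Itv.

Section Domination.
Context {R : realType}.
Local Notation leb := (@lebesgue_measure R).

(** Lebesgue measure is an outer measure built from half-open intervals, so a
    bound on these passes to countable covers. *)
Lemma dominated_by_leb (nu : {measure set (measurableTypeR R) -> \bar R}) (K : R) :
  0 < K ->
  (forall a b : R, a <= b -> (nu `]a, b]%classic <= (K * (b - a))%:E)%E) ->
  forall B, measurable B -> (nu B <= K%:E * leb B)%E.
Proof.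
move=> K0 H B mB.
rewrite muleC -lee_pdivrMr//.
apply: le_ereal_inf_tmp => _ [F [mF BF] <-].
rewrite lee_pdivrMr// muleC -nneseriesZl//.
have mF' k : measurable (F k : set (measurableTypeR R)).
  by apply: sub_sigma_algebra; exact: mF.
apply: (@le_trans _ _ (nu (\bigcup_k F k))).
  apply: le_measure; rewrite ?inE//.
  exact: bigcup_measurable.
apply: le_trans (measure_sigma_subadditive _ _ _ _) _; [by []| exact: bigcup_measurable|by []|].
apply: lee_nneseries => //= k _.
have [[a b] _ <-] := mF k.
have [ab|ba] := ltP a b.
  rewrite wlength_itv_bnd ?(ltW ab)//=; apply: le_trans (H _ _ (ltW ab)) _.
  by rewrite EFinM muleC.
by rewrite set_itv_ge ?bnd_simp -?leNgt// measure0 wlength0 mule0.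
Qed.

End Domination.

(** * Integrals along expanding time changes *)

Section Expanding.
Context {R : realType}.
Local Notation leb := (@lebesgue_measure R).

Lemma expanding_nondecreasing (phi : R -> R) (k : R) : 0 < k ->
  (forall s t : R, s <= t -> k * (t - s) <= phi t - phi s) ->
  {homo phi : s t / s <= t}.
Proof.
move=> k0 phik s t st; rewrite -subr_ge0; apply: le_trans (phik _ _ st).
by rewrite mulr_ge0 ?subr_ge0// ltW.
Qed.

Lemma expanding_measurable (phi : R -> R) (k : R) : 0 < k ->
  (forall s t : R, s <= t -> k * (t - s) <= phi t - phi s) ->
  measurable_fun setT phi.
Proof.
move=> k0 phik; apply: nondecreasing_measurable => // s t.
exact: (expanding_nondecreasing k0 phik).
Qed.

(** Two points of the preimage are at distance at most [k^-1 * (y - x)], so the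
    preimage lies in an interval of that length. *)
Lemma expanding_preimage_le (phi : R -> R) (k : R) : 0 < k ->
  (forall s t : R, s <= t -> k * (t - s) <= phi t - phi s) ->
  forall x y, x <= y -> (leb (phi @^-1` `]x, y]) <= (k^-1 * (y - x))%:E)%E.
Proof.
move=> k0 phik x y xy; set S := _ @^-1` _.
have [S0|/set0P[s0 Ss0]] := eqVneq S set0.
  by rewrite S0 measure0 lee_fin mulr_ge0 ?invr_ge0 ?subr_ge0// ltW.
have SD s t : S s -> S t -> t - s <= k^-1 * (y - x).
  move=> Ss St; have [st|ts] := leP s t; last first.
    by rewrite (@le_trans _ _ 0) ?subr_le0 ?mulr_ge0 ?invr_ge0 ?subr_ge0// ltW.
  rewrite mulrC ler_pdivlMr// mulrC (le_trans (phik _ _ st))//.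
  by move: Ss St; rewrite /S/= !in_itv/= => /andP[? ?] /andP[? ?]; rewrite lerB// ltW.
pose c := k^-1 * (y - x).
have c0 : 0 <= c by rewrite mulr_ge0 ?invr_ge0 ?subr_ge0// ltW.
have hS : has_sup S.
  by split; [exists s0|exists (s0 + c) => t St; rewrite -lerBlDl; exact: SD].
apply: (@le_trans _ _ (leb `[sup S - c, sup S]%classic)); last first.
  by rewrite leb_itvcc ?lerBlDr ?lerDl// opprB addrC subrK.
apply: le_measure; rewrite ?inE//.
  rewrite -[X in measurable X]setTI.
  by apply: (expanding_measurable k0 phik) => //; exact: measurable_itv.
move=> t St; rewrite /= in_itv/= sup_upper_bound// andbT lerBlDr.
by apply: ge_sup; [exists s0|move=> r Sr; rewrite -lerBlDl; exact: SD].
Qed.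

(** The image of Lebesgue measure under [phi] is dominated by [k^-1] times Lebesgue
    measure.  This domination stands in for a change of variables, [phi]
    being only monotone. *)
Lemma expanding_integral_le (phi g : R -> R) (k u v : R) : 0 < k ->
  (forall s t : R, s <= t -> k * (t - s) <= phi t - phi s) ->
  measurable_fun setT g -> (forall t, 0 <= g t <= 1) -> u <= v ->
  \int[leb]_(t in `[u, v]) g (phi t) <=
  k^-1 * \int[leb]_(t in `[phi u, phi v]) g t.
Proof.
move=> k0 phik mg g01 uv.
have mphi := expanding_measurable k0 phik.
have phiP s t : (phi s <= phi t) = (s <= t).
  have [st|ts] := leP s t; first exact: (expanding_nondecreasing k0 phik).
  apply/negbTE; rewrite -ltNge -subr_gt0; apply: lt_le_trans (phik _ _ (ltW ts)).
  by rewrite mulr_gt0// subr_gt0.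
have uvE : `[u, v]%classic = phi @^-1` `[phi u, phi v].
  by apply/seteqP; split => t /=; rewrite !in_itv/= !phiP.
have ig (h : R -> R) (w z : R) : measurable_fun setT h -> (forall t, 0 <= h t <= 1) ->
    leb.-integrable `[w, z] (EFin \o h).
  by move=> mh h01; apply: unit_integrable => //; exact: leb_itvcc_lty.
have mgphi : measurable_fun setT (g \o phi) by apply: measurableT_comp.
rewrite -lee_fin EFinM !fineK ?integrable_fin_num//; last 2 first.
  exact: ig.
  by apply: (ig (g \o phi)) => // t; exact: g01.
pose J := `[phi u, phi v]%classic.
pose G x := ((EFin \o g) \_ J) x.
have G0 x : (0 <= G x)%E.
  by rewrite /G /patch; case: ifP => // _; rewrite lee_fin; case/andP: (g01 x).
have mG : measurable_fun setT G.
  have mEg : measurable_fun setT (EFin \o g) by exact/measurable_EFinP.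
  apply: (iffLR (measurable_restrictT (EFin \o g) (measurable_itv _))).
  exact: measurable_funS mEg.
rewrite [leLHS](_ : _ = \int[pushforward leb (phi : _ -> measurableTypeR R)]_x G x)%E; last first.
  rewrite ge0_integral_pushforward//.
  rewrite preimage_setT [LHS]integral_mkcond; apply: eq_integral => x _.
  by rewrite /G /patch /= uvE.
have kn : 0 <= k^-1 by rewrite invr_ge0 ltW.
rewrite [leRHS](_ : _ = \int[mscale (NngNum kn) leb]_x G x)%E; last first.
  by rewrite ge0_integral_mscale//= [in LHS]integral_mkcond.
have H : forall B : set (measurableTypeR R), measurable B ->
    (pushforward leb (phi : _ -> measurableTypeR R) B <= mscale (NngNum kn) leb B)%E.
  move=> B mB.
  have /(_ mphi) D := @dominated_by_leb R (pushforward leb (phi : _ -> measurableTypeR R)) k^-1.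
  rewrite /mscale/=; apply: D => //; first by rewrite invr_gt0.
  by move=> x y xy; exact: expanding_preimage_le.
exact: (ge0_le_measure_integral H measurableT G0 mG).
Qed.

(** The second bound is the first one for [1 - g]; together they control the
    integral from both sides, since [k] is close to 1 in the applications. *)
Lemma expanding_integral_itv (a g : R -> R) (k u v : R) : 0 < k <= 1 -> u <= v ->
  (forall s t, u <= s -> s <= t -> t <= v -> k * (t - s) <= a t - a s) ->
  measurable_fun setT g -> (forall t, 0 <= g t <= 1) ->
  \int[leb]_(t in `[u, v]) g (a t) <= k^-1 * \int[leb]_(t in `[a u, a v]) g t /\
  (v - u) - \int[leb]_(t in `[u, v]) g (a t) <=
  k^-1 * ((a v - a u) - \int[leb]_(t in `[a u, a v]) g t).
Proof.
move=> /andP[k0 k1] uv ak mg g01.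
(* Unit speed outside the interval makes the change of time expanding on the
   whole line. *)
pose phi t := if t < u then a u + (t - u) else if v < t then a v + (t - v) else a t.
have phiE t : u <= t <= v -> phi t = a t.
  by case/andP => ut tv; rewrite /phi ltNge ut/= ltNge tv.
have k1' x y : x <= y -> k * (y - x) <= y - x.
  by move=> xy; rewrite ler_piMl// subr_ge0.
have phik s t : s <= t -> k * (t - s) <= phi t - phi s.
  move=> st; rewrite /phi.
  have auv := ak u v (lexx _) uv (lexx _).
  have [su|us] := ltP s u; have [tu|ut] := ltP t u.
  - by have := k1' _ _ st; lra.
  - have := k1' _ _ (ltW su); have [vt|tv] := ltP v t.
      by have := k1' _ _ (ltW vt); lra.
    by have := ak u t (lexx _) ut tv; lra.
  - by exfalso; move: st tu us; lra.
  - have [vs|sv] := ltP v s; have [vt|tv] := ltP v t.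
    + by have := k1' _ _ st; lra.
    + by exfalso; move: st vs tv; lra.
    + by have := k1' _ _ (ltW vt); have := ak s v us sv (lexx _); lra.
    + exact: ak.
have phiu : phi u = a u by apply: phiE; rewrite lexx.
have phiv : phi v = a v by apply: phiE; rewrite lexx andbT.
have auv : a u <= a v.
  by rewrite -phiu -phiv; exact: (expanding_nondecreasing k0 phik).
have gE (h : R -> R) : \int[leb]_(t in `[u, v]) h (a t) = \int[leb]_(t in `[u, v]) h (phi t).
  by apply: eq_Rintegral => t; rewrite inE/= in_itv/= => tuv; rewrite phiE.
have mphi := expanding_measurable k0 phik.
split.
  by rewrite gE -phiu -phiv; exact: expanding_integral_le.
have := expanding_integral_le k0 phik (measurable_onem mg) (unit_onem g01) uv.
have mgp : measurable_fun setT (g \o phi) by apply: measurableT_comp.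
have O (w z : R) (h : R -> R) : w <= z -> measurable_fun setT h -> (forall t, 0 <= h t <= 1) ->
    \int[leb]_(t in `[w, z]) (1 - h t) = (z - w) - \int[leb]_(t in `[w, z]) h t.
  move=> wz mh h01.
  rewrite (@Rintegral_onem _ _ _ leb `[w, z]%classic h (measurable_itv _) (leb_itvcc_lty w z))//.
  by rewrite (_ : fine _ = z - w)// -[RHS]/(fine (z - w)%:E) -leb_itvcc.
have := O u v _ uv mgp (fun t => g01 (phi t)); rewrite /= => ->.
by rewrite O ?phiu ?phiv// gE.
Qed.

(** For a translation [k = 1], and the two bounds of [expanding_integral_itv] meet. *)
Lemma Rintegral_shift (g : R -> R) (r u v : R) : u <= v ->
  measurable_fun setT g -> (forall t, 0 <= g t <= 1) ->
  \int[leb]_(t in `[u, v]) g (t + r) = \int[leb]_(t in `[u + r, v + r]) g t.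
Proof.
move=> uv mg g01.
have [|s t _ _ _|] := @expanding_integral_itv (fun t => t + r) g 1 u v _ uv _ mg g01.
- by rewrite ltr01 lexx.
- by rewrite mul1r; lra.
by rewrite invr1 !mul1r; lra.
Qed.
End Expanding.

(** * Averages along almost linear time changes *)

Section AlmostLinear.
Context {R : realType}.
Local Notation leb := (@lebesgue_measure R).

(** A lower bound on local difference quotients passes to all increments, by a
    supremum argument; it applies to derivatives that are one-sided at the
    endpoints. *)
Lemma local_slope_expanding (u1 u2 m : R) (a : R -> R) :
  (forall x, u1 <= x <= u2 -> exists2 d : R, 0 < d &
     forall q, u1 <= q <= u2 -> q != x -> `|x - q| < d -> m < (a q - a x) / (q - x)) ->
  forall s t, u1 <= s -> s <= t -> t <= u2 -> m * (t - s) <= a t - a s.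
Proof.
move=> H s t us st tu.
pose b r := a r - m * r.
suff : b s <= b t by rewrite /b; lra.
have Hb x : u1 <= x <= u2 -> exists2 d : R, 0 < d &
    forall q, u1 <= q <= u2 -> `|x - q| < d -> (x <= q -> b x <= b q) /\ (q <= x -> b q <= b x).
  move=> /H[d d0 Hd]; exists d => // q quu qd.
  have [->|qx] := eqVneq q x; first by split.
  have := Hd _ quu qx qd; rewrite /b; split => [xq|qx'].
    have {}xq : x < q by rewrite lt_neqAle eq_sym qx.
    by move: H0; rewrite ltr_pdivlMr ?subr_gt0//; lra.
  have {}xq : q < x by rewrite lt_neqAle qx.
  by move: H0; rewrite ltr_ndivlMr ?subr_lt0//; lra.
(* The supremum of the times up to which [b] stays above [b s] is [t]. *)
pose S := [set r | s <= r <= t /\ forall q, s <= q <= r -> b s <= b q].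
have Ss : S s by split; [rewrite lexx st|move=> q; rewrite -eq_le => /eqP ->].
have hS : has_sup S by split; [exists s|exists t => r [/andP[]]].
pose r0 := sup S.
have sr0 : s <= r0 by apply: sup_upper_bound.
have r0t : r0 <= t by apply: ge_sup; [exists s|move=> r [/andP[]]].
have r0u : u1 <= r0 <= u2 by rewrite (le_trans us sr0) (le_trans r0t tu).
have [d d0 Hd] := Hb _ r0u.
have below q : s <= q -> q < r0 -> b s <= b q.
  move=> sq qr0; have e0 : 0 < r0 - q by rewrite subr_gt0.
  have [r [rst rS] rq] := sup_adherent e0 hS.
  by apply: rS; rewrite sq ltW//; move: rq; rewrite -/r0; lra.
have br0 : b s <= b r0.
  have [->//|nsr0] := eqVneq s r0.
  have sr0' : s < r0 by rewrite lt_neqAle nsr0.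
  pose q := Num.max s (r0 - d / 2).
  have qr0 : q < r0 by rewrite gt_max sr0'/=; lra.
  have sq : s <= q by rewrite le_max lexx.
  have qd : r0 - d / 2 <= q by rewrite le_max lexx orbT.
  apply: le_trans (below _ sq qr0) _; apply: (Hd q _ _).2; last exact: ltW.
    by rewrite (le_trans us sq) (le_trans (ltW qr0))//; case/andP: r0u.
  by rewrite ger0_norm; lra.
have [r0t'|tr0] := ltP r0 t; last by have <- : r0 = t by apply/eqP; rewrite eq_le r0t.
exfalso; pose q := Num.min t (r0 + d / 2).
have r0q : r0 < q by rewrite lt_min r0t'/=; lra.
have qt : q <= t by rewrite ge_min lexx.
have qd : q <= r0 + d / 2 by rewrite ge_min lexx orbT.
suff : S q by move=> /(sup_upper_bound hS); rewrite leNgt r0q.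
split=> [|p /andP[sp pq]]; first by rewrite (le_trans sr0 (ltW r0q)).
have [pr0|r0p] := ltP p r0; first exact: below.
apply: (le_trans br0); apply: (Hd p _ _).1 => //.
  by rewrite (le_trans us sp)/=; lra.
by rewrite ler0_norm; lra.
Qed.

Lemma SAL_expanding (u1 u2 e : R) (a : R -> R) (U : set R) :
  SAL u1 u2 a U e ->
  forall s t, u1 <= s -> s <= t -> t <= u2 -> (1 - e) * (t - s) <= a t - a s.
Proof.
move=> [a' [[da _] _ _ a'b]]; apply: local_slope_expanding => x xu.
have xI : x \in `[u1, u2] by rewrite in_itv.
have /andP[ea' _] := a'b _ xI.
have := da _ xI; move/cvgr_gt => /(_ _ ea').
rewrite near_withinE /dnbhs near_withinE => /nbhs_ballP[d /= d0 Hd].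
exists d => // q qu qx xq; apply: Hd => //.
Qed.

(** The change of time expands by at least [1 - e], which bounds
    [g (a t)] and [1 - g (a t)] by integrals over the image interval
    [[a u1, a u2]]; its endpoints differ from [u1] and [u2] by at most
    [e * (u2 - u1)]. *)
Lemma SAL_compare (u1 u2 e : R) (a : R -> R) (U : set R) (g : R -> R) :
  u1 <= u2 -> 0 < e <= 1 / 2 -> SAL u1 u2 a U e ->
  measurable_fun setT g -> (forall t, 0 <= g t <= 1) ->
  `|\int[leb]_(t in `[u1, u2]) g (a t) - \int[leb]_(t in `[u1, u2]) g t| <=
  8 * e * (u2 - u1).
Proof.
move=> uu /andP[e0 e1] sal mg g01.
have ex := SAL_expanding sal.
have [_ [_ _ [a1 a2] _]] := sal.
have k01 : 0 < 1 - e <= 1 by apply/andP; split; lra.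
have [i1 i2] := expanding_integral_itv k01 uu ex mg g01.
have auu : a u1 <= a u2.
  rewrite -subr_ge0; apply: le_trans (ex _ _ (lexx _) uu (lexx _)).
  by rewrite mulr_ge0 ?subr_ge0//; lra.
have /andP[G0 G1] := unit_Rintegral_itv mg g01 auu.
have l1 := primitive_lip mg g01 u1 (a u1).
have l2 := primitive_lip mg g01 u2 (a u2).
have p1 := primitiveB mg g01 auu; have p2 := primitiveB mg g01 uu.
have Kle X : 0 <= X -> (1 - e)^-1 * X <= X + 2 * e * X.
  move=> X0; rewrite mulrC ler_pdivrMr; last by lra.
  have eX : 0 <= e * X by rewrite mulr_ge0// ltW.
  have : e * (e * X) <= 1 / 2 * (e * X) by rewrite ler_wpM2r.
  lra.
have K1 := Kle _ G0.
have G2 : 0 <= a u2 - a u1 - \int[leb]_(t in `[a u1, a u2]) g t by rewrite subr_ge0.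
have K2 := Kle _ G2.
move: a1 a2 l1 l2 i1 i2 K1 K2 p1 p2 G0 G1 G2.
set IG := \int[leb]_(t in `[a u1, a u2]) g t.
set I := \int[leb]_(t in `[u1, u2]) g t.
set J := \int[leb]_(t in `[u1, u2]) g (a t).
move: (primitive g (a u1)) (primitive g (a u2)) (primitive g u1) (primitive g u2) => q1 q2 q3 q4.
set L := u2 - u1.
rewrite !ler_norml => a1 a2 l1 l2 i1 i2 K1 K2 p1 p2 G0 G1 G2.
have e2 : e * e <= e / 2 by nra.
have L0 : 0 <= L by rewrite subr_ge0.
have dL : a u2 - a u1 <= 2 * L by rewrite /L in a1 a2 *; nra.
have e3 : 2 * e * IG <= 4 * e * L by nra.
have e4 : 2 * e * (a u2 - a u1 - IG) <= 4 * e * L - 2 * e * IG by nra.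
have e5 : 0 <= e * IG by nra.
have l1' : `|a u1 - u1| <= e * L by rewrite ler_norml.
have l2' : `|a u2 - u2| <= e * L by rewrite ler_norml.
have /andP[l11 l12] := l1; have /andP[l21 l22] := l2.
have dL2 : a u2 - a u1 <= L + 2 * e * L by rewrite /L in a1 a2 *; nra.
by apply/andP; split; lra.
Qed.

Lemma Rintegral_close d (T : measurableType d) (mu : {measure set T -> \bar R})
    (D : set T) (g h : T -> R) (w : R) :
  measurable D -> (mu D < +oo)%E -> mu.-integrable D (EFin \o g) ->
  mu.-integrable D (EFin \o h) -> (forall t, D t -> `|g t - h t| <= w) ->
  `|\int[mu]_(t in D) g t - \int[mu]_(t in D) h t| <= w * fine (mu D).
Proof.
move=> mD muD ig ih gh; rewrite -RintegralB//.
have iB : mu.-integrable D (EFin \o (fun t => g t - h t)).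
  rewrite (_ : _ \o _ = (EFin \o g) \- (EFin \o h))%E; first exact: integrableB.
  by apply/funext => t /=; rewrite EFinB.
apply: le_trans (le_normr_Rintegral mD iB) _.
rewrite -Rintegral_cst//; apply: le_Rintegral => //.
  rewrite (_ : _ \o _ = abse \o (EFin \o (fun t => g t - h t)))//.
  exact: integrable_abse.
apply: measurable_bounded_integrable => //; exists `|w|; split => // M wM x _ /=.
exact: ltW.
Qed.

Lemma unit_integrable_itv (i : interval R) (lo hi : R) (g : R -> R) :
  [set` i] `<=` `[lo, hi] ->
  measurable_fun [set` i] g -> (forall t, 0 <= g t <= 1) ->
  leb.-integrable [set` i] (EFin \o g).
Proof.
move=> ilh mg g01; apply: measurable_bounded_integrable => //.
  by apply: le_lt_trans (leb_itvcc_lty lo hi); apply: le_measure; rewrite ?inE.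
exists 1; split => // M M1 x _ /=.
by have /andP[g0 g1] := g01 x; rewrite ger0_norm// (le_trans g1)// ltW.
Qed.

Lemma Rintegral_itvoo_cc (lo hi : R) (g : R -> R) :
  measurable_fun setT g -> (forall t, 0 <= g t <= 1) ->
  \int[leb]_(t in `]lo, hi[) g t = \int[leb]_(t in `[lo, hi]) g t.
Proof.
move=> mg g01; rewrite Rintegral_itv_bndo_bndc; last first.
  apply: (@unit_integrable_itv _ lo hi) => //; last exact: measurable_funTS.
  exact: subset_itv_oo_cc.
rewrite Rintegral_itv_obnd_cbnd//.
apply: (@unit_integrable_itv _ lo hi) => //; last exact: measurable_funTS.
exact: subset_itv_oc_cc.
Qed.

(** On each interval of [U] the change of time is a translation, so the two
    primitives have increments differing by at most [w] times the length; summing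
    over consecutive intervals, the errors come from the gaps and from the
    jumps of the translation lengths. *)
Lemma PAL_compare (u1 u2 c e w : R) (a : R -> R) (U : set R) (g1 g2 : R -> R) :
  u1 < u2 -> 0 < e < 1 -> 0 < c -> 0 <= w -> PAL u1 u2 a U c e -> U `<=` `[u1, u2] ->
  measurable_fun setT g1 -> (forall t, 0 <= g1 t <= 1) ->
  measurable_fun setT g2 -> (forall t, 0 <= g2 t <= 1) ->
  (forall t, U t -> `|g1 t - g2 (a t)| <= w) ->
  `|\int[leb]_(t in `[u1, u2]) g1 t - \int[leb]_(t in `[u1, u2]) g2 t| <=
  (w + 4 * e + 2 * e / c) * (u2 - u1).
Proof.
move=> uu /andP[e0 e1] c0 w0 [v [lo [hi [r [[lohi hilo UE vL UL] [ar r0 rr]]]]]] Usub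
  mg1 g101 mg2 g201 g12.
set L := u2 - u1 in vL UL r0 *.
have L0 : 0 < L by rewrite subr_gt0.
have v0 : (0 < v)%N.
  rewrite lt0n; apply/eqP => v0; move: UL; rewrite UE v0.
  rewrite (_ : `I_0 = set0) ?bigcup_set0 ?measure0; last by apply/seteqP; split.
  by rewrite lte_fin ltNge mulr_ge0// ltW// subr_gt0.
have Ui i t : (i < v)%N -> lo i < t < hi i -> U t.
  by move=> iv lth; rewrite UE; exists i => //=; rewrite in_itv.
have ulo i : (i < v)%N -> u1 <= lo i.
  move=> iv; rewrite leNgt; apply/negP => lou.
  have lh := lohi _ iv; pose m := Num.min u1 (hi i).
  have m1 : lo i < m by rewrite lt_min lou.
  have m2 : m <= u1 by rewrite ge_min lexx.
  have m3 : m <= hi i by rewrite ge_min lexx orbT.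
  have /Usub : U ((lo i + m) / 2) by apply: (Ui i) => //; apply/andP; split; lra.
  by rewrite /= in_itv/= => /andP[]; lra.
have hiu i : (i < v)%N -> hi i <= u2.
  move=> iv; rewrite leNgt; apply/negP => lou.
  have lh := lohi _ iv; pose m := Num.max u2 (lo i).
  have m1 : m < hi i by rewrite gt_max lou.
  have m2 : u2 <= m by rewrite le_max lexx.
  have m3 : lo i <= m by rewrite le_max lexx orbT.
  have /Usub : U ((hi i + m) / 2) by apply: (Ui i) => //; apply/andP; split; lra.
  by rewrite /= in_itv/= => /andP[]; lra.
pose H1 := primitive g1; pose H2 := primitive g2.
have seg i : (i < v)%N ->
  `|(H1 (hi i) - H1 (lo i)) - (H2 (hi i + r i) - H2 (lo i + r i))| <= w * (hi i - lo i).
  move=> iv; have lh := ltW (lohi _ iv).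
  have mg2r : measurable_fun setT (fun t : R => g2 (t + r i)).
    by apply: (measurableT_comp mg2); exact: measurable_funD.
  rewrite /H1 /H2 !primitiveB ?lerD2r// -Rintegral_shift// -!Rintegral_itvoo_cc//.
  rewrite (_ : hi i - lo i = fine (leb `]lo i, hi i[%classic)); last first.
    by rewrite lebesgue_measure_itv/= lte_fin lohi.
  apply: Rintegral_close => //.
  - by rewrite /= lebesgue_measure_itv/= lte_fin lohi// -EFinB ltry.
  - apply: (@unit_integrable_itv _ (lo i) (hi i)) => //; last exact: measurable_funTS.
    exact: subset_itv_oo_cc.
  - apply: (@unit_integrable_itv _ (lo i) (hi i)) => //; last exact: measurable_funTS.
    exact: subset_itv_oo_cc.
  - move=> t; rewrite /= in_itv/= => lth; rewrite -(ar i)//.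
    by apply: g12; exact: (Ui i).
have lip1 := primitive_lip mg1 g101; have lip2 := primitive_lip mg2 g201.
(* Each passage from one interval to the next costs at most twice the gap, plus
   the jump [e] of the translation length. *)
have tele k : (k < v)%N ->
    `|(H1 (hi k) - H1 (lo 0%N)) - (H2 (hi k + r k) - H2 (lo 0%N + r 0%N))| <=
    w * (hi k - lo 0%N) +
    2 * (hi k - lo 0%N - \sum_(i < k.+1) (hi i - lo i)) + k%:R * e /\
    `|r k| <= e * L + k%:R * e.
  elim: k => [_|k IH kv].
    rewrite big_ord1 subrr mulr0 mul0r !addr0; split; first exact: seg.
    exact: r0.
  have kv' := ltnW kv; have [I1 I2] := IH kv'.
  have s1 := seg _ kv; have hl := hilo _ kv; have rk := rr _ kv.
  have l1 := lip1 (hi k) (lo k.+1).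
  have l2 := lip2 (hi k + r k) (lo k.+1 + r k.+1).
  rewrite -/H1 in l1; rewrite -/H2 in l2.
  rewrite big_ord_recr/= -(natr1 k).
  have wg : 0 <= w * (lo k.+1 - hi k) by rewrite mulr_ge0// subr_ge0.
  move: I1 I2 s1 rk l1 l2.
  set P1 := H1 (hi k); set P2 := H1 (lo k.+1); set P3 := H1 (hi k.+1).
  set Q1 := H2 (hi k + _); set Q2 := H2 (lo k.+1 + _); set Q3 := H2 (hi k.+1 + _).
  rewrite (ger0_norm (x := lo k.+1 - hi k)) ?subr_ge0//.
  set sg := \sum_(_ < _) _.
  move=> I1 I2 s1 rk l1 l2.
  have l3 : `|lo k.+1 + r k.+1 - (hi k + r k)| <= (lo k.+1 - hi k) + e.
    rewrite (_ : _ - _ = (lo k.+1 - hi k) + (r k.+1 - r k)); last by ring.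
    rewrite (le_trans (ler_normD _ _))// (ger0_norm (x := lo k.+1 - hi k)) ?subr_ge0//.
    by rewrite lerD2l ltW.
  split; last first.
    rewrite -[r k.+1](subrK (r k)) (le_trans (ler_normD _ _))//.
    by rewrite mulrDl mul1r; lra.
  have {l2 l3} l2 := le_trans l2 l3.
  move: I1 s1 l1 l2; rewrite !ler_norml.
  move=> /andP[? ?] /andP[? ?] /andP[? ?] /andP[? ?].
  by rewrite mulrDl mul1r; apply/andP; split; lra.
have vK : (v.-1 < v)%N by rewrite prednK.
have [t1 t2] := tele _ vK; rewrite prednK// in t1.
(* The gaps have total length at most [e * L], and [v <= L / c] bounds the
   total jump by [e / c * L]. *)
have sumU : (1 - e) * L <= \sum_(i < v) (hi i - lo i).
  rewrite -lee_fin; apply: le_trans (ltW UL) _.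
  rewrite UE bigcup_mkord.
  have := @Boole_inequality _ _ _ leb (fun i => `]lo i, hi i[%classic) v.
  move=> /(_ (fun i _ => measurable_itv _)) B; apply: (le_trans B).
  rewrite -sumEFin; apply: lee_sum => i _.
  by rewrite /= lebesgue_measure_itv/= lte_fin lohi// EFinB.
have vR : v.-1%:R <= L / c.
  by apply: le_trans vL; rewrite ler_nat leq_pred.
have ve : v.-1%:R * e <= e / c * L.
  by rewrite (_ : e / c * L = L / c * e); [rewrite ler_wpM2r// ltW|ring].
have b1 := ulo _ v0; have b2 := hiu _ vK.
have m1 := lip1 u1 (lo 0%N); have m2 := lip1 (hi v.-1) u2.
have m3 := lip2 u1 (lo 0%N + r 0%N); have m4 := lip2 (hi v.-1 + r v.-1) u2.
have m5 : `|lo 0%N + r 0%N - u1| <= (lo 0%N - u1) + e * L.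
  rewrite addrAC (le_trans (ler_normD _ _))// (ger0_norm (x := lo _ - u1)) ?subr_ge0//.
  by rewrite lerD2l.
have m6 : `|u2 - (hi v.-1 + r v.-1)| <= (u2 - hi v.-1) + (e * L + v.-1%:R * e).
  rewrite opprD addrA (le_trans (ler_normD _ _))// normrN.
  by rewrite (ger0_norm (x := u2 - _)) ?subr_ge0// lerD2l.
have {m3 m5} m3 := le_trans m3 m5; have {m4 m6} m4 := le_trans m4 m6.
rewrite (ger0_norm (x := lo 0%N - u1)) ?subr_ge0// in m1.
rewrite (ger0_norm (x := u2 - _)) ?subr_ge0// in m2.
have wl : w * (hi v.-1 - lo 0%N) <= w * L by rewrite ler_wpM2l// lerB.
rewrite -!primitiveB// ?(ltW uu)// -/H1 -/H2.
move: m1 m2 m3 m4 t1; rewrite -/H1 -/H2 !ler_norml.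
move=> /andP[? ?] /andP[? ?] /andP[? ?] /andP[? ?] /andP[? ?].
rewrite (_ : (w + _ + _) * L = w * L + 4 * (e * L) + 2 * (e / c * L)); last by ring.
have LE : L = u2 - u1 by [].
by apply/andP; split; lra.
Qed.

(** In the smooth case [U] is the whole interval, so [g1] may first be replaced by
    [g2 \o a]; the quotient [e / c] comes from the piecewise case, where up to
    [(u2 - u1) / c] jumps of size [e] add up. *)
Lemma good_triple_compare (u1 u2 c e w : R) (a : R -> R) (U : set R) (g1 g2 : R -> R) :
  u1 < u2 -> 0 < e <= 1 / 2 -> 0 < c < 1 -> 0 <= w -> good_triple u1 u2 a U c e ->
  measurable_fun setT g1 -> (forall t, 0 <= g1 t <= 1) ->
  measurable_fun setT g2 -> (forall t, 0 <= g2 t <= 1) ->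
  (forall t, U t -> `|g1 t - g2 (a t)| <= w) ->
  `|\int[leb]_(t in `[u1, u2]) g1 t - \int[leb]_(t in `[u1, u2]) g2 t| <=
  (w + 8 * (e / c)) * (u2 - u1).
Proof.
move=> uu /andP[e0 e1] /andP[c0 c1] w0 [ma mU Usub PS] mg1 g101 mg2 g201 g12.
have L0 : 0 < u2 - u1 by rewrite subr_gt0.
have ec : e <= e / c by rewrite ler_pdivlMr// ler_piMr// ltW.
case: PS => [pal|sal].
  apply: le_trans (PAL_compare uu _ c0 w0 pal Usub mg1 g101 mg2 g201 g12) _.
    by rewrite e0/=; lra.
  by rewrite ler_wpM2r ?(ltW L0)// -mulrA; lra.
have [_ [_ UE _ _]] := sal.
have := @SAL_compare _ _ _ _ _ g2 (ltW uu) _ sal mg2 g201; rewrite e0 => /(_ e1) s1.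
have ie (h : R -> R) : measurable_fun `[u1, u2] h -> (forall t, 0 <= h t <= 1) ->
    leb.-integrable `[u1, u2] (EFin \o h).
  by move=> mh h01; exact: (@unit_integrable_itv _ u1 u2).
have s2 : `|\int[leb]_(t in `[u1, u2]) g1 t - \int[leb]_(t in `[u1, u2]) g2 (a t)| <=
    w * (u2 - u1).
  have -> : u2 - u1 = fine (leb `[u1, u2]%classic) by rewrite leb_itvcc// ltW.
  apply: Rintegral_close => //.
  - exact: leb_itvcc_lty.
  - by apply: ie => //; exact: measurable_funTS.
  - by apply: (ie (g2 \o a)) => [|t]; [exact: measurableT_comp mg2 ma|exact: g201].
  - by move=> t tU; apply: g12; rewrite UE.
apply: le_trans (ler_distD (\int[leb]_(t in `[u1, u2]) g2 (a t)) _ _) _.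
apply: le_trans (lerD s2 s1) _; rewrite -mulrDl ler_wpM2r ?(ltW L0)// lerD2l; lra.
Qed.
End AlmostLinear.

(** * The maximal ergodic theorem *)

Section BoundedIntegral.
Context {d : measure_display} {T : measurableType d} {R : realType}.
Variable mu : {finite_measure set T -> \bar R}.

Lemma bounded_integrable (D : set T) (g : T -> R) (K : R) :
  measurable D -> measurable_fun setT g -> (forall z, `|g z| <= K) ->
  mu.-integrable D (EFin \o g).
Proof.
move=> mD mg gK; apply: measurable_bounded_integrable => //.
- by rewrite -ge0_fin_numE// fin_num_measure.
- exact: measurable_funTS.
- by exists K; split => [|M /ltW KM x _ /=]; [exact: num_real|exact: le_trans (gK x) KM].
Qed.

Lemma bounded_Rintegral_cvg (D : set T) (f : (T -> R)^nat) (g : T -> R) (K : R) :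
  measurable D -> (forall n, measurable_fun setT (f n)) -> measurable_fun setT g ->
  (forall n z, `|f n z| <= K) ->
  {ae mu, forall z, D z -> f n z @[n --> \oo] --> g z} ->
  \int[mu]_(z in D) f n z @[n --> \oo] --> \int[mu]_(z in D) g z.
Proof.
move=> mD mf mg fK fg.
have [|||||ig _ h] := @dominated_convergence _ _ _ mu D mD
    (fun n => EFin \o f n) (EFin \o g) (cst K%:E).
- by move=> n; apply/measurable_EFinP; exact: measurable_funTS.
- by apply/measurable_EFinP; exact: measurable_funTS.
- by apply: filterS fg => z H Dz; apply: cvg_EFin; [exact: nearW|exact: H].
- apply: (bounded_integrable (K := `|K|) mD (measurable_cst K)) => z.
  exact: lexx.
- by apply: aeW => z n _; rewrite /= lee_fin.
apply: fine_cvg; rewrite fineK; first exact: h.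
exact: (integrable_fin_num mD ig).
Qed.

Lemma Rintegral_patch (D : set T) (g : T -> R) :
  \int[mu]_z (g \_ D) z = \int[mu]_(z in D) g z.
Proof. by rewrite [RHS]Rintegral_mkcond. Qed.

End BoundedIntegral.

Section MeasurePreserving.
Context {d : measure_display} {T : measurableType d} {R : realType}.
Variables (mu : probability T R) (tau : T -> T).
Hypothesis mtau : measurable_fun setT tau.
Hypothesis tau_preserving : forall A, measurable A -> mu (tau @^-1` A) = mu A.

Lemma Rintegral_preserving (D : set T) (g : T -> R) (K : R) :
  measurable D -> measurable_fun setT g -> (forall z, `|g z| <= K) ->
  \int[mu]_(z in tau @^-1` D) g (tau z) = \int[mu]_(z in D) g z.
Proof.
move=> mD mg gK; congr fine.
have mtD : measurable (tau @^-1` D) by rewrite -[X in measurable X]setTI; exact: mtau.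
rewrite -(integral_pushforward mtau (mu := mu) (D := D) (f := EFin \o g))//.
- by apply: eq_measure_integral => A mA _; exact: tau_preserving.
- exact/measurable_EFinP.
- exact: (@bounded_integrable _ _ _ mu _ (g \o tau) K mtD
    (measurableT_comp mg mtau) (fun z => gK (tau z))).
Qed.

Definition birkhoff_sum (F : T -> R) (n : nat) (z : T) : R :=
  \sum_(i < n) F (iter i tau z).

Lemma birkhoff_sumS F n z :
  birkhoff_sum F n.+1 z = F z + birkhoff_sum F n (tau z).
Proof.
rewrite /birkhoff_sum big_ord_recl/=; congr (_ + _).
by apply: eq_bigr => i _; rewrite -iterSr.
Qed.

Fixpoint max_sum (g : T -> R) (n : nat) (z : T) : R :=
  if n is n'.+1 then Num.max 0 (g z + max_sum g n' (tau z)) else 0.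

Lemma max_sum_ge0 g n z : 0 <= max_sum g n z.
Proof. by case: n => //= n; rewrite le_max lexx. Qed.

Lemma max_sum_leS g n z : max_sum g n z <= max_sum g n.+1 z.
Proof.
elim: n z => [|n IH] z; first exact: max_sum_ge0.
by rewrite /= ge_max !le_max lexx/= lerD2l [X in _ || X]IH orbT.
Qed.

Lemma max_sum_bounded (g : T -> R) n z (K : R) : (forall z, `|g z| <= K) ->
  `|max_sum g n z| <= n%:R * K.
Proof.
move=> gK; elim: n z => [|n IH] z; first by rewrite /= normr0 mul0r.
rewrite ger0_norm ?max_sum_ge0//= ge_max; apply/andP; split.
  by rewrite mulr_ge0//; exact: le_trans (gK z).
rewrite -natr1 mulrDl mul1r addrC lerD//.
  by apply: le_trans (IH (tau z)); exact: ler_norm.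
by apply: le_trans (gK z); exact: ler_norm.
Qed.

Lemma measurable_max_sum g n : measurable_fun setT g ->
  measurable_fun setT (max_sum g n).
Proof.
move=> mg; elim: n => [|n IH] /=; first exact: measurable_cst.
apply: measurable_maxr; first exact: measurable_cst.
by apply: measurable_funD => //; exact: measurableT_comp IH mtau.
Qed.

Lemma birkhoff_sum_le_max_sum g n k z : (k <= n)%N ->
  birkhoff_sum g k z <= max_sum g n z.
Proof.
elim: n k z => [|n IH] [|k] z // kn; rewrite ?birkhoff_sumS.
- by rewrite /birkhoff_sum big_ord0.
- by rewrite /birkhoff_sum big_ord0 max_sum_ge0.
- by rewrite /= le_max lerD2l IH ?orbT.
Qed.

(** Garsia's argument: where the maximum [M] of the partial sums is positive, it is
    attained after at least one step, so [g >= M - M \o tau] there; elsewhere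
    [M] vanishes and [M - M \o tau <= 0].  The integral of [M - M \o tau] is 0. *)
Lemma garsia (g : T -> R) n (K : R) : measurable_fun setT g -> (forall z, `|g z| <= K) ->
  0 <= \int[mu]_(z in [set z | 0 < max_sum g n.+1 z]) g z.
Proof.
move=> mg gK.
set E := [set z | _].
have mM k : measurable_fun setT (max_sum g k) by exact: measurable_max_sum.
have mE : measurable E.
  rewrite /E -[X in measurable X]setTI.
  rewrite (_ : [set z | _] = (max_sum g n.+1) @^-1` `]0, +oo[).
    by apply: (mM n.+1) => //; exact: measurable_itv.
  by apply/seteqP; split => z /=; rewrite in_itv/= andbT.
have bM z := max_sum_bounded n.+1 z gK.
have iM : mu.-integrable setT (EFin \o max_sum g n.+1).
  exact: (@bounded_integrable _ _ _ mu _ _ _ measurableT (mM _) bM).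
have iMt : mu.-integrable setT (EFin \o (max_sum g n.+1 \o tau)).
  exact: (@bounded_integrable _ _ _ mu _ _ _ measurableT
    (measurableT_comp (mM _) mtau) (fun z => bM (tau z))).
have := Rintegral_preserving measurableT (mM n.+1) bM; rewrite preimage_setT => eM.
rewrite -Rintegral_patch.
have mgE : measurable_fun setT (g \_ E).
  by apply/(measurable_restrictT _ mE).1; exact: measurable_funTS.
have bgE z : `|(g \_ E) z| <= K.
  rewrite /patch; case: ifP => _; first exact: gK.
  by rewrite normr0; apply: le_trans (gK z).
rewrite -[leLHS](subrr (\int[mu]_z max_sum g n.+1 z)) -[X in _ - X]eM.
rewrite -RintegralB//.
apply: le_Rintegral => //.
- rewrite (_ : _ \o _ = (EFin \o max_sum g n.+1) \- (EFin \o (max_sum g n.+1 \o tau)))%E.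
    exact: integrableB.
  by apply/funext => z /=; rewrite EFinB.
- exact: (@bounded_integrable _ _ _ mu _ _ _ measurableT mgE bgE).
move=> z _; rewrite /patch; case: ifPn => [|]; rewrite ?inE ?notin_setE => Ez.
  move: Ez; rewrite /E/= lt_max ltxx/= => Ez.
  rewrite (max_r (ltW Ez)) lerBlDr lerD2l.
  exact: max_sum_leS.
have -> : max_sum g n.+1 z = 0.
  by apply/eqP; rewrite eq_le max_sum_ge0 andbT leNgt; apply/negP.
by rewrite sub0r oppr_le0 max_sum_ge0.
Qed.

(** The sets of [garsia] for [g := F \_ J] increase to [J]. *)
Lemma maximal_ergodic (J : set T) (F : T -> R) (K : R) :
  measurable J -> tau @^-1` J = J ->
  measurable_fun setT F -> (forall z, `|F z| <= K) ->
  (forall z, J z -> exists n, 0 < birkhoff_sum F n z) ->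
  0 <= \int[mu]_(z in J) F z.
Proof.
move=> mJ tJ mF FK HJ.
have tJz z : J (tau z) = J z by rewrite -[in RHS]tJ.
pose g := F \_ J.
have mg : measurable_fun setT g.
  by apply/(measurable_restrictT _ mJ).1; exact: measurable_funTS.
have gK z : `|g z| <= K.
  rewrite /g /patch; case: ifP => _; first exact: FK.
  by rewrite normr0; apply: le_trans (FK z).
have gFJ n z : J z -> birkhoff_sum g n z = birkhoff_sum F n z.
  elim: n z => [|n IH] z Jz; first by rewrite /birkhoff_sum !big_ord0.
  by rewrite !birkhoff_sumS IH ?tJz// /g /patch mem_set.
pose E n := [set z | 0 < max_sum g n.+1 z].
have mE n : measurable (E n).
  rewrite /E -[X in measurable X]setTI.
  rewrite (_ : [set z | _] = (max_sum g n.+1) @^-1` `]0, +oo[).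
    by apply: (measurable_max_sum n.+1 mg) => //; exact: measurable_itv.
  by apply/seteqP; split => z /=; rewrite in_itv/= andbT.
rewrite -Rintegral_patch -/g.
have : \int[mu]_z (g \_ (E n)) z @[n --> \oo] --> \int[mu]_z g z.
  apply: (bounded_Rintegral_cvg (K := K)) => //.
  - by move=> n; apply/(measurable_restrictT _ (mE n)).1; exact: measurable_funTS.
  - move=> n z; rewrite /patch; case: ifP => _; first exact: gK.
    by rewrite normr0; apply: le_trans (FK z).
  - apply: aeW => z _.
    have [Jz|nJz] := pselect (J z); last first.
      rewrite (_ : (fun n => _) = cst (g z)); first exact: cvg_cst.
      apply/funext => n; rewrite /patch/=; case: ifP => // _.
      by rewrite /g /patch memNset.
    have [n Hn] := HJ z Jz.
    apply: cvg_near_cst; exists n => // m /= nm; rewrite /patch mem_set//.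
    rewrite /E/=; apply: lt_le_trans (birkhoff_sum_le_max_sum _ _ (leqW nm)).
    by rewrite gFJ.
move/cvgr_to_ge; apply.
by apply: nearW => n; rewrite Rintegral_patch; exact: garsia gK.
Qed.

End MeasurePreserving.

(** * Birkhoff's theorem for bounded functions *)

Section LimSup.
Context {R : realType}.
Implicit Types (u v : (\bar R)^nat).

Lemma limn_esup_le_esups u N : (limn_esup u <= esups u N)%E.
Proof.
rewrite limn_esup_lim (cvg_lim _ (@cvg_esups_inf _ u))//.
by apply: ereal_inf_lbound; exists N.
Qed.

Lemma limn_esup_gt u (b : \bar R) N : (b < limn_esup u)%E ->
  exists2 n, (N <= n)%N & (b < u n)%E.
Proof.
move=> bu; have := lt_le_trans bu (limn_esup_le_esups u N).
by move=> /ereal_sup_gt[_ [n /= Nn <-] bn]; exists n.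
Qed.

Lemma le_limn_esup_near u v :
  (forall e : R, 0 < e -> \forall n \near \oo, (u n <= v n + e%:E)%E) ->
  (limn_esup u <= limn_esup v)%E.
Proof.
move=> H; apply/lee_addgt0Pr => e e0; have [M _ HM] := H _ e0.
rewrite -leeBlDr//.
rewrite [leRHS]limn_esup_lim (cvg_lim _ (@cvg_esups_inf _ v))//.
apply: le_ereal_inf_tmp => _ [N _ <-]; rewrite leeBlDr//.
apply: le_trans (limn_esup_le_esups u (maxn M N)) _.
apply: ge_ereal_sup => _ [n /= Mn <-].
have [Mn' Nn] : (M <= n)%N /\ (N <= n)%N.
  by split; apply: leq_trans Mn; rewrite ?leq_maxl ?leq_maxr.
apply: le_trans (HM n Mn') _; apply: leeD2r.
by apply: ereal_sup_ubound; exists n.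
Qed.

Lemma limn_esup_close (x y : R^nat) : x n - y n @[n --> \oo] --> 0 ->
  limn_esup (EFin \o x) = limn_esup (EFin \o y).
Proof.
move=> xy; apply/eqP; rewrite eq_le; apply/andP; split;
  apply: le_limn_esup_near => e e0.
- have /cvgr0Pnorm_le/(_ _ e0) := xy; apply: filterS => n /=.
  by rewrite ler_norml -EFinD lee_fin => /andP[? ?]; lra.
- have /cvgr0Pnorm_le/(_ _ e0) := xy; apply: filterS => n /=.
  by rewrite ler_norml -EFinD lee_fin => /andP[? ?]; lra.
Qed.

Lemma limn_einf_close (x y : R^nat) : x n - y n @[n --> \oo] --> 0 ->
  limn_einf (EFin \o x) = limn_einf (EFin \o y).
Proof.
move=> xy; rewrite /limn_einf; congr (- _)%E.
rewrite -[LHS]/(limn_esup (EFin \o (fun n => - x n))).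
rewrite -[RHS]/(limn_esup (EFin \o (fun n => - y n))).
apply: limn_esup_close; rewrite (_ : (fun n => _) = (fun n => - (x n - y n))).
  by rewrite -oppr0; exact: cvgN.
by apply/funext => n; rewrite opprB addrC opprK.
Qed.

Lemma bounded_limn_esup (x : R^nat) (K : R) : (forall n, `|x n| <= K) ->
  (- K%:E <= limn_esup (EFin \o x) <= K%:E)%E.
Proof.
move=> xK; apply/andP; split; last first.
  apply: le_trans (limn_esup_le_esups _ 0) _; apply: ge_ereal_sup => _ [n _ <-] /=.
  by rewrite lee_fin; apply: le_trans (xK n); exact: ler_norm.
apply: le_trans (limn_einf_sup _).
rewrite /limn_einf leeN2.
apply: le_trans (limn_esup_le_esups _ 0) _; apply: ge_ereal_sup => _ [n _ <-] /=.
by rewrite lee_fin; apply: le_trans (xK n); rewrite -normrN; exact: ler_norm.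
Qed.

Lemma bounded_limn_esup_fin (x : R^nat) (K : R) : (forall n, `|x n| <= K) ->
  limn_esup (EFin \o x) \is a fin_num.
Proof.
move=> /bounded_limn_esup /andP[infK supK].
rewrite fin_numE -ltNye -ltey; apply/andP; split.
  by apply: lt_le_trans infK; rewrite ltNye.
by apply: le_lt_trans supK _; rewrite ltry.
Qed.

Lemma bounded_limn_einf_fin (x : R^nat) (K : R) : (forall n, `|x n| <= K) ->
  limn_einf (EFin \o x) \is a fin_num.
Proof.
move=> xK; rewrite /limn_einf fin_numN.
rewrite -[X in X \is a _]/(limn_esup (EFin \o (fun n => - x n))).
by apply: (@bounded_limn_esup_fin _ K) => n; rewrite normrN.
Qed.

Lemma cvg_bounded_esup (x : R^nat) (K : R) : (forall n, `|x n| <= K) ->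
  ~ (limn_einf (EFin \o x) < limn_esup (EFin \o x))%E ->
  x n @[n --> \oo] --> fine (limn_esup (EFin \o x)).
Proof.
move=> xK /negP; rewrite -leNgt => le1.
have E : limn_einf (EFin \o x) = limn_esup (EFin \o x).
  by apply/eqP; rewrite eq_le limn_einf_sup.
have fn := bounded_limn_esup_fin xK.
apply: (@fine_cvg _ _ _ _ (EFin \o x)); rewrite fineK//.
apply: (@squeeze_cvge _ _ _ _ (einfs (EFin \o x)) _ (esups (EFin \o x))).
- apply: nearW => n; apply/andP; split.
    by apply: ereal_inf_lbound; exists n => /=.
  by apply: ereal_sup_ubound; exists n => /=.
- by rewrite -[X in _ --> X]E limn_einf_lim; exact: is_cvg_einfs.
- by rewrite limn_esup_lim; exact: is_cvg_esups.
Qed.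

End LimSup.

Lemma negligible_countable d (T : measurableType d) (R : realType)
    (mu : {measure set T -> \bar R}) (I : countType) (B : I -> set T) :
  (forall i, mu.-negligible (B i)) -> mu.-negligible (\bigcup_i B i).
Proof.
move=> nB; pose C n := if unpickle n is Some i then B i else set0.
apply: (@negligibleS _ _ _ _ (\bigcup_n C n)).
  by move=> z [i _ Bz]; exists (pickle i) => //; rewrite /C pickleK.
apply: negligible_bigcup => n; rewrite /C; case: unpickle => [i|]; first exact: nB.
exact: negligible_set0.
Qed.

Section Birkhoff.
Context {d : measure_display} {T : measurableType d} {R : realType}.
Variables (mu : probability T R) (tau : T -> T).
Hypothesis mtau : measurable_fun setT tau.
Hypothesis tau_preserving : forall A, measurable A -> mu (tau @^-1` A) = mu A.

Definition birkhoff_avg (F : T -> R) (n : nat) (z : T) : R :=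
  n%:R^-1 * birkhoff_sum tau F n z.

Definition birkhoff_sup (F : T -> R) (z : T) : \bar R :=
  limn_esup (EFin \o (fun n => birkhoff_avg F n z)).

Definition birkhoff_inf (F : T -> R) (z : T) : \bar R :=
  limn_einf (EFin \o (fun n => birkhoff_avg F n z)).

Section bounded.
Variables (F : T -> R) (K : R).
Hypotheses (mF : measurable_fun setT F) (FK : forall z, `|F z| <= K).

Lemma birkhoff_sum_bounded n z : `|birkhoff_sum tau F n z| <= n%:R * K.
Proof.
apply: le_trans (ler_norm_sum _ _ _) _.
by rewrite -[n in n%:R]card_ord -sum1_card natr_sum mulr_suml ler_sum// => i _; rewrite mul1r.
Qed.

Lemma birkhoff_avg_bounded n z : `|birkhoff_avg F n z| <= K.
Proof.
have K0 : 0 <= K by apply: le_trans (FK z).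
case: n => [|n]; first by rewrite /birkhoff_avg invr0 mul0r normr0.
rewrite normrM ger0_norm ?invr_ge0// mulrC ler_pdivrMr// mulrC.
exact: birkhoff_sum_bounded.
Qed.

Lemma measurable_iter n : measurable_fun setT (iter n tau).
Proof.
elim: n => [|n IH]; first exact: measurable_id.
by rewrite (_ : iter n.+1 tau = tau \o iter n tau)//; exact: measurableT_comp mtau IH.
Qed.

Lemma measurable_birkhoff_avg n : measurable_fun setT (birkhoff_avg F n).
Proof.
apply: measurable_funM => //; apply: measurable_sum => i.
exact: measurableT_comp mF (measurable_iter i).
Qed.

Lemma birkhoff_avg_shift z :
  birkhoff_avg F n (tau z) - birkhoff_avg F n z @[n --> \oo] --> 0.
Proof.
apply/cvgr0Pnorm_le => e e0.
near=> n.
have n0 : (0 < n)%N by near: n; exact: nbhs_infty_gt.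
have K0 : 0 <= K by apply: le_trans (FK z).
rewrite /birkhoff_avg -mulrBr.
have -> : birkhoff_sum tau F n (tau z) - birkhoff_sum tau F n z =
    F (iter n tau z) - F z.
  have := birkhoff_sumS tau F n z.
  by rewrite {1}/birkhoff_sum big_ord_recr/= -/(birkhoff_sum tau F n z); lra.
rewrite normrM ger0_norm ?invr_ge0// mulrC ler_pdivrMr ?ltr0n//.
apply: le_trans (ler_normB _ _) _; apply: le_trans (lerD (FK _) (FK _)) _.
rewrite -ler_pdivrMl// mulrC; near: n; exact: nbhs_infty_ger.
Unshelve. all: by end_near. Qed.

Lemma birkhoff_sup_invariant z : birkhoff_sup F (tau z) = birkhoff_sup F z.
Proof. exact: limn_esup_close (birkhoff_avg_shift z). Qed.

Lemma birkhoff_inf_invariant z : birkhoff_inf F (tau z) = birkhoff_inf F z.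
Proof. exact: limn_einf_close (birkhoff_avg_shift z). Qed.

Lemma measurable_birkhoff_sup : measurable_fun setT (birkhoff_sup F).
Proof.
apply: (measurable_fun_limn_esup (f := fun n z => (birkhoff_avg F n z)%:E)) => n.
by apply/measurable_EFinP; exact: measurable_birkhoff_avg.
Qed.

Lemma birkhoff_avg_gt n z b : (0 < n)%N -> b < birkhoff_avg F n z ->
  0 < birkhoff_sum tau (fun z => F z - b) n z.
Proof.
move=> n0; rewrite /birkhoff_avg mulrC ltr_pdivlMr ?ltr0n// => bn.
rewrite /birkhoff_sum big_split/= sumrN sumr_const card_ord subr_gt0.
by rewrite -mulr_natr.
Qed.

(** The maximal ergodic theorem for [F - b]. *)
Lemma birkhoff_sup_le_integral (J : set T) (b : R) :
  measurable J -> tau @^-1` J = J -> (forall z, J z -> (b%:E < birkhoff_sup F z)%E) ->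
  b * fine (mu J) <= \int[mu]_(z in J) F z.
Proof.
move=> mJ tJ HJ; rewrite -subr_ge0 -Rintegral_cst//.
have iF := @bounded_integrable _ _ _ mu _ _ _ mJ mF FK.
have ib := @bounded_integrable _ _ _ mu _ (cst b) `|b| mJ (measurable_cst b) (fun=> lexx _).
rewrite -RintegralB//.
have mFb : measurable_fun setT (fun z => F z - b) by apply: measurable_funB.
have bFb z : `|F z - b| <= K + `|b|.
  by apply: le_trans (ler_normB _ _) _; rewrite lerD2r.
apply: (maximal_ergodic mtau tau_preserving mJ tJ mFb bFb) => z Jz.
have [n n1 bn] := limn_esup_gt 1 (HJ z Jz).
by exists n; apply: birkhoff_avg_gt.
Qed.

End bounded.

Lemma birkhoff_supN F z : birkhoff_sup (fun z => - F z) z = (- birkhoff_inf F z)%E.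
Proof.
rewrite /birkhoff_inf /limn_einf oppeK /birkhoff_sup; congr limn_esup.
apply/funext => n /=; rewrite /birkhoff_avg /birkhoff_sum sumrN mulrN.
by rewrite EFinN.
Qed.

Lemma birkhoff_inf_ge_integral (F : T -> R) (K : R) (J : set T) (b : R) :
  measurable_fun setT F -> (forall z, `|F z| <= K) ->
  measurable J -> tau @^-1` J = J -> (forall z, J z -> (birkhoff_inf F z < b%:E)%E) ->
  \int[mu]_(z in J) F z <= b * fine (mu J).
Proof.
move=> mF FK mJ tJ HJ.
have mN : measurable_fun setT (fun z => - F z) by apply: measurable_funN.
have NK z : `|- F z| <= K by rewrite normrN.
have := birkhoff_sup_le_integral mN NK (b := - b) mJ tJ.
rewrite mulNr (_ : \int[mu]_(x in J) - F x = - \int[mu]_(x in J) F x).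
  by rewrite lerN2; apply => z Jz; rewrite birkhoff_supN EFinN lteN2; exact: HJ.
rewrite -[RHS]mulN1r -RintegralZl//; last exact: bounded_integrable mF FK.
by apply: eq_Rintegral => z _; rewrite mulN1r.
Qed.

Lemma measurable_birkhoff_inf (F : T -> R) : measurable_fun setT F ->
  measurable_fun setT (birkhoff_inf F).
Proof.
move=> mF.
have -> : birkhoff_inf F = (fun z => - birkhoff_sup (fun z => (- F z)%R) z)%E.
  by apply/funext => z /=; rewrite birkhoff_supN oppeK.
by apply: measurableT_comp => //; apply: measurable_birkhoff_sup; apply: measurable_funN.
Qed.

(** If [q1 < q2] separate the lower from the upper limit on an invariant set [B],
    the two one-sided integral bounds give [q2 * mu B <= q1 * mu B]. *)
Lemma birkhoff_ae_cvg (F : T -> R) (K : R) :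
  measurable_fun setT F -> (forall z, `|F z| <= K) ->
  {ae mu, forall z, birkhoff_avg F n z @[n --> \oo] --> fine (birkhoff_sup F z)}.
Proof.
move=> mF FK.
(* The set where the lower and the upper limit differ is a countable union of
   sets on which two rationals separate them. *)
pose B (p : rat * rat) := [set z | p.1 < p.2 /\
  ((birkhoff_inf F z < (ratr p.1)%:E)%E /\ ((ratr p.2)%:E < birkhoff_sup F z)%E)].
suff nB p : mu.-negligible (B p).
  apply: (@negligibleS _ _ _ _ (\bigcup_p B p)); last exact: negligible_countable.
  move=> z /= Hz; have infsup : (birkhoff_inf F z < birkhoff_sup F z)%E.
    by apply: contrapT => H; apply: Hz; exact: (cvg_bounded_esup (birkhoff_avg_bounded FK ^~ z)).
  have fi := bounded_limn_einf_fin (birkhoff_avg_bounded FK ^~ z).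
  have fs := bounded_limn_esup_fin (birkhoff_avg_bounded FK ^~ z).
  rewrite -/(birkhoff_inf F z) in fi; rewrite -/(birkhoff_sup F z) in fs.
  have : fine (birkhoff_inf F z) < fine (birkhoff_sup F z) by rewrite fine_lt.
  move=> /rat_in_itvoo[q1]; rewrite in_itv/= => /andP[iq1 q1s].
  have /rat_in_itvoo[q2] := q1s; rewrite in_itv/= ltr_rat => /andP[q12 q2s].
  exists (q1, q2) => //; split => //=.
  by rewrite -(fineK fi) -(fineK fs) !lte_fin.
have [p12|p12] := boolP (p.1 < p.2); last first.
  by rewrite (_ : B p = set0); [exact: negligible_set0|apply/seteqP; split => z //= []; rewrite (negbTE p12)].
have iB z : B p (tau z) = B p z.
  by rewrite /B/= (birkhoff_inf_invariant FK) (birkhoff_sup_invariant FK).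
have mB : measurable (B p).
  rewrite (_ : B p = (birkhoff_inf F @^-1` `]-oo, (ratr p.1)%:E[) `&`
      (birkhoff_sup F @^-1` `](ratr p.2)%:E, +oo[)).
    apply: measurableI; rewrite -[X in measurable X]setTI.
      by apply: (measurable_birkhoff_inf mF) => //; exact: emeasurable_itv.
    by apply: (measurable_birkhoff_sup mF) => //; exact: emeasurable_itv.
  apply/seteqP; split => z /=; rewrite !in_itv/= ?andbT; first by case=> _ [].
  by case=> h1 h2; split.
have tB : tau @^-1` B p = B p by apply/funext => z; exact: iB.
exists (B p); split => //.
have h1 := birkhoff_sup_le_integral mF FK mB tB (fun z Bz => Bz.2.2).
have h2 := birkhoff_inf_ge_integral mF FK mB tB (fun z Bz => Bz.2.1).
have := le_trans h1 h2; have p12' : ratr p.1 < ratr p.2 :> R by rewrite ltr_rat.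
rewrite -subr_ge0 -mulrBl => h3.
have f0 : fine (mu (B p)) = 0.
  apply/eqP; rewrite eq_le fine_ge0// andbT leNgt; apply/negP => f0.
  by move: h3; rewrite pmulr_lge0// subr_ge0 leNgt p12'.
by rewrite -[LHS]fineK ?fin_num_measure// f0.
Qed.

(** All averages have the same integral over an invariant set; dominated convergence
    passes this to the limit. *)
Lemma birkhoff_integral (F : T -> R) (K : R) (J : set T) :
  measurable_fun setT F -> (forall z, `|F z| <= K) ->
  measurable J -> tau @^-1` J = J ->
  \int[mu]_(z in J) fine (birkhoff_sup F z) = \int[mu]_(z in J) F z.
Proof.
move=> mF FK mJ tJ.
have mS : measurable_fun setT (fine \o birkhoff_sup F).
  by apply: measurableT_comp => //; exact: measurable_birkhoff_sup.
have cv := bounded_Rintegral_cvg mJ (measurable_birkhoff_avg mF) mS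
  (birkhoff_avg_bounded FK).
have {cv} cv : \int[mu]_(z in J) birkhoff_avg F n z @[n --> \oo] -->
    \int[mu]_(z in J) fine (birkhoff_sup F z).
  apply: cv; have := birkhoff_ae_cvg mF FK; apply: filterS => z Hz _; exact: Hz.
have iF i : \int[mu]_(z in J) F (iter i tau z) = \int[mu]_(z in J) F z.
  elim: i => [//|i IH]; rewrite -[RHS]IH.
  rewrite -(Rintegral_preserving mtau tau_preserving (g := F \o iter i tau) mJ _ (fun z => FK _)).
    by rewrite tJ; apply: eq_Rintegral => z _ /=; rewrite -iterSr.
  exact: measurableT_comp mF (measurable_iter i).
have E n : (0 < n)%N -> \int[mu]_(z in J) birkhoff_avg F n z = \int[mu]_(z in J) F z.
  move=> n0; rewrite /birkhoff_avg RintegralZl//; last first.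
    apply: (@bounded_integrable _ _ _ mu _ _ (n%:R * K) mJ).
      by apply: measurable_sum => i; exact: measurableT_comp mF (measurable_iter i).
    by move=> z; exact: birkhoff_sum_bounded.
  suff -> : \int[mu]_(z in J) birkhoff_sum tau F n z = n%:R * \int[mu]_(z in J) F z.
    by rewrite mulrA mulVf ?mul1r// pnatr_eq0 -lt0n.
  elim: n {n0} => [|n IH].
    by rewrite mul0r /birkhoff_sum; under eq_Rintegral do rewrite big_ord0; rewrite Rintegral_cst// mul0r.
  rewrite /birkhoff_sum; under eq_Rintegral do rewrite big_ord_recr/=.
  rewrite RintegralD//.
  - by rewrite iF -/(birkhoff_sum tau F n) IH -natr1 mulrDl mul1r.
  - apply: (@bounded_integrable _ _ _ mu _ _ (n%:R * K) mJ).
      by apply: measurable_sum => i; exact: measurableT_comp mF (measurable_iter i).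
    by move=> z; exact: birkhoff_sum_bounded.
  - exact: (@bounded_integrable _ _ _ mu _ _ K mJ (measurableT_comp mF (measurable_iter n)) (fun z => FK _)).
apply: (cvg_unique _ cv) => //.
by apply: cvg_near_cst; exists 1%N => // n n1; exact: E.
Qed.

End Birkhoff.

(** * Measures invariant under an ergodic map *)

Definition ergodic_map d (T : measurableType d) (R : realType)
    (mu : probability T R) (tau : T -> T) : Prop :=
  forall J, measurable J -> tau @^-1` J = J -> mu J = 0%E \/ mu J = 1%E.

Lemma Rintegral_indicI d (T : measurableType d) (R : realType)
    (mu : {measure set T -> \bar R}) (D A : set T) :
  measurable D -> measurable A ->
  \int[mu]_(z in D) \1_A z = fine (mu (D `&` A)).
Proof. by move=> mD mA; rewrite /Rintegral integral_indic// setIC. Qed.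

Section ErgodicUniqueness.
Context {d : measure_display} {T : measurableType d} {R : realType}.
Variables (mu : probability T R) (tau : T -> T).
Hypothesis mtau : measurable_fun setT tau.
Hypothesis tau_preserving : forall A, measurable A -> mu (tau @^-1` A) = mu A.
Hypothesis tau_ergodic : ergodic_map mu tau.

Let indic_bounded (A : set T) x : `|\1_A x : R| <= 1.
Proof. by rewrite indicE; case: (_ \in _); rewrite /= ?normr1 ?normr0. Qed.

Let sup_set (A : set T) (b : R) := [set x | (b%:E < birkhoff_sup tau \1_A x)%E].

Let measurable_sup_set A b : measurable A -> measurable (sup_set A b).
Proof.
move=> mA; rewrite (_ : sup_set A b = birkhoff_sup tau \1_A @^-1` `]b%:E, +oo[).
  rewrite -[X in measurable X]setTI.
  apply: (measurable_birkhoff_sup mtau (measurable_indic mA)) => //.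
  exact: emeasurable_itv.
by apply/seteqP; split => x /=; rewrite in_itv/= andbT.
Qed.

Let sup_set_invariant A b : tau @^-1` (sup_set A b) = sup_set A b.
Proof.
by apply/funext => x; rewrite /sup_set/= (birkhoff_sup_invariant tau (indic_bounded A)).
Qed.

(** The set is invariant; if it had full measure, the mean of the indicator of [A]
    would be at least [b]. *)
Lemma ergodic_birkhoff_sup_le (A : set T) (b : R) : measurable A ->
  fine (mu A) < b -> mu (sup_set A b) = 0%E.
Proof.
move=> mA Ab; set J := sup_set A b; have mJ : measurable J by exact: measurable_sup_set.
have [//|mJ1] := tau_ergodic mJ (sup_set_invariant A b).
have := birkhoff_sup_le_integral mtau tau_preserving (measurable_indic mA)
  (indic_bounded A) mJ (sup_set_invariant A b) (b := b).
rewrite mJ1 /= mulr1 Rintegral_indicI// => /(_ (fun x h => h)) bA; exfalso.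
have : fine (mu (J `&` A)) <= fine (mu A).
  apply: fine_le; rewrite ?fin_num_measure//; first exact: measurableI.
  by apply: le_measure; rewrite ?inE//; exact: measurableI.
by move=> /(le_trans bA); rewrite leNgt Ab.
Qed.

Section probability.
Variable m : probability T R.
Hypothesis m_preserving : forall A, measurable A -> m (tau @^-1` A) = m A.
Hypothesis m_ac : forall A, measurable A -> mu A = 0%E -> m A = 0%E.

(** Off a [mu]-null, hence [m]-null set, the averages of the indicator of [A] have
    limits at most about [mu A]; integrating with respect to [m] bounds [m A]. *)
Lemma ergodic_unique_le (A : set T) : measurable A -> fine (m A) <= fine (mu A).
Proof.
move=> mA; apply/ler_addgt0Pr => e e0.
pose b := fine (mu A) + e / 2.
have muJ : mu (sup_set A b) = 0%E by apply: ergodic_birkhoff_sup_le => //; rewrite /b; lra.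
have mJ := measurable_sup_set b mA; have mJ0 := m_ac mJ muJ.
set J := sup_set A b in mJ mJ0 *; pose V := ~` J.
have mV : measurable V by exact: measurableC.
have tV : tau @^-1` V = V by congr (~` _); exact: sup_set_invariant.
have := birkhoff_inf_ge_integral mtau m_preserving (b := fine (mu A) + e)
  (measurable_indic mA) (indic_bounded A) mV tV.
rewrite Rintegral_indicI// probability_setC// mJ0 sube0 mulr1.
have mVA : m (V `&` A) = m A.
  rewrite setIC -setDE measureD//; last by rewrite -ge0_fin_numE// fin_num_measure.
  rewrite -[RHS]sube0; congr (_ - _)%E; rewrite -[LHS]/(m (A `&` J)).
  apply/eqP; rewrite eq_le measure_ge0 andbT -mJ0; apply: le_measure; rewrite ?inE//.
  exact: measurableI.
rewrite -mVA; apply => x /negP; rewrite -leNgt => h; apply: le_lt_trans (limn_einf_sup _) _.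
by apply: le_lt_trans h _; rewrite lte_fin /b; lra.
Qed.

Lemma ergodic_unique (A : set T) : measurable A -> m A = mu A.
Proof.
move=> mA; rewrite -[LHS]fineK ?fin_num_measure// -[RHS]fineK ?fin_num_measure//.
congr _%:E; apply/eqP; rewrite eq_le ergodic_unique_le//=.
have := ergodic_unique_le (measurableC mA).
by rewrite !probability_setC// !fineB ?fin_num_measure//=; lra.
Qed.
End probability.

(** Meant for slices [A |-> rho (W `&` (A `*` B))] of a joining, whose total
    mass is arbitrary: normalisation reduces them to probabilities. *)
Lemma ergodic_proportional (m : {measure set T -> \bar R}) :
  (m setT < +oo)%E -> (forall A, measurable A -> m (tau @^-1` A) = m A) ->
  (forall A, measurable A -> mu A = 0%E -> m A = 0%E) ->
  forall A, measurable A -> m A = (m setT * mu A)%E.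
Proof.
move=> moo m_preserving m_ac A mA.
have mfin : m setT \is a fin_num by rewrite ge0_fin_numE.
have [m0|m0] := eqVneq (m setT) 0%E.
  rewrite m0 mul0e; apply/eqP; rewrite eq_le measure_ge0 andbT -m0.
  by apply: le_measure; rewrite ?inE.
have nE B : mnormalize m mu B = (m B * (fine (m setT))^-1%:E)%E.
  by rewrite /mnormalize (negbTE m0)/= (lt_eqF moo).
have mt0 : fine (m setT) != 0 by rewrite fine_eq0.
have H := @ergodic_unique (mnormalize m mu) _ _ A mA.
rewrite -H; last 2 first.
- move=> B mB; rewrite -[LHS]/(mnormalize m mu _) -[RHS]/(mnormalize m mu _) !nE.
  by rewrite m_preserving.
- move=> B mB B0; rewrite -[LHS]/(mnormalize m mu _) nE.
  by rewrite m_ac// mul0e.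
rewrite -[X in (_ * X)%E]/(mnormalize m mu A) nE muleCA.
have -> : (m setT * (fine (m setT))^-1%:E = 1)%E.
  by rewrite -[X in (X * _)%E](fineK mfin) -EFinM divff.
by rewrite mule1.
Qed.

End ErgodicUniqueness.

(** * Weak mixing makes every time map ergodic *)

Record pmp_flow (R : realType) d (T : measurableType d) (mu : probability T R)
    (phi : R -> T -> T) : Prop := PmpFlow {
  pmp_flow0 : forall z, phi 0 z = z ;
  pmp_flowD : forall s t z, phi (s + t) z = phi s (phi t z) ;
  pmp_flow_measurable :
    measurable_fun [set: measurableTypeR R * T] (fun p => phi p.1 p.2) ;
  pmp_flow_preserving : forall t A, measurable A -> mu (phi t @^-1` A) = mu A }.

Lemma is_flow_pmp (R : realType) d (T : measurableType d) (mu : probability T R)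
    (phi : R -> T -> T) : is_flow mu phi -> pmp_flow mu phi.
Proof. by case=> *; split. Qed.

Section FlowMaps.
Context {R : realType} {d : measure_display} {T : measurableType d}.
Variables (mu : probability T R) (phi : R -> T -> T).
Hypothesis flow : pmp_flow mu phi.

Lemma flow_map_measurable t : measurable_fun setT (phi t).
Proof.
exact: (measurableT_comp (pmp_flow_measurable flow) (pair1_measurable (t : measurableTypeR R))).
Qed.

Lemma flow_orbit_measurable z : measurable_fun setT (fun t : measurableTypeR R => phi t z).
Proof.
exact: (measurableT_comp (pmp_flow_measurable flow) (pair2_measurable z)).
Qed.

Lemma flow_preimage_measurable t A : measurable A -> measurable (phi t @^-1` A).
Proof. by move=> mA; rewrite -[X in measurable X]setTI; exact: flow_map_measurable. Qed.

End FlowMaps.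

Section WeakMixing.
Context {R : realType} {d : measure_display} {T : measurableType d}.
Local Notation leb := (@lebesgue_measure R).
Variables (mu : probability T R) (phi : R -> T -> T).
Hypothesis flow : pmp_flow mu phi.
Hypothesis wm : weakly_mixing mu phi.

(** The averages of a periodic function tend to its mean over a period, so a
    nonnegative one with limit 0 vanishes almost everywhere; the conclusion is
    stated on intervals that exhaust the line. *)
Lemma mean_periodic_eq0 (h : R -> R) (q : R) : 0 < q ->
  measurable_fun setT h -> (forall s, 0 <= h s <= 1) ->
  (forall s, h (s + q) = h s) ->
  (t^-1 * \int[leb]_(s in `[0, t]) h s) @[t --> +oo] --> (0 : R) ->
  forall n : nat, \int[leb]_(s in `[- (n%:R * q), n%:R * q]) h s = 0.
Proof.
move=> q0 mh h01 hq lim0.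
have nq0 n : 0 <= n%:R * q by rewrite mulr_ge0// ltW.
have Sn n : n%:R * q + q = n.+1%:R * q by rewrite -natr1 mulrDl mul1r.
have sh n : \int[leb]_(s in `[n%:R * q, n.+1%:R * q]) h s = \int[leb]_(s in `[0, q]) h s.
  elim: n => [|n IH]; first by rewrite mul0r mul1r.
  rewrite -IH -(Sn n.+1) -[in LHS](Sn n) -(Sn n).
  rewrite -Rintegral_shift ?lerDl ?(ltW q0)//.
  by apply: eq_Rintegral => s _; rewrite hq.
have pos n : \int[leb]_(s in `[0, n%:R * q]) h s = n%:R * \int[leb]_(s in `[0, q]) h s.
  elim: n => [|n IH]; first by rewrite !mul0r set_itv1 Rintegral_set1.
  rewrite (@Rintegral_itv_split _ h mh h01 0 (n%:R * q))//.
    by rewrite IH sh -natr1 mulrDl mul1r.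
  by rewrite -natr1 mulrDl mul1r lerDl ltW.
have I0 : \int[leb]_(s in `[0, q]) h s = 0.
  set I := \int[_]_(_ in _) _.
  have cI : (n.+1%:R * q)^-1 * \int[leb]_(s in `[0, n.+1%:R * q]) h s @[n --> \oo] --> (0 : R).
    apply: (cvg_comp (fun n : nat => n.+1%:R * q) (fun t => t^-1 * \int[leb]_(s in `[0, t]) h s)) lim0.
    apply/cvgryPge => B; near=> n.
    rewrite -ler_pdivrMr//; near: n.
    exists (Num.truncn `|B / q|) => // n /= Bn.
    apply: (le_trans (ler_norm _)); apply: ltW.
    apply: lt_le_trans (truncnS_gt _) _; by rewrite ler_nat ltnS.
  have cE : (fun n : nat => (n.+1%:R * q)^-1 * \int[leb]_(s in `[0, n.+1%:R * q]) h s) = (fun=> q^-1 * I).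
    by apply/funext => n; rewrite pos -/I invfM mulrACA mulVf ?mul1r// pnatr_eq0.
  rewrite cE in cI; have /eqP : q^-1 * I = 0.
    by apply: (cvg_unique _ (cvg_cst _) cI).
  by rewrite mulf_eq0 invr_eq0 gt_eqF//= => /eqP.
move=> n; rewrite (@Rintegral_itv_split _ h mh h01 _ 0) ?oppr_le0//.
rewrite pos I0 mulr0 addr0.
have hn k s : h (s + k%:R * q) = h s.
  by elim: k => [|k IH]; rewrite ?mul0r ?addr0// -natr1 mulrDl mul1r addrA hq.
transitivity (\int[leb]_(s in `[- (n%:R * q), 0]) h (s + n%:R * q)).
  by apply: eq_Rintegral => s _; rewrite hn.
by rewrite Rintegral_shift ?oppr_le0// addNr add0r pos I0 mulr0.
Unshelve. all: by end_near. Qed.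

Section invariant_set.
Variables (q : R) (J : set T).
Hypotheses (q0 : 0 < q) (mJ : measurable J) (qJ : phi q @^-1` J = J).

Let E : set (measurableTypeR R * T) := (fun p => phi p.1 p.2) @^-1` J.

Let mE : measurable E.
Proof. by rewrite -[X in measurable X]setTI; exact: (pmp_flow_measurable flow). Qed.

Let a := fine (mu J).

(** The correlations [mu (A `&` phi s @^-1` J)] are periodic in [s] when [J] is
    invariant under [phi q], so their mean deviation from [mu A * mu J], which
    weak mixing makes tend to 0, is 0. *)
Lemma periodic_correlation (A : set T) : measurable A ->
  {ae leb, forall s, mu (A `&` phi s @^-1` J) = (a%:E * mu A)%E}.
Proof.
move=> mA.
pose g s := fine (mu (A `&` phi s @^-1` J)).
have mAs s : measurable (A `&` phi s @^-1` J).
  by apply: measurableI => //; exact: (flow_preimage_measurable flow).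
have mg : measurable_fun setT (g : measurableTypeR R -> R).
  apply: (measurableT_comp (f := fine)) => //.
  pose C : set (measurableTypeR R * T) := (setT `*` A) `&` E.
  have mC : measurable C by apply: measurableI => //; exact: measurableX.
  have := measurable_fun_xsection mu mC.
  congr measurable_fun; apply/funext => s /=; congr (mu _).
  apply/seteqP; split => x /=; rewrite /xsection/= inE /C/=; first by case=> [[]].
  by case.
have g01 s : 0 <= g s <= 1.
  by rewrite fine_ge0//= -lee_fin fineK ?fin_num_measure// probability_le1.
pose h (s : R) : R := `|g s - fine (mu A) * a|.
have ma01 : 0 <= fine (mu A) * a <= 1.
  rewrite mulr_ge0 ?fine_ge0//=.
  by apply: mulr_ile1; rewrite ?fine_ge0// -lee_fin fineK ?fin_num_measure// probability_le1.
have mh : measurable_fun setT h.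
  by apply: measurableT_comp; [exact: normr_measurable|exact: measurable_funB].
have h01 s : 0 <= h s <= 1.
  by rewrite normr_ge0/= ler_norml; have := g01 s; lra.
have hq s : h (s + q) = h s.
  rewrite /h /g (_ : phi (s + q) @^-1` J = phi s @^-1` J)//.
  by rewrite -[in RHS]qJ; apply/funext => z; rewrite /preimage/= addrC (pmp_flowD flow).
have I0 := mean_periodic_eq0 q0 mh h01 hq (wm mA mJ).
have aen n : {ae leb, forall s, `[- (n%:R * q), n%:R * q]%classic s -> (h s)%:E = 0%E}.
  have mhn : measurable_fun `[- (n%:R * q), n%:R * q] (EFin \o h).
    by apply/measurable_EFinP; exact: measurable_funTS.
  apply: (iffLR (ae_eq_integral_abs leb (measurable_itv _) mhn)) => //=.
  have ih : leb.-integrable `[- (n%:R * q), n%:R * q] (EFin \o h).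
    by apply: unit_integrable => //; exact: leb_itvcc_lty.
  rewrite -[RHS]/(0%:E) -(I0 n) /Rintegral fineK; last exact: integrable_fin_num ih.
  by apply: eq_integral => s _; rewrite /h /= normr_id.
have := ae_foralln aen; apply: filterS => s Hs.
have {Hs} /eqP : (h s)%:E = 0%E.
  apply: (Hs (Num.truncn (`|s| / q)).+1) => /=; rewrite in_itv/= -ler_norml.
  by rewrite -ler_pdivrMr//; apply: ltW; exact: truncnS_gt.
rewrite eqe normr_eq0 subr_eq0 => /eqP gs.
by rewrite -[LHS]fineK ?fin_num_measure// -/(g s) gs EFinM fineK ?fin_num_measure// muleC.
Qed.

(** In the space of pairs [(s, x)] the set [E := phi s x \in J] is independent of
    all rectangles by [periodic_correlation], hence of itself, which forces
    measure 0 or 1. *)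
Lemma weakly_mixing_invariant01 : mu J = 0%E \/ mu J = 1%E.
Proof.
have [a0|a0] := eqVneq a 0.
  by left; rewrite -[LHS]fineK ?fin_num_measure// -/a a0.
right.
have apos : 0 < a by rewrite lt_neqAle eq_sym a0 fine_ge0.
have aV : 0 <= a^-1 by rewrite invr_ge0 ltW.
have muJ : mu J = a%:E by rewrite fineK ?fin_num_measure.
pose m' := mscale (NngNum aV) (mrestr (leb \x mu)%E mE).
have xE I A s : xsection ((I `*` A) `&` E) s = if s \in I then A `&` phi s @^-1` J else set0.
  apply/seteqP; split => x; rewrite /xsection/= inE/=.
    by case=> [[Is Ax]] Ex; rewrite mem_set.
  case: ifPn => //; rewrite inE => Is [Ax Jx].
  by split.
(* On rectangles, [leb \x mu] restricted to [E] is [a] times [leb \x mu]. *)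
have rect I A : measurable I -> measurable A ->
    ((leb \x mu) ((I `*` A) `&` E) = a%:E * (leb I * mu A))%E.
  move=> mI mA.
  rewrite /product_measure1/=.
  transitivity (\int[leb]_(s in I) mu (A `&` phi s @^-1` J))%E.
    rewrite [RHS]integral_mkcond; apply: eq_integral => s _ /=.
    by rewrite xE /patch; case: ifP => // _; rewrite measure0.
  have mAJ : measurable_fun setT (fun s : measurableTypeR R => mu (A `&` phi s @^-1` J)).
    have mC : measurable ((setT `*` A) `&` E) by apply: measurableI => //; exact: measurableX.
    have := measurable_fun_xsection mu mC.
    by congr measurable_fun; apply/funext => s /=; rewrite xE in_setT.
  rewrite (ae_eq_integral (cst (a%:E * mu A)%E))//.
  - by rewrite integral_cst// -muleA [X in (_ * X)%E]muleC.
  - exact: measurable_funS mAJ.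
  - have [N [mN N0 sN]] := periodic_correlation mA; exists N; split => //.
    by apply: subset_trans sN => s /= + H; apply => _; exact: H.
pose C : set (measurableTypeR R * T) := (`[0, 1]%classic `*` setT) `&` E.
have mC : measurable C by apply: measurableI => //; exact: measurableX.
have lC : ((leb \x mu) C = a%:E)%E.
  by rewrite rect// probability_setT mule1 leb_itvcc// subr0 mule1.
have m'E B : m' B = (a^-1%:E * (leb \x mu) (B `&` E))%E by [].
(* Both measures agree on the part [C] of [E] above the unit interval: one gives
   it mass [a], the other [a^-1 * a]. *)
have H : ((leb \x mu) C = m' C)%E.
  apply: (@product_measure_unique _ _ _ _ _ leb mu m' _ C mC) => I A mI mA.
  by rewrite -[LHS]/(m' (I `*` A)) m'E rect// muleA -EFinM mulVf// mul1e.
move: H; rewrite lC m'E (_ : C `&` E = C) ?lC; last by rewrite /C -setIA setIid.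
by rewrite muJ => ->; rewrite -EFinM mulVf.
Qed.
End invariant_set.

Lemma weakly_mixing_ergodic_map (q : R) : q != 0 -> ergodic_map mu (phi q).
Proof.
move=> q0 J mJ qJ; have [qp|qn|q00] := ltgtP 0 q; last by rewrite -q00 eqxx in q0.
  exact: weakly_mixing_invariant01 qp mJ qJ.
apply: (@weakly_mixing_invariant01 (- q)) => //; first by rewrite oppr_gt0.
apply/funext => z; rewrite -[in LHS]qJ /preimage/=.
by rewrite -(pmp_flowD flow) subrr (pmp_flow0 flow).
Qed.
End WeakMixing.

(** * Time means of a flow *)

Section TimeMean.
Context {R : realType} {d : measure_display} {T : measurableType d}.
Local Notation leb := (@lebesgue_measure R).
Variables (mu : probability T R) (phi : R -> T -> T).
Hypothesis flow : pmp_flow mu phi.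

Definition unit_mean (f : T -> R) (z : T) : R := \int[leb]_(t in `[0, 1]) f (phi t z).

(** The flow average is the Birkhoff limit of the time-one map for the function
    averaged over unit time. *)
Definition time_mean (f : T -> R) (z : T) : R :=
  fine (birkhoff_sup (phi 1) (unit_mean f) z).

Section unit_function.
Variable f : T -> R.
Hypotheses (mf : measurable_fun setT f) (f01 : forall z, 0 <= f z <= 1).

Lemma orbit_measurable z : measurable_fun setT (fun t : R => f (phi t z)).
Proof. exact: (measurableT_comp mf (flow_orbit_measurable flow z)). Qed.

Lemma orbit_unit z t : 0 <= f (phi t z) <= 1.
Proof. exact: f01. Qed.

Lemma unit_mean_unit z : 0 <= unit_mean f z <= 1.
Proof.
have := unit_Rintegral_itv (orbit_measurable z) (orbit_unit z) (ler01).
by rewrite subr0.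
Qed.

Let k (D : set (measurableTypeR R)) (J : set T) (p : measurableTypeR R * T) : R :=
  f (phi p.1 p.2) * (\1_D p.1 * \1_J p.2).

Let mk D J : measurable D -> measurable J -> measurable_fun setT (k D J).
Proof.
move=> mD mJ; apply: measurable_funM.
  exact: (measurableT_comp mf (pmp_flow_measurable flow)).
apply: measurable_funM.
  by apply: measurableT_comp; [exact: measurable_indic|exact: measurable_fst].
by apply: measurableT_comp; [exact: measurable_indic|exact: measurable_snd].
Qed.

Let k0 D J p : 0 <= k D J p.
Proof. by rewrite /k mulr_ge0 ?mulr_ge0 ?indicE//; case/andP: (f01 (phi p.1 p.2)). Qed.

Let unit_meanE z : (\int[leb]_t (k `[0%R, 1%R] setT (t, z))%:E = (unit_mean f z)%:E)%E.
Proof.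
rewrite /unit_mean /Rintegral fineK; last first.
  apply: integrable_fin_num => //; apply: (@unit_integrable _ _ _ leb _ (fun t => f (phi t z))) => //.
  - exact: leb_itvcc_lty.
  - exact: orbit_measurable.
rewrite [RHS]integral_mkcond; apply: eq_integral => t _.
rewrite /k /patch !indicE in_setT mulr1/=.
by case: ifP => _; rewrite ?mulr1 ?mulr0.
Qed.

Lemma measurable_unit_mean : measurable_fun setT (unit_mean f).
Proof.
have -> : unit_mean f = fine \o (fun z => \int[leb]_t (k `[0%R, 1%R] setT (t, z))%:E)%E.
  by apply/funext => z; rewrite /= unit_meanE.
apply: measurableT_comp => //.
apply: (measurable_fun_fubini_tonelli_G (m1 := leb) (EFin \o k `[0%R, 1%R] setT)).
  by apply/measurable_EFinP; exact: mk.
by move=> p; rewrite lee_fin.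
Qed.

(** Tonelli, and the invariance of the measure at each fixed time. *)
Lemma unit_mean_integral J : measurable J -> (forall s, phi s @^-1` J = J) ->
  \int[mu]_(z in J) unit_mean f z = \int[mu]_(z in J) f z.
Proof.
move=> mJ tJ.
have FK z : `|f z| <= 1 by have /andP[f0 f1] := f01 z; rewrite ger0_norm.
have := @fubini_tonelli _ _ _ _ R leb mu (EFin \o k `[0%R, 1%R] J).
move=> /(_ _ _)/wrap[||fub].
- by apply/measurable_EFinP; exact: mk.
- by move=> p; rewrite lee_fin.
have L : (\int[mu]_z \int[leb]_t (k `[0%R, 1%R] J (t, z))%:E = \int[mu]_(z in J) (unit_mean f z)%:E)%E.
  rewrite [RHS]integral_mkcond; apply: eq_integral => z _.
  rewrite /patch; case: ifPn => zJ.
    rewrite -unit_meanE; apply: eq_integral => t _.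
    by rewrite /k !indicE in_setT/= zJ.
  by apply: integral0_eq => t _; rewrite /k [\1_J _]indicE/= (negbTE zJ) !mulr0.
have I t : (\int[mu]_z (k `[0%R, 1%R] J (t, z))%:E =
    ((fun=> \int[mu]_(z in J) (f z)%:E) \_ `[0%R, 1%R]) t)%E.
  rewrite /patch; case: ifPn => tI; last first.
    by apply: integral0_eq => z _; rewrite /k indicE/= (negbTE tI) mul0r mulr0.
  have := Rintegral_preserving (flow_map_measurable flow t) (pmp_flow_preserving flow t) mJ mf FK.
  rewrite tJ /Rintegral => H; have {H} := congr1 EFin H; rewrite !fineK.
  - move=> <-; rewrite [RHS]integral_mkcond; apply: eq_integral => z _.
    rewrite /k /patch !indicE/= tI mul1r; case: ifP => _; first by rewrite mulr1.
    by rewrite mulr0.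
  - by apply: integrable_fin_num => //; exact: (@bounded_integrable _ _ _ mu _ _ _ mJ mf FK).
  - apply: integrable_fin_num => //.
    exact: (@bounded_integrable _ _ _ mu _ _ _ mJ
      (measurableT_comp mf (flow_map_measurable flow t)) (fun z => FK _)).
rewrite /Rintegral -L -fub; congr fine.
transitivity (\int[leb]_t ((fun=> \int[mu]_(z in J) (f z)%:E) \_ `[0%R, 1%R]) t)%E.
  by apply: eq_integral => t _; rewrite -I.
rewrite -integral_mkcond integral_cst//= leb_itvcc// subr0 mule1//.
Qed.

Lemma birkhoff_avg_unit_mean n z :
  birkhoff_avg (phi 1) (unit_mean f) n z =
  n%:R^-1 * \int[leb]_(t in `[0, n%:R]) f (phi t z).
Proof.
congr (_ * _); rewrite /birkhoff_sum.
have mo := orbit_measurable z; have uo := orbit_unit z.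
elim: n => [|n IH]; first by rewrite big_ord0 set_itv1 Rintegral_set1.
rewrite big_ord_recr/= IH (@Rintegral_itv_split _ _ mo uo 0 n%:R n.+1%:R) ?ler_nat//.
congr (_ + _); rewrite /unit_mean.
have itE : iter n (phi 1) z = phi n%:R z.
  elim: n {IH} => [|n IH]; first by rewrite (pmp_flow0 flow).
  by rewrite /= IH -(pmp_flowD flow) nat1r.
transitivity (\int[leb]_(t in `[0, 1]) f (phi (t + n%:R) z)).
  by apply: eq_Rintegral => t _; rewrite itE (pmp_flowD flow).
have := @Rintegral_shift _ (fun t => f (phi t z)) n%:R 0 1 ler01 mo uo.
by rewrite add0r nat1r.
Qed.

Let FK z : `|unit_mean f z| <= 1.
Proof. by have /andP[f0 f1] := unit_mean_unit z; rewrite ger0_norm. Qed.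

Lemma time_mean_cvg : {ae mu, forall z,
  n%:R^-1 * \int[leb]_(t in `[0, n%:R]) f (phi t z) @[n --> \oo] --> time_mean f z}.
Proof.
have := birkhoff_ae_cvg (flow_map_measurable flow 1) (pmp_flow_preserving flow 1)
  measurable_unit_mean FK.
apply: filterS => z; rewrite /time_mean.
by under eq_fun do rewrite birkhoff_avg_unit_mean.
Qed.

Lemma measurable_time_mean : measurable_fun setT (time_mean f).
Proof.
apply: measurableT_comp => //; apply: measurable_birkhoff_sup.
  exact: (flow_map_measurable flow 1).
exact: measurable_unit_mean.
Qed.

Lemma time_mean_integral J : measurable J -> (forall s, phi s @^-1` J = J) ->
  \int[mu]_(z in J) time_mean f z = \int[mu]_(z in J) f z.
Proof.
move=> mJ tJ; rewrite -unit_mean_integral//.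
exact: (birkhoff_integral (flow_map_measurable flow 1) (pmp_flow_preserving flow 1)
  measurable_unit_mean FK mJ (tJ 1)).
Qed.

Lemma time_mean_bounded z : `|time_mean f z| <= 1.
Proof.
have B := birkhoff_avg_bounded (phi 1) FK ^~ z.
have /andP[] := bounded_limn_esup B.
rewrite -(fineK (bounded_limn_esup_fin B)) -EFinN !lee_fin => h1 h2.
by rewrite ler_norml h1.
Qed.

(** Shifting an orbit by [s] changes its integral over [[0, n]] by at most [2 * s],
    so even the upper limit is unchanged, at every point and not only almost
    everywhere. *)
Lemma time_mean_invariant s z : time_mean f (phi s z) = time_mean f z.
Proof.
congr fine; apply: limn_esup_close; apply/cvgr0Pnorm_le => e e0; near=> n.
have n0 : (0 < n)%N by near: n; exact: nbhs_infty_gt.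
rewrite !birkhoff_avg_unit_mean -mulrBr normrM ger0_norm ?invr_ge0//.
have mo := orbit_measurable z; have uo := orbit_unit z.
rewrite (_ : \int[leb]_(t in `[0, n%:R]) f (phi t (phi s z)) =
    \int[leb]_(t in `[s, n%:R + s]) f (phi t z)); last first.
  have := @Rintegral_shift _ (fun t => f (phi t z)) s 0 n%:R (ler0n _ _) mo uo.
  by rewrite add0r => <-; apply: eq_Rintegral => t _; rewrite (pmp_flowD flow).
rewrite -!primitiveB ?ler0n ?lerDr//.
set H := primitive _.
rewrite mulrC ler_pdivrMr ?ltr0n//.
have l1 := primitive_lip mo uo n%:R (n%:R + s); have l2 := primitive_lip mo uo 0 s.
rewrite (_ : _ - _ = (H (n%:R + s) - H n%:R) - (H s - H 0)); last by ring.
apply: le_trans (ler_normB _ _) _; apply: le_trans (lerD l1 l2) _.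
rewrite [n%:R + s]addrC addrK subr0 -ler_pdivrMl// mulrC; near: n; exact: nbhs_infty_ger.
Unshelve. all: by end_near. Qed.

End unit_function.
End TimeMean.

(** * Averages over far windows *)

(** The integral over [[M, M + L]] is the difference of two integrals from 0, each
    within a multiple of [th * (M + L)] of its expected value; [M <= L / kappa]
    turns this into a multiple of [th / kappa * L]. *)
Lemma window_mean (R : realType) (g : R -> R) (l th kappa M L : R) (N : nat) :
  measurable_fun setT g -> (forall t, 0 <= g t <= 1) ->
  0 < th <= 1 -> 0 < kappa <= 1 -> 1 <= th * N%:R ->
  (forall n, (N <= n)%N ->
    `|n%:R^-1 * \int[@lebesgue_measure R]_(t in `[0, n%:R]) g t - l| <= th) ->
  N%:R <= M -> M * kappa <= L ->
  `|\int[@lebesgue_measure R]_(t in `[M, M + L]) g t - L * l| <= 12 * th / kappa * L.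
Proof.
move=> mg g01 /andP[th0 th1] /andP[k0 k1] thN Hl NM ML.
have Npos : 0 < (N%:R : R) by rewrite -(pmulr_rgt0 _ th0) (lt_le_trans _ thN).
have M0 : 0 < M by exact: lt_le_trans NM.
have L0 : 0 <= L by apply: le_trans ML; rewrite mulr_ge0// ltW.
pose H s := \int[@lebesgue_measure R]_(t in `[0, s]) g t.
have bH s : 0 <= s -> 0 <= H s <= s.
  by move=> s0; have := unit_Rintegral_itv mg g01 s0; rewrite subr0.
have Hn n : (N <= n)%N -> `|H n%:R - n%:R * l| <= th * n%:R.
  move=> Nn; have n0 : 0 < (n%:R : R) by apply: lt_le_trans Npos _; rewrite ler_nat.
  have := Hl n Nn; rewrite -/(H n%:R).
  have -> : H n%:R - n%:R * l = n%:R * (n%:R^-1 * H n%:R - l).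
    by rewrite mulrBr mulrA divff ?gt_eqF// mul1r.
  by rewrite normrM (ger0_norm (ltW n0)) [th * _]mulrC ler_pM2l.
have lb : `|l| <= 2.
  have n0 := Npos; have := Hn N (leqnn N); have := bH _ (ltW n0).
  set h := H _ => h1 h2.
  have : `|N%:R * l| <= 2 * N%:R.
    rewrite -[N%:R * l](subKr h) (le_trans (ler_normB _ _))//.
    have : th * N%:R <= N%:R by rewrite ler_piMl// ltW.
    by rewrite [`|h|]ger0_norm; lra.
  by rewrite normrM (ger0_norm (ltW n0)) mulrC ler_pM2r.
(* Rounding [r] to an integer costs at most 3, which [1 <= th * N] absorbs. *)
have Hr r : N%:R <= r -> `|H r - r * l| <= 4 * th * r.
  move=> Nr; have r0 : 0 <= r by exact: le_trans (ltW Npos) Nr.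
  pose n := Num.truncn r.
  have /andP[nr rn] : n%:R <= r < n.+1%:R by exact: truncn_itv.
  have Nn : (N <= n)%N.
    by rewrite -ltnS -(ltr_nat R); exact: le_lt_trans rn.
  have e1 : `|H r - H n%:R| <= 1.
    rewrite /H (@Rintegral_itv_split _ g mg g01 0 n%:R r)// addrC addKr.
    have := unit_Rintegral_itv mg g01 nr; rewrite -natr1 in rn.
    by move=> /andP[i0 i1]; rewrite ger0_norm//; lra.
  have e2 := Hn n Nn.
  have e3 : `|(n%:R - r) * l| <= 2.
    rewrite normrM -[leRHS]mul1r ler_pM//.
    by rewrite -natr1 in rn; rewrite ler_norml; lra.
  have e4 : th * n%:R <= th * r by rewrite ler_pM2l.
  have e5 : 1 <= th * r by apply: le_trans thN _; rewrite ler_pM2l.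
  rewrite (_ : _ - _ = (H r - H n%:R) + (H n%:R - n%:R * l) + (n%:R - r) * l); last by ring.
  apply: le_trans (ler_normD _ _) _.
  apply: le_trans (lerD (ler_normD _ _) (lexx _)) _.
  by lra.
have ML0 : M <= M + L by rewrite lerDl.
have := Rintegral_itv_split mg g01 (ltW M0) ML0; rewrite -/(H _) -/(H _) => e.
have -> : \int[@lebesgue_measure R]_(t in `[M, M + L]) g t - L * l =
  (H (M + L) - (M + L) * l) - (H M - M * l) by rewrite e; ring.
apply: le_trans (ler_normB _ _) _.
apply: le_trans (lerD (Hr _ (le_trans NM ML0)) (Hr _ NM)) _.
have Mk : M <= L / kappa by rewrite ler_pdivlMr.
have Lk : L <= L / kappa by rewrite ler_pdivlMr// ler_piMr.
rewrite -!mulrDr (_ : 12 * th / kappa * L = 4 * th * (3 * (L / kappa))); last by ring.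
by rewrite ler_pM2l ?mulr_gt0//; lra.
Qed.

(** * Inner regularity *)

Section FineMeasure.
Context {R : realType} {d : measure_display} {T : measurableType d}.
Variable mu : probability T R.
Local Notation pr A := (fine (mu A)).

Lemma pr_EFin A : measurable A -> (pr A)%:E = mu A.
Proof. by move=> mA; rewrite fineK ?fin_num_measure. Qed.

Lemma pr_ge0 A : 0 <= pr A. Proof. exact: fine_ge0. Qed.

Lemma pr_le A B : measurable A -> measurable B -> A `<=` B -> pr A <= pr B.
Proof.
move=> mA mB AB; apply: fine_le; rewrite ?fin_num_measure//.
by apply: le_measure; rewrite ?inE.
Qed.

Lemma pr_setT : pr setT = 1. Proof. by rewrite probability_setT. Qed.

Lemma pr_le1 A : measurable A -> pr A <= 1.
Proof. by move=> mA; rewrite -pr_setT pr_le. Qed.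

Lemma prD A B : measurable A -> measurable B -> B `<=` A -> pr (A `\` B) = pr A - pr B.
Proof.
move=> mA mB BA; apply: EFin_inj; rewrite EFinB !pr_EFin//; last exact: measurableD.
rewrite measureD//; first by rewrite setIidr.
by rewrite -ge0_fin_numE// fin_num_measure.
Qed.

Lemma prC A : measurable A -> pr (~` A) = 1 - pr A.
Proof. by move=> mA; rewrite -setTD prD// pr_setT. Qed.

Lemma prU2 A B : measurable A -> measurable B -> pr (A `|` B) <= pr A + pr B.
Proof.
move=> mA mB; rewrite -lee_fin EFinD !pr_EFin//; last exact: measurableU.
exact: measureU2.
Qed.

Lemma pr_cvg_nondecreasing (F : (set T)^nat) : (forall n, measurable (F n)) ->
  nondecreasing_seq F -> pr (F n) @[n --> \oo] --> pr (\bigcup_n F n).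
Proof.
move=> mF ndF; have mU := bigcupT_measurable _ mF.
apply: fine_cvg; rewrite pr_EFin//.
exact: (nondecreasing_cvg_mu mF mU ndF).
Qed.

Lemma pr_cvg_nonincreasing (F : (set T)^nat) : (forall n, measurable (F n)) ->
  nonincreasing_seq F -> pr (F n) @[n --> \oo] --> pr (\bigcap_n F n).
Proof.
move=> mF niF; have mI := bigcapT_measurable mF.
apply: fine_cvg; rewrite pr_EFin//.
by apply: (nonincreasing_cvg_mu _ mF mI niF); rewrite -ge0_fin_numE// fin_num_measure.
Qed.

End FineMeasure.

Section InnerRegularity.
Context {R : realType} {d : measure_display} {T : measurableType d}.
Variables (mu : probability T R) (K : set (set T)).

Definition inner_regular (S : set T) : Prop :=
  measurable S /\ forall e : R, 0 < e ->
    exists2 A, K A & A `<=` S /\ (mu (S `\` A) < e%:E)%E.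

Hypothesis KM : forall A, K A -> measurable A.
Hypothesis K0 : K set0.
Hypothesis KU : forall A B, K A -> K B -> K (A `|` B).
Hypothesis KI : forall A : (set T)^nat, (forall n, K (A n)) -> K (\bigcap_n A n).

Lemma inner_regular_compact A : K A -> inner_regular A.
Proof.
move=> KA; split; first exact: KM.
by move=> e e0; exists A => //; split => //; rewrite setDv measure0 lte_fin.
Qed.

Lemma inner_regularU A B : inner_regular A -> inner_regular B -> inner_regular (A `|` B).
Proof.
move=> [mA rA] [mB rB]; split; first exact: measurableU.
move=> e e0; have e20 : 0 < e / 2 by lra.
have [A' KA' [A'A eA]] := rA _ e20; have [B' KB' [B'B eB]] := rB _ e20.
exists (A' `|` B'); first exact: KU.
split; first exact: setUSS.
have mA' := KM KA'; have mB' := KM KB'.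
apply: (@le_lt_trans _ _ (mu ((A `\` A') `|` (B `\` B')))).
  apply: le_measure; rewrite ?inE.
  - by apply: measurableD; exact: measurableU.
  - by apply: measurableU; exact: measurableD.
  - by move=> z [[Az|Bz] /not_orP[nA nB]]; [left|right].
apply: (@le_lt_trans _ _ (mu (A `\` A') + mu (B `\` B'))%E).
  by apply: measureU2; exact: measurableD.
by rewrite [e]splitr EFinD; exact: lteD.
Qed.

Lemma inner_regular_bigsetU (S : (set T)^nat) n : (forall n, inner_regular (S n)) ->
  inner_regular (\big[setU/set0]_(i < n) S i).
Proof.
move=> rS; elim: n => [|n IH]; first by rewrite big_ord0; exact: inner_regular_compact.
by rewrite big_ord_recr/=; exact: inner_regularU.
Qed.

Lemma inner_regular_bigcup (S : (set T)^nat) : (forall n, inner_regular (S n)) ->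
  inner_regular (\bigcup_n S n).
Proof.
move=> rS; have mS n : measurable (S n) by case: (rS n).
have mU : measurable (\bigcup_n S n) by exact: bigcupT_measurable.
split => // e e0; have e20 : 0 < e / 2 by lra.
pose F n := \big[setU/set0]_(i < n) S i.
have rF n : inner_regular (F n) by exact: inner_regular_bigsetU.
have mF n : measurable (F n) by case: (rF n).
have FS n : F n `<=` \bigcup_n S n by rewrite /F -bigcup_mkord => z [i _ Sz]; exists i.
have FE : \bigcup_n F n = \bigcup_n S n.
  apply/seteqP; split => z [n _ nz]; first exact: (FS n).
  by exists n.+1 => //; rewrite /F -bigcup_mkord; exists n => /=.
have ndF : nondecreasing_seq F.
  move=> m n mn; apply/subsetPset; rewrite /F -!bigcup_mkord => z [i im Sz].
  by exists i => //=; exact: leq_trans mn.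
have cv := pr_cvg_nondecreasing (mu := mu) mF ndF; rewrite FE in cv.
have [n Fn] : exists n, fine (mu (\bigcup_n S n)) - e / 2 < fine (mu (F n)).
  have lt : fine (mu (\bigcup_n S n)) - e / 2 < fine (mu (\bigcup_n S n)) by lra.
  by have [n _ Hn] := cvgr_gt _ cv _ lt; exists n; apply: Hn => /=.
have [A KA [AF eA]] := (rF n).2 _ e20.
exists A => //; split; first exact: subset_trans (FS n).
have mA := KM KA.
apply: (@le_lt_trans _ _ (mu (F n `\` A) + mu (\bigcup_n S n `\` F n))%E).
  apply: le_trans (measureU2 _ _ _); try exact: measurableD.
  apply: le_measure; rewrite ?inE; [exact: measurableD|by apply: measurableU; exact: measurableD|].
  by move=> z [Sz nAz]; have [Fz|nFz] := pselect (F n z); [left|right].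
rewrite [e]splitr EFinD; apply: lteD => //.
rewrite -pr_EFin; last exact: measurableD.
by rewrite prD// lte_fin; lra.
Qed.

Lemma inner_regular_bigcap (S : (set T)^nat) : (forall n, inner_regular (S n)) ->
  inner_regular (\bigcap_n S n).
Proof.
move=> rS; have mS n : measurable (S n) by case: (rS n).
have mI : measurable (\bigcap_n S n) by exact: bigcapT_measurable.
split => // e e0; have e20 : 0 < e / 2 by lra.
have H n : exists A, K A /\ A `<=` S n /\ (mu (S n `\` A) < (e / 2 / (2 ^ n.+1)%:R)%:E)%E.
  have [|A KA AS] := (rS n).2 (e / 2 / (2 ^ n.+1)%:R); last by exists A.
  by rewrite divr_gt0// ltr0n expn_gt0.
have [A HA] := choice H.
have KA n : K (A n) by case: (HA n).
have AS n : A n `<=` S n by case: (HA n) => _ [].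
have mA n := KM (KA n).
exists (\bigcap_n A n); first exact: KI.
split; first by move=> z Az n _; apply: AS; exact: Az.
apply: (@le_lt_trans _ _ (\sum_(n <oo) mu (S n `\` A n))%E).
  apply: (@le_trans _ _ (mu (\bigcup_n (S n `\` A n)))).
    apply: le_measure; rewrite ?inE.
    - by apply: measurableD => //; exact: bigcapT_measurable.
    - by apply: bigcupT_measurable => n; exact: measurableD.
    - move=> z [Sz /existsNP[n /not_implyP[_ nAz]]].
      by exists n => //; split => //; exact: Sz.
  apply: measure_sigma_subadditive => //.
    by move=> n; exact: measurableD.
  by apply: bigcupT_measurable => n; exact: measurableD.
apply: (@le_lt_trans _ _ (e / 2)%:E); last by rewrite lte_fin; lra.
apply: le_trans (epsilon_trick0 xpredT (ltW e20)).
by apply: lee_nneseries => // n _; apply: ltW; case: (HA n) => _ [].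
Qed.

(** The sets that are inner regular together with their complements form a
    sigma-algebra; closing [K] under countable intersections handles
    complements of unions. *)
Lemma inner_regular_sigma (G : set (set T)) :
  d.-measurable = <<s G >> -> inner_regular setT ->
  (forall S, G S -> inner_regular S /\ inner_regular (~` S)) ->
  forall S, measurable S -> inner_regular S.
Proof.
move=> mG rT rG S mS.
suff : [set S | inner_regular S /\ inner_regular (~` S)] S by case.
move: mS; rewrite mG; move: S; apply: smallest_sub => //; split => /=.
- by split; [exact: inner_regular_compact|rewrite setC0].
- by move=> A [rA rAc]; rewrite setTD setCK.
- move=> F rF; split; first by apply: inner_regular_bigcup => n; case: (rF n).
  by rewrite setC_bigcup; apply: inner_regular_bigcap => n; case: (rF n).
Qed.

End InnerRegularity.

(** * Borel sets of metric spaces *)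

Section MetricBorel.
Context {R : realType} (X : pointedMetricType R).
Implicit Types (A G O : set X).

Lemma open_borel A : open A -> measurable (A : set (borel X)).
Proof. exact: sub_sigma_algebra. Qed.

Lemma closed_borel A : closed A -> measurable (A : set (borel X)).
Proof.
by move=> cA; rewrite -[A]setCK; apply: measurableC; apply: open_borel; exact: closed_openC.
Qed.

Lemma metric_compact_closed A : compact A -> closed A.
Proof. by apply: compact_closed; exact: metric_hausdorff. Qed.

Lemma compact_borel A : compact A -> measurable (A : set (borel X)).
Proof. by move=> /metric_compact_closed /closed_borel. Qed.

Lemma metric_openP A : (forall x, A x -> exists2 e : R, 0 < e &
  forall y, mdist x y < e -> A y) -> open A.
Proof.
move=> H; rewrite openE => x Ax; have [e e0 He] := H x Ax.
apply/nbhs_ballP; exists e => // y; rewrite ballEmdist/=; exact: He.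
Qed.

Definition thickening A (n : nat) : set X :=
  [set x | exists2 g, A g & mdist g x < n.+1%:R^-1].

Lemma thickening_open A n : open (thickening A n).
Proof.
apply: metric_openP => x [g Ag gx]; exists (n.+1%:R^-1 - mdist g x); first by rewrite subr_gt0.
move=> y xy; exists g => //; apply: le_lt_trans (metric_triangle _ x _) _.
by rewrite -ltrBrDl.
Qed.

Lemma sub_thickening A n : A `<=` thickening A n.
Proof. by move=> x Ax; exists x => //; rewrite mdistxx invr_gt0. Qed.

Lemma thickening_nonincreasing A : nonincreasing_seq (thickening A).
Proof.
move=> m n mn; apply/subsetPset => x [g Ag gx]; exists g => //.
by apply: lt_le_trans gx _; rewrite lef_pV2 ?posrE// ler_nat.
Qed.

Lemma bigcap_thickening A : closed A -> \bigcap_n thickening A n = A.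
Proof.
move=> cA; apply/seteqP; split => x; last by move=> Ax n _; exact: sub_thickening.
move=> Hx; apply: cA => B /nbhs_ballP[e /= e0 eB].
have [n _ Hn] := near_infty_natSinv_lt (PosNum e0).
have [g Ag gx] := Hx n I; exists g; split => //; apply: eB.
rewrite ballEmdist/= metric_sym; apply: lt_trans gx _.
exact: (Hn n (leqnn n)).
Qed.

(** Sigma-compactness makes closed sets countable unions of compact sets, and an
    open set is the union of the complements of the thickenings of its
    complement. *)
Lemma borel_inner_regular (mu : probability (borel X) R) : sigma_compact X ->
  forall S : set (borel X), measurable S -> inner_regular mu (@compact X) S.
Proof.
move=> [C cC CT].
have KM (A : set X) : compact A -> measurable (A : set (borel X)) by exact: compact_borel.
have K0 : compact (set0 : set X) by exact: compact0.
have KU (A B : set X) : compact A -> compact B -> compact (A `|` B) by exact: compactU.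
have KI (A : (set X)^nat) : (forall n, compact (A n)) -> compact (\bigcap_n A n).
  move=> cA; apply: (@subclosed_compact _ _ (A 0%N)) => //.
    by apply: closed_bigI => n _; exact: metric_compact_closed.
  by move=> x; apply.
have rC (A : set X) : closed A -> inner_regular mu (@compact X) (A : set (borel X)).
  move=> cA; rewrite -[A]setIT -CT setI_bigcupr.
  apply: inner_regular_bigcup => // n; apply: inner_regular_compact => //.
  rewrite setIC; apply: (@subclosed_compact _ _ (C n)) => //.
  by apply: closedI => //; exact: metric_compact_closed.
apply: (@inner_regular_sigma R _ (borel X) mu (@compact X) KM K0 KU KI (@open X)) => //.
  by apply: (rC setT); exact: closedT.
move=> S oS; split; last by apply: rC; exact: open_closedC.
have -> : S = \bigcup_n ~` (thickening (~` S) n).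
  by rewrite -setC_bigcap bigcap_thickening ?setCK//; exact: open_closedC.
apply: inner_regular_bigcup => // n; apply: rC.
by apply: open_closedC; exact: thickening_open.
Qed.

(** An almost-automorphism uniformly close to the identity almost preserves a
    fixed compact set [G]: the points it sends into [G] lie in a thin
    thickening of [G] and have the same measure as [G]. *)
Lemma compact_almost_returns (mu : probability (borel X) R) (Xk : nat -> set X)
    (A : nat -> X -> X) (G : set X) :
  (forall k, measurable (Xk k : set (borel X))) ->
  mu (Xk k) @[k --> \oo] --> mu setT ->
  (forall k, is_aut mu (Xk k) (A k)) ->
  (forall e : R, 0 < e ->
    \forall k \near \oo, forall x, Xk k x -> mdist (A k x) x < e) ->
  compact G -> forall e : R, 0 < e -> \forall k \near \oo,
    measurable (Xk k `&` (G `\` A k @^-1` G) : set (borel X)) /\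
    fine (mu (Xk k `&` (G `\` A k @^-1` G))) <= e.
Proof.
move=> mXk Xk1 autA Acvg cG e e0.
have mG := compact_borel cG.
have mth n : measurable (thickening G n : set (borel X)).
  by apply: open_borel; exact: thickening_open.
have := pr_cvg_nonincreasing (mu := mu) mth (@thickening_nonincreasing G).
rewrite bigcap_thickening; last exact: metric_compact_closed.
have lt1 : fine (mu G) < fine (mu G) + e / 2 by lra.
move=> /cvgr_lt /(_ _ lt1)[n _ /(_ n (leqnn n)) thn].
have /fine_cvg Xk1' : mu (Xk k) @[k --> \oo] --> (fine (mu setT))%:E.
  by rewrite fineK ?fin_num_measure.
have lt2 : fine (mu setT) - e / 2 < fine (mu setT) by lra.
have ninv : 0 < (n.+1%:R^-1 : R) by rewrite invr_gt0.
near=> k.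
have Xke : fine (mu setT) - e / 2 < fine (mu (Xk k)).
  by near: k; exact: (cvgr_gt _ Xk1' _ lt2).
have Ak : forall x, Xk k x -> mdist (A k x) x < n.+1%:R^-1.
  by near: k; exact: Acvg.
have [Afun mA Apres _] := autA k.
have mGX : measurable (Xk k `&` G : set (borel X)) by exact: measurableI.
have mpre : measurable (Xk k `&` A k @^-1` G : set (borel X)) by apply: mA.
have preE : mu (Xk k `&` A k @^-1` G) = mu (Xk k `&` G).
  rewrite -(Apres _ mGX (@subIsetl _ _ _)); congr (mu _).
  apply/seteqP; split => x /= [Xx Gx]; first by split => //; split => //; exact: Afun.
  by case: Gx.
have sub : Xk k `&` A k @^-1` G `<=` thickening G n.
  by move=> x [Xx Gx]; exists (A k x) => //; exact: Ak.
have setE : Xk k `&` (G `\` A k @^-1` G) = (Xk k `&` G) `\` (Xk k `&` A k @^-1` G).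
  apply/seteqP; split => x /=; first by move=> [Xx [Gx nG]]; split => // -[].
  by move=> [[Xx Gx] nG]; split => //; split => // AG; apply: nG.
have mset : measurable (Xk k `&` (G `\` A k @^-1` G) : set (borel X)).
  by rewrite setE; exact: measurableD.
split=> //.
apply: (@le_trans _ _ (fine (mu (thickening G n `\` (Xk k `&` A k @^-1` G))))).
  apply: pr_le => //; first exact: measurableD.
  by rewrite setE => x [[_ Gx] nG]; split => //; exact: sub_thickening.
rewrite prD// preE.
have : fine (mu G) - e / 2 <= fine (mu (Xk k `&` G)).
  have : fine (mu G) <= fine (mu (Xk k `&` G)) + fine (mu (~` Xk k)).
    apply: le_trans (prU2 mu mGX (measurableC (mXk k))).
    apply: pr_le => //; first by apply: measurableU => //; exact: measurableC.
    by move=> x Gx; have [Xx|nX] := pselect (Xk k x); [left|right].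
  by rewrite prC//; move: Xke; rewrite probability_setT/=; lra.
by lra.
Unshelve. all: by end_near. Qed.

End MetricBorel.

Section ProductBorel.
Context {R : realType} (X Y : pointedMetricType R).
Variables (mu : probability (borel X) R) (nu : probability (borel Y) R).
Variable rho : probability (borel X * borel Y)%type R.
Hypothesis rho_fst : forall A, measurable A -> rho (A `*` setT) = mu A.
Hypothesis rho_snd : forall B, measurable B -> rho (setT `*` B) = nu B.

Lemma pair_hausdorff : hausdorff_space (X * Y)%type.
Proof.
move=> [x y] [x' y'] cl; congr pair.
  apply: (@metric_hausdorff _ X) => A B Ax Bx.
  have [|| [a b] [/= [Aa _] [Ba _]]] := cl (A `*` setT) (B `*` setT); last by exists a.
    by exists (A, setT) => //; split => //; exact: filterT.
  by exists (B, setT) => //; split => //; exact: filterT.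
apply: (@metric_hausdorff _ Y) => A B Ax Bx.
have [|| [a b] [/= [_ Aa] [_ Ba]]] := cl (setT `*` A) (setT `*` B); last by exists b.
  by exists (setT, A) => //; split => //; exact: filterT.
by exists (setT, B) => //; split => //; exact: filterT.
Qed.

Definition compact_measurable : set (set (X * Y)) :=
  [set G | compact G /\ measurable (G : set (borel X * borel Y))].

(** Rectangles are treated through the marginals.  Measurability is part of the
    class of compact sets because the sigma-algebra is the product of the Borel
    ones, in which a compact set of the product topology is not obviously
    measurable. *)
Lemma product_inner_regular : sigma_compact X -> sigma_compact Y ->
  forall S : set (borel X * borel Y), measurable S ->
  inner_regular rho compact_measurable S.
Proof.
move=> scX scY.
have KM (A : set (X * Y)) : compact_measurable A -> measurable (A : set (borel X * borel Y)).
  by case.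
have K0 : compact_measurable set0 by split; [exact: compact0|exact: measurable0].
have KU A B : compact_measurable A -> compact_measurable B -> compact_measurable (A `|` B).
  by move=> [cA mA] [cB mB]; split; [exact: compactU|exact: measurableU].
have KI (A : (set (X * Y))^nat) :
    (forall n, compact_measurable (A n)) -> compact_measurable (\bigcap_n A n).
  move=> cA; split.
    apply: (@subclosed_compact _ _ (A 0%N)); last by move=> x; apply.
      apply: closed_bigI => n _; apply: compact_closed; first exact: pair_hausdorff.
      by case: (cA n).
    by case: (cA 0%N).
  by apply: (@bigcapT_measurable _ (borel X * borel Y)%type) => n; case: (cA n).
have rR (A : set (borel X)) (B : set (borel Y)) : measurable A -> measurable B ->
    inner_regular rho compact_measurable (A `*` B).
  move=> mA mB; split; first exact: measurableX.
  move=> e e0; have e20 : 0 < e / 2 by lra.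
  have [A' cA' [AA eA]] := (borel_inner_regular mu scX mA).2 _ e20.
  have [B' cB' [BB eB]] := (borel_inner_regular nu scY mB).2 _ e20.
  have mA' := compact_borel cA'; have mB' := compact_borel cB'.
  exists (A' `*` B').
    by split; [exact: compact_setX|exact: measurableX].
  split; first by move=> [x y] [/= /AA ? /BB ?].
  have mDA : measurable (A `\` A' : set (borel X)) by exact: measurableD.
  have mDB : measurable (B `\` B' : set (borel Y)) by exact: measurableD.
  apply: (@le_lt_trans _ _ (rho (((A `\` A') `*` setT) `|` (setT `*` (B `\` B'))))).
    apply: le_measure; rewrite ?inE.
    - by apply: measurableD; exact: measurableX.
    - by apply: measurableU; exact: measurableX.
    - move=> [x y] [/= [Ax By] /not_andP[nA|nB]]; [by left|by right].
  apply: (@le_lt_trans _ _ (rho ((A `\` A') `*` setT) + rho (setT `*` (B `\` B')))%E).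
    by apply: measureU2; exact: measurableX.
  by rewrite rho_fst// rho_snd// [e]splitr EFinD; exact: lteD.
apply: (@inner_regular_sigma R _ (borel X * borel Y)%type rho compact_measurable
  KM K0 KU KI
  [set A `*` B | A in @measurable _ (borel X) & B in @measurable _ (borel Y)]).
- exact: measurable_prod_measurableType.
- by rewrite -setXTT; exact: rR.
- move=> _ [A mA [B mB <-]]; split; first exact: rR.
  rewrite (_ : ~` (A `*` B) = (~` A `*` setT) `|` (setT `*` ~` B)).
    by apply: inner_regularU => //; apply: rR => //; exact: measurableC.
  apply/seteqP; split => [[x y] /not_andP[nA|nB]|[x y] [[nA _] []|[_ nB] []]] //.
    by left.
  by right.
Qed.

End ProductBorel.

(** * Approximation of open sets; factors *)

Section LipschitzApproximation.
Context {R : realType} (X : pointedMetricType R).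

Lemma lipschitz_borel_measurable (g : X -> R) (C : R) :
  (forall x x', `|g x - g x'| <= C * mdist x x') ->
  measurable_fun setT (g : borel X -> R).
Proof.
move=> gC; apply: (measurability _ (RGenOInfty.measurableE R)) => //.
move=> _ [_ [a ->] <-]; rewrite setTI; apply: open_borel.
apply: metric_openP => x; rewrite /= in_itv/= andbT => ax.
pose C' := `|C| + 1; have C'0 : 0 < C' by rewrite /C' ltr_wpDl.
exists ((g x - a) / C'); first by rewrite divr_gt0// subr_gt0.
move=> y xy; rewrite in_itv/= andbT.
have d0 : 0 <= mdist x y by exact: mdist_ge0.
have : C * mdist x y <= C' * mdist x y.
  by rewrite ler_wpM2r// /C'; apply: le_trans (ler_norm _) _; rewrite lerDl.
move: xy; rewrite ltr_pdivlMr// mulrC => xy.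
by have := gC x y; rewrite ler_norml => /andP[_]; lra.
Qed.

Definition dist_to (A : set X) (x : X) : R := inf [set mdist x y | y in A].

Lemma dist_to_le (A : set X) x y : A y -> dist_to A x <= mdist x y.
Proof.
move=> Ay; apply: inf_lbound; last by exists y.
by exists 0 => _ [z _ <-]; exact: mdist_ge0.
Qed.

Lemma le_dist_to (A : set X) x (e : R) : A !=set0 ->
  (forall y, A y -> e <= mdist x y) -> e <= dist_to A x.
Proof.
move=> [a Aa] H; apply: lb_le_inf; first by exists (mdist x a), a.
by move=> _ [z Az <-]; exact: H.
Qed.

Lemma dist_to_lip (A : set X) x x' : A !=set0 ->
  dist_to A x - dist_to A x' <= mdist x x'.
Proof.
move=> A0; rewrite lerBlDr addrC -lerBlDr; apply: le_dist_to => // y Ay.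
rewrite lerBlDr addrC; apply: le_trans (dist_to_le _ Ay) _.
exact: metric_triangle.
Qed.

(** The whole space is a separate case, since the distance to the empty set is an
    infimum over nothing, with default value 0. *)
Definition open_approx (O : set X) (n : nat) (x : X) : R :=
  if O == setT then 1 else Num.min 1 (n.+1%:R * dist_to (~` O) x).

Lemma open_approx_unit O n x : 0 <= open_approx O n x <= 1.
Proof.
rewrite /open_approx; case: eqVneq => [_|/setTPn[a Oa]]; first by rewrite ler01 lexx.
rewrite ge_min lexx/= andbT le_min ler01/= mulr_ge0//.
by apply: le_dist_to => [|y _]; [exists a|exact: mdist_ge0].
Qed.

Lemma open_approx_lip O n x x' :
  `|open_approx O n x - open_approx O n x'| <= n.+1%:R * mdist x x'.
Proof.
rewrite /open_approx; case: eqVneq => [_|/setTPn[a Oa]].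
  by rewrite subrr normr0 mulr_ge0// mdist_ge0.
have A0 : ~` O !=set0 by exists a.
have l1 := dist_to_lip x x' A0; have l2 := dist_to_lip x' x A0.
rewrite metric_sym in l2.
have n0 : 0 < (n.+1%:R : R) by [].
have m1 : n.+1%:R * dist_to (~` O) x - n.+1%:R * dist_to (~` O) x' <= n.+1%:R * mdist x x'.
  by rewrite -mulrBr ler_pM2l.
have m2 : n.+1%:R * dist_to (~` O) x' - n.+1%:R * dist_to (~` O) x <= n.+1%:R * mdist x x'.
  by rewrite -mulrBr ler_pM2l.
have m3 : 0 <= n.+1%:R * mdist x x' by rewrite mulr_ge0// mdist_ge0.
move: m1 m2 m3; rewrite /Order.min.
by do 2 case: ifPn; rewrite -?leNgt => *; rewrite ler_norml; apply/andP; split; lra.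
Qed.

Lemma open_approx_cvg O x : open O -> open_approx O n x @[n --> \oo] --> (\1_O x : R).
Proof.
move=> oO; rewrite /open_approx; case: eqVneq => [->|/setTPn[a Oa]].
  by rewrite indicE in_setT; exact: cvg_cst.
have A0 : ~` O !=set0 by exists a.
rewrite indicE; case: (boolP (x \in O)); rewrite ?inE ?notin_setE => Ox.
  move: oO; rewrite openE => /(_ _ Ox) /nbhs_ballP[e /= e0 eO].
  have ed : e <= dist_to (~` O) x.
    apply: le_dist_to => // y Oy; rewrite leNgt; apply/negP => xy.
    by apply: Oy; apply: eO; rewrite ballEmdist.
  apply: cvg_near_cst; near=> n; apply/min_idPl.
  apply: (@le_trans _ _ (n.+1%:R * e)); last by rewrite ler_wpM2l.
  rewrite -ler_pdivrMr// -natr1 -lerBlDr.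
  by near: n; exact: nbhs_infty_ger.
have -> : dist_to (~` O) x = 0.
  apply/eqP; rewrite eq_le; apply/andP; split.
    by rewrite -(mdistxx x); exact: dist_to_le.
  by apply: le_dist_to => // y _; exact: mdist_ge0.
rewrite (_ : (fun n => _) = fun=> 0); first exact: cvg_cst.
by apply/funext => n; rewrite mulr0; apply/min_idPr.
Unshelve. all: by end_near. Qed.

Lemma borel_measure_unique (m1 m2 : {measure set (borel X) -> \bar R}) :
  (m1 setT < +oo)%E -> (forall O : set X, open O -> m1 O = m2 O) ->
  forall A : set (borel X), measurable A -> m1 A = m2 A.
Proof.
move=> m1oo H A mA.
apply: (@g_sigma_algebra_measure_unique _ R (borel X) (@open X) _ (fun=> setT)) => //.
- by move=> O oO; exact: open_borel.
- by move=> _; exact: openT.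
- by apply/seteqP; split => // x _; exists 0%N.
- by move=> O1 O2; exact: openI.
Qed.

End LipschitzApproximation.

Section FactorIndependence.
Context {R : realType} {d1 d2 : measure_display}.
Context {X : measurableType d1} {W : measurableType d2}.
Variables (mu : probability X R) (rho : probability W R).

(** The measure [A |-> rho (V `&` pi @^-1` A)] is invariant under the ergodic map
    [sigma] and dominated by [mu]. *)
Lemma factor_independent (sigma : X -> X) (tau : W -> W) (pi : W -> X) (V : set W) :
  measurable_fun setT sigma -> (forall A, measurable A -> mu (sigma @^-1` A) = mu A) ->
  ergodic_map mu sigma ->
  measurable_fun setT tau -> (forall A, measurable A -> rho (tau @^-1` A) = rho A) ->
  measurable_fun setT pi -> (forall w, pi (tau w) = sigma (pi w)) ->
  (forall A, measurable A -> rho (pi @^-1` A) = mu A) ->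
  measurable V -> tau @^-1` V = V ->
  forall A, measurable A -> rho (V `&` pi @^-1` A) = (rho V * mu A)%E.
Proof.
move=> msigma psigma esigma mtau ptau mpi pitau pirho mV tV A mA.
have mpiA B : measurable B -> measurable (pi @^-1` B).
  by move=> mB; rewrite -[X in measurable X]setTI; exact: mpi.
pose m : set X -> \bar R := pushforward (mrestr rho mV) pi.
have mE B : m B = rho (V `&` pi @^-1` B) by rewrite /m /pushforward /mrestr setIC.
have := @ergodic_proportional _ _ _ mu sigma msigma psigma esigma (pushforward (mrestr rho mV) pi).
move=> /(_ mpi) H; rewrite -mE -[V in RHS]setIT -(preimage_setT pi) -mE.
apply: H => // [|B mB|B mB B0].
- rewrite -[ltLHS]/(m setT) mE -ge0_fin_numE//; apply: fin_num_measure.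
  by apply: measurableI => //; exact: mpiA.
- rewrite -[LHS]/(m _) -[RHS]/(m _) !mE.
  have mVB : measurable (V `&` pi @^-1` B) by apply: measurableI => //; exact: mpiA.
  rewrite -(ptau _ mVB) preimage_setI tV; congr (rho (V `&` _)).
  by apply/funext => w; rewrite /preimage/= pitau.
- rewrite -[LHS]/(m _) mE; apply/eqP; rewrite eq_le measure_ge0 andbT -B0 -(pirho _ mB).
  by apply: le_measure; rewrite ?inE//; [apply: measurableI => //|]; exact: mpiA.
Qed.

End FactorIndependence.

(** * Compact sets and almost-identity automorphisms *)

Section CompactReturns.
Context {R : realType} (X Y : pointedMetricType R).
Variables (mu : probability (borel X) R) (Xk : nat -> set X) (A : nat -> X -> X).
Hypothesis mXk : forall k, measurable (Xk k : set (borel X)).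
Hypothesis Xk_cvg : mu (Xk k) @[k --> \oo] --> mu setT.
Hypothesis autA : forall k, is_aut mu (Xk k) (A k).
Hypothesis A_cvg : forall e : R, 0 < e ->
  \forall k \near \oo, forall x, Xk k x -> mdist (A k x) x < e.

Lemma finite_compact_returns (G : Y -> set X) (s : seq Y) :
  (forall y, compact (G y)) -> forall e : R, 0 < e -> \forall k \near \oo,
  exists N : set (borel X), [/\ measurable N, fine (mu N) <= e &
    forall y x, y \in s -> Xk k x -> G y x -> ~ N x -> G y (A k x)].
Proof.
move=> cG; elim: s => [|y0 s IH] e e0.
  by near=> k; exists set0; split; [exact: measurable0|rewrite measure0 ltW|].
have e2 : 0 < e / 2 by rewrite divr_gt0.
have H1 := IH _ e2.
have H2 := compact_almost_returns mXk Xk_cvg autA A_cvg (cG y0) e2.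
near=> k.
have [N [mN Ne HN]] : exists N : set (borel X), [/\ measurable N, fine (mu N) <= e / 2 &
    forall y x, y \in s -> Xk k x -> G y x -> ~ N x -> G y (A k x)] by near: k.
have [mB Be] : measurable (Xk k `&` (G y0 `\` A k @^-1` G y0) : set (borel X)) /\
    fine (mu (Xk k `&` (G y0 `\` A k @^-1` G y0))) <= e / 2 by near: k.
exists ((Xk k `&` (G y0 `\` A k @^-1` G y0)) `|` N); split.
- exact: measurableU.
- by apply: le_trans (prU2 mu mB mN) _; rewrite [leRHS]splitr lerD.
- move=> y x; rewrite inE => /orP[/eqP->|ys] Xx Gx nN.
    by apply: contrapT => nG; apply: nN; left.
  by apply: (HN y) => // Nx; apply: nN; right.
Unshelve. all: by end_near. Qed.

(** Points [x] and [A k x] are lifted to [G] without any measurable selection: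
    [G] is cut into finitely many compact slices, thin in the second
    coordinate, and outside a small set [A k] maps the projection of each slice
    into itself. *)
Lemma compact_fibre_returns (G : set (X * Y)) (E : nat -> set X) (c delta : R) :
  compact G -> (forall k, measurable (E k : set (borel X))) ->
  (forall k, c <= fine (mu (E k))) -> 0 < c -> 0 < delta ->
  1 - c / 2 < fine (mu (fst @` G)) ->
  \forall k \near \oo, exists x y y',
    [/\ E k x, Xk k x, G (x, y), G (A k x, y') & mdist y y' < delta].
Proof.
move=> cG mE cE c0 d0 mG.
have d3 : 0 < delta / 3 by rewrite divr_gt0.
pose B (y0 : Y) := [set y | mdist y0 y <= delta / 3].
pose Gs (y0 : Y) : set X := fst @` (G `&` (setT `*` B y0)).
have cB y0 : closed (B y0).
  rewrite (_ : B y0 = ~` [set y | delta / 3 < mdist y0 y]); last first.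
    by apply/seteqP; split => y; rewrite /B/= leNgt => /negP.
  apply: open_closedC; apply: metric_openP => y /= dy.
  exists (mdist y0 y - delta / 3); first by rewrite subr_gt0.
  move=> z yz; have := metric_triangle y0 z y; rewrite (metric_sym z y) => ?; lra.
have cGs y0 : compact (Gs y0).
  apply: continuous_compact.
    by apply: continuous_subspaceT => z; exact: cvg_fst.
  apply: compact_closedI => //; rewrite (_ : _ `*` _ = snd @^-1` (B y0)).
    by apply: closed_comp => // z _; exact: cvg_snd.
  by apply/seteqP; split => [[x y] []|[x y]].
have cK : compact (snd @` G).
  apply: continuous_compact => //.
  by apply: continuous_subspaceT => z; exact: cvg_snd.
have [s cov] : exists s : seq Y, forall y, (snd @` G) y -> exists2 y0, y0 \in s & B y0 y.
  move: cK; rewrite compact_cover => /(_ Y setT (fun y0 => [set y | mdist y0 y < delta / 3])).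
  case.
  - move=> y0 _; apply: metric_openP => y /= dy.
    exists (delta / 3 - mdist y0 y); first by rewrite subr_gt0.
    move=> z yz; have := metric_triangle y0 y z => ?; lra.
  - by move=> y _; exists y => //=; rewrite mdistxx.
  - move=> D' _ cov; exists (finmap.enum_fset D') => y /cov[y0 /= y0D /ltW ?].
    by exists y0.
have mK : measurable (fst @` G : set (borel X)).
  apply: compact_borel; apply: continuous_compact => //.
  by apply: continuous_subspaceT => z; exact: cvg_fst.
have c4 : 0 < c / 4 by rewrite divr_gt0.
have H1 := finite_compact_returns s cGs c4.
have H2 : \forall k \near \oo, 1 - c / 4 < fine (mu (Xk k)).
  have : fine (mu (Xk k)) @[k --> \oo] --> fine (mu setT).
    by apply: fine_cvg; rewrite fineK ?fin_num_measure.
  rewrite pr_setT => /cvgr_gt; apply; lra.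
near=> k.
have [N [mN Nc HN]] : exists N : set (borel X), [/\ measurable N, fine (mu N) <= c / 4 &
    forall y x, y \in s -> Xk k x -> Gs y x -> ~ N x -> Gs y (A k x)] by near: k.
have Xc : 1 - c / 4 < fine (mu (Xk k)) by near: k.
have [x [Ex Xx Kx nN]] : exists x, [/\ E k x, Xk k x, (fst @` G) x & ~ N x].
  apply: contrapT => H.
  have sub : E k `<=` (~` Xk k `|` ~` (fst @` G)) `|` N.
    move=> x Ex; have [Xx|] := pselect (Xk k x); last by left; left.
    have [Kx|] := pselect ((fst @` G) x); last by left; right.
    by right; apply: contrapT => nN; apply: H; exists x.
  have mXC : measurable (~` Xk k : set (borel X)) by exact: measurableC.
  have mKC : measurable (~` (fst @` G) : set (borel X)) by exact: measurableC.
  have mU : measurable (~` Xk k `|` ~` (fst @` G) : set (borel X)) by exact: measurableU.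
  have := pr_le mu (mE k) (measurableU _ _ mU mN) sub.
  have := prU2 mu mU mN; have := prU2 mu mXC mKC; rewrite !prC//.
  by have := cE k; lra.
have [[x1 y] /= Gy xE] := Kx; rewrite {}xE in Gy.
have [|y0 y0s By] := cov y; first by exists (x, y).
have [|[x2 y'] [Gy' [_ /= By']] /= xE] := HN y0 x y0s Xx _ nN; first by exists (x, y).
exists x, y, y'; split => //; first by rewrite -xE.
move: By By'; rewrite /B/= => By By'.
have := metric_triangle y y0 y'; rewrite (metric_sym y y0); lra.
Unshelve. all: by end_near. Qed.

End CompactReturns.

(** * Invariant sets cut out by time means *)

Lemma pr_eq0 d (T : measurableType d) (R : realType) (mu : probability T R) A :
  measurable A -> fine (mu A) = 0 -> mu A = 0%E.
Proof. by move=> mA A0; rewrite -pr_EFin// A0. Qed.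

Lemma ae_le_Rintegral d (T : measurableType d) (R : realType) (mu : probability T R)
    (W : set T) (g h : T -> R) (K : R) :
  measurable W -> measurable_fun setT g -> measurable_fun setT h ->
  (forall z, `|g z| <= K) -> (forall z, `|h z| <= K) ->
  mu.-negligible (W `&` [set z | h z < g z]) ->
  \int[mu]_(z in W) g z <= \int[mu]_(z in W) h z.
Proof.
move=> mW mg mh gK hK nD.
pose m z := Num.min (g z) (h z).
have mm : measurable_fun setT m by exact: measurable_minr.
have mK z : `|m z| <= K by rewrite /m /Order.min; case: ifP.
have -> : \int[mu]_(z in W) g z = \int[mu]_(z in W) m z.
  congr fine; apply: ae_eq_integral => //.
  - by apply/measurable_EFinP; exact: measurable_funTS.
  - by apply/measurable_EFinP; exact: measurable_funTS.
  - apply: (@negligibleS _ _ _ _ (W `&` [set z | h z < g z])) => //.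
    move=> z /= /not_implyP[Wz gm]; split => //=; rewrite ltNge; apply/negP => gh.
    by apply: gm; congr EFin; apply/esym/min_idPl.
apply: le_Rintegral => //.
- exact: bounded_integrable mm mK.
- exact: bounded_integrable mh hK.
- by move=> z _; rewrite ge_min lexx orbT.
Qed.

Lemma scaled_flow (R : realType) d (T : measurableType d) (mu : probability T R)
    (phi : R -> T -> T) (s : R) :
  pmp_flow mu phi -> pmp_flow mu (fun t => phi (s * t)).
Proof.
move=> flow; split.
- by move=> z; rewrite mulr0 (pmp_flow0 flow).
- by move=> t u z; rewrite mulrDr (pmp_flowD flow).
- have ms : measurable_fun [set: measurableTypeR R * T] (fun p => (s * p.1 : measurableTypeR R, p.2)).
    apply/measurable_fun_pairP; split; last exact: measurable_snd.
    have ms : @measurable_fun _ _ (measurableTypeR R) (measurableTypeR R) setT (fun x => s * x).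
      exact: mulrl_measurable.
    exact: (measurableT_comp ms measurable_fst).
  exact: (measurableT_comp (pmp_flow_measurable flow) ms).
- by move=> t A mA; exact: (pmp_flow_preserving flow).
Qed.

Section InvariantSets.
Context {R : realType} {d : measure_display} {T : measurableType d}.
Variables (mu : probability T R) (phi : R -> T -> T).
Hypothesis flow : pmp_flow mu phi.

Definition flow_invariant (W : set T) : Prop :=
  measurable W /\ forall s, phi s @^-1` W = W.

Lemma flow_invariantI W V : flow_invariant W -> flow_invariant V ->
  flow_invariant (W `&` V).
Proof.
move=> [mW iW] [mV iV]; split; first exact: measurableI.
by move=> s; rewrite preimage_setI iW iV.
Qed.

Section direction.
Variable s : R.
Hypothesis s_neq0 : s != 0.

Let tm := time_mean (fun t => phi (s * t)).

Lemma scaled_time_mean_invariant (f : T -> R) : measurable_fun setT f ->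
  (forall z, 0 <= f z <= 1) -> forall t z, tm f (phi t z) = tm f z.
Proof.
move=> mf f01 t z; have H := time_mean_invariant (scaled_flow s flow) mf f01 (s^-1 * t) z.
have E : s * (s^-1 * t) = t by rewrite mulrA divff ?mul1r.
by rewrite E in H; exact: H.
Qed.

Lemma time_mean_gt_invariant (f : T -> R) (c : R) : measurable_fun setT f ->
  (forall z, 0 <= f z <= 1) -> flow_invariant [set z | c < tm f z].
Proof.
move=> mf f01; split; last first.
  by move=> t; apply/funext => z; rewrite /preimage/= scaled_time_mean_invariant.
have mt := measurable_time_mean (scaled_flow s flow) mf f01.
rewrite (_ : [set z | _] = tm f @^-1` `]c, +oo[).
  by rewrite -[X in measurable X]setTI; apply: mt => //; exact: measurable_itv.
by apply/seteqP; split => z /=; rewrite in_itv/= andbT.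
Qed.

Lemma time_mean_lt_invariant (f : T -> R) (c : R) : measurable_fun setT f ->
  (forall z, 0 <= f z <= 1) -> flow_invariant [set z | tm f z < c].
Proof.
move=> mf f01; split; last first.
  by move=> t; apply/funext => z; rewrite /preimage/= scaled_time_mean_invariant.
have mt := measurable_time_mean (scaled_flow s flow) mf f01.
rewrite (_ : [set z | _] = tm f @^-1` `]-oo, c[).
  by rewrite -[X in measurable X]setTI; apply: mt => //; exact: measurable_itv.
by apply/seteqP; split => z /=; rewrite in_itv/=.
Qed.

(** If the time mean were at most [c + e] almost everywhere on [W], integrating would
    contradict the strict inequality once [e] is half the excess. *)
Lemma time_mean_exceeds (f : T -> R) (W : set T) (c : R) : measurable_fun setT f ->
  (forall z, 0 <= f z <= 1) -> flow_invariant W ->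
  c * fine (mu W) < \int[mu]_(z in W) f z ->
  exists2 e : R, 0 < e & 0 < fine (mu (W `&` [set z | c + e < tm f z])).
Proof.
move=> mf f01 [mW iW] cf; pose e := (\int[mu]_(z in W) f z - c * fine (mu W)) / 2.
have e0 : 0 < e by rewrite divr_gt0// subr_gt0.
exists e => //; rewrite lt_neqAle fine_ge0// andbT; apply/negP => /eqP eq0.
have [mV _] := time_mean_gt_invariant (c + e) mf f01.
have mWV : measurable (W `&` [set z | c + e < tm f z]) by exact: measurableI.
have nV : mu.-negligible (W `&` [set z | c + e < tm f z]).
  by exists (W `&` [set z | c + e < tm f z]); split => //; rewrite -pr_EFin// -eq0.
have flowS := scaled_flow s flow.
have mt := measurable_time_mean flowS mf f01.
have bt := time_mean_bounded flowS mf f01.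
have := @ae_le_Rintegral _ _ _ mu W (tm f) (cst (c + e)) (Num.max 1 `|c + e|) mW mt
  (measurable_cst _).
rewrite (time_mean_integral flowS mf f01 mW)//.
move=> /(_ _ _ nV); rewrite Rintegral_cst// => H.
have : \int[mu]_(z in W) f z <= (c + e) * fine (mu W).
  apply: H => z; rewrite le_max ?lexx ?orbT//.
  by rewrite bt.
have : e * fine (mu W) <= e by rewrite ler_piMr ?pr_le1// ltW.
have eE : \int[mu]_(z in W) f z = c * fine (mu W) + 2 * e by rewrite /e; lra.
by rewrite mulrDl eE; lra.
Qed.

(** The time means have the integrals of [f] and [g], so the first is less than the
    second on a set of positive measure, which countably many pairs of rationals
    cover. *)
Lemma time_mean_separates (f g : T -> R) (W : set T) : measurable_fun setT f ->
  (forall z, 0 <= f z <= 1) -> measurable_fun setT g -> (forall z, 0 <= g z <= 1) ->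
  flow_invariant W -> \int[mu]_(z in W) f z < \int[mu]_(z in W) g z ->
  exists q r : R, q < r /\
    0 < fine (mu (W `&` ([set z | tm f z < q] `&` [set z | r < tm g z]))).
Proof.
move=> mf f01 mg g01 [mW iW] fg; apply: contrapT => H.
have flowS := scaled_flow s flow.
have mtf := measurable_time_mean flowS mf f01.
have btf := time_mean_bounded flowS mf f01.
have mtg := measurable_time_mean flowS mg g01.
have btg := time_mean_bounded flowS mg g01.
have := @ae_le_Rintegral _ _ _ mu W (tm g) (tm f) 1 mW mtg mtf btg btf.
rewrite !(time_mean_integral flowS _ _ mW)// leNgt fg.
suff nV : mu.-negligible (W `&` [set z | tm f z < tm g z]) by move=> /(_ nV).
pose B (p : rat * rat) := [set z | p.1 < p.2 /\
  (W `&` ([set z | tm f z < ratr p.1] `&` [set z | ratr p.2 < tm g z])) z].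
apply: (@negligibleS _ _ _ _ (\bigcup_p B p)).
  move=> z [Wz /= /rat_in_itvoo[q1]]; rewrite in_itv/= => /andP[fq1 q1g].
  have /rat_in_itvoo[q2] := q1g; rewrite in_itv/= ltr_rat => /andP[q12 q2g].
  by exists (q1, q2).
apply: negligible_countable => p.
have [p12|p12] := boolP (p.1 < p.2); last first.
  by rewrite (_ : B p = set0); [exact: negligible_set0|apply/seteqP; split => z //= []; rewrite (negbTE p12)].
pose C := W `&` ([set z | tm f z < ratr p.1] `&` [set z | ratr p.2 < tm g z]).
have mC : measurable C.
  apply: measurableI => //; apply: measurableI.
    by case: (time_mean_lt_invariant (ratr p.1) mf f01).
  by case: (time_mean_gt_invariant (ratr p.2) mg g01).
exists C; split => //; last by move=> z [].
apply: pr_eq0 => //; apply/eqP; rewrite eq_le pr_ge0 andbT leNgt; apply/negP => C0.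
by apply: H; exists (ratr p.1), (ratr p.2); rewrite ltr_rat.
Qed.

End direction.

(** Almost everywhere convergence is uniform up to a small set. *)
Lemma uniform_time_mean (f : T -> R) (th e : R) : measurable_fun setT f ->
  (forall z, 0 <= f z <= 1) -> 0 < th -> 0 < e ->
  exists (N : nat) (V : set T), [/\ measurable V, 1 - e < fine (mu V) &
    forall z n, V z -> (N <= n)%N ->
    `|n%:R^-1 * \int[@lebesgue_measure R]_(t in `[0, n%:R]) f (phi t z)
      - time_mean phi f z| <= th].
Proof.
move=> mf f01 th0 e0.
pose a n z := n%:R^-1 * \int[@lebesgue_measure R]_(t in `[0, n%:R]) f (phi t z).
pose V N := \bigcap_(n in [set n | (N <= n)%N]) [set z | `|a n z - time_mean phi f z| <= th].
have ma n : measurable_fun setT (a n).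
  rewrite (_ : a n = birkhoff_avg (phi 1) (unit_mean phi f) n).
    apply: measurable_birkhoff_avg; first exact: (flow_map_measurable flow 1).
    exact: (measurable_unit_mean flow).
  by apply/funext => z; rewrite (birkhoff_avg_unit_mean flow).
have mt := measurable_time_mean flow mf f01.
have mV N : measurable (V N).
  apply: bigcap_measurable; first by exists N => /=.
  move=> n _; rewrite (_ : [set z | _] = (fun z => `|a n z - time_mean phi f z|) @^-1` `]-oo, th]).
    rewrite -[X in measurable X]setTI.
    have : measurable_fun setT (fun z => `|a n z - time_mean phi f z|).
      by apply: measurableT_comp; [exact: normr_measurable|exact: measurable_funB].
    by apply => //; exact: measurable_itv.
  by apply/seteqP; split => z /=; rewrite in_itv/=.
have ndV : nondecreasing_seq V.
  by move=> m n mn; apply/subsetPset => z Vz k /= nk; apply: Vz => /=; exact: leq_trans nk.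
have cv := pr_cvg_nondecreasing (mu := mu) mV ndV.
have U1 : fine (mu (\bigcup_N V N)) = 1.
  have mU : measurable (\bigcup_N V N) by exact: bigcupT_measurable.
  have := prC mu mU; have -> : mu (~` \bigcup_N V N) = 0%E.
    have [B [mB B0 sB]] := time_mean_cvg flow mf f01.
    apply/eqP; rewrite eq_le measure_ge0 andbT -B0; apply: le_measure; rewrite ?inE//.
      exact: measurableC.
    apply: subset_trans sB => z nU /= cz; apply: nU.
    have /cvgrPdist_le/(_ _ th0)[N _ HN] := cz.
    by exists N => // n /= Nn; rewrite distrC; exact: HN.
  by move=> /=; lra.
rewrite U1 in cv; have lt : 1 - e < 1 by lra.
have [N _ /(_ N (leqnn N)) HN] := cvgr_gt _ cv _ lt.
exists N, (V N); split => //.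
by move=> z n Vz Nn; exact: Vz.
Qed.

End InvariantSets.

(** * Joinings restricted to invariant sets *)

Section Joining.
Context {R : realType} (X Y : pointedMetricType R).
Variables (mu : probability (borel X) R) (nu : probability (borel Y) R).
Variables (T : R -> X -> X) (S : R -> Y -> Y).
Variable rho : probability (borel X * borel Y)%type R.
Hypothesis flowT : pmp_flow mu (T : R -> borel X -> borel X).
Hypothesis flowS : pmp_flow nu (S : R -> borel Y -> borel Y).
Hypothesis wmT : weakly_mixing mu (T : R -> borel X -> borel X).
Hypothesis wmS : weakly_mixing nu (S : R -> borel Y -> borel Y).
Hypothesis joining : is_joining mu nu T S rho.

Definition joint_flow (t : R) (z : borel X * borel Y) : borel X * borel Y :=
  (T t z.1, S t z.2).

Lemma joint_flow_pmp : pmp_flow rho joint_flow.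
Proof.
split.
- by move=> [x y]; rewrite /joint_flow/= (pmp_flow0 flowT) (pmp_flow0 flowS).
- by move=> s t [x y]; rewrite /joint_flow/= (pmp_flowD flowT) (pmp_flowD flowS).
- apply/measurable_fun_pairP; split.
    have m1 : measurable_fun [set: measurableTypeR R * (borel X * borel Y)]
        (fun p => (p.1, p.2.1)).
      apply/measurable_fun_pairP; split; first exact: measurable_fst.
      exact: (measurableT_comp measurable_fst measurable_snd).
    exact: (measurableT_comp (pmp_flow_measurable flowT) m1).
  have m2 : measurable_fun [set: measurableTypeR R * (borel X * borel Y)]
      (fun p => (p.1, p.2.2)).
    apply/measurable_fun_pairP; split; first exact: measurable_fst.
    exact: (measurableT_comp measurable_snd measurable_snd).
  exact: (measurableT_comp (pmp_flow_measurable flowS) m2).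
- by move=> t C mC; exact: (joining_invariant joining).
Qed.

Definition fst_shift (p : R) (z : borel X * borel Y) : borel X * borel Y := (T p z.1, z.2).

Lemma measurable_fst_shift p : measurable_fun setT (fst_shift p).
Proof.
apply/measurable_fun_pairP; split; last exact: measurable_snd.
exact: (measurableT_comp (flow_map_measurable flowT p) measurable_fst).
Qed.

Lemma setXTE (A : set (borel X)) : A `*` setT = (fst : borel X * borel Y -> borel X) @^-1` A.
Proof. by apply/seteqP; split => [[x y] []|[x y]]. Qed.

Lemma setTXE (B : set (borel Y)) : setT `*` B = (snd : borel X * borel Y -> borel Y) @^-1` B.
Proof. by apply/seteqP; split => [[x y] []|[x y]]. Qed.

(** [W] is invariant under the time-one map, which factors onto the ergodic map
    [T 1]. *)
Lemma invariant_fst_independent W : flow_invariant joint_flow W ->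
  forall A, measurable A -> rho (W `&` (A `*` setT)) = (rho W * mu A)%E.
Proof.
move=> [mW iW] A mA; rewrite setXTE.
have fl := joint_flow_pmp.
apply: (factor_independent (flow_map_measurable flowT 1) (pmp_flow_preserving flowT 1)
  (weakly_mixing_ergodic_map flowT wmT (oner_neq0 _))
  (flow_map_measurable fl 1) (pmp_flow_preserving fl 1) measurable_fst) => //.
by move=> B mB; rewrite -setXTE (joining_fst joining).
Qed.

Lemma invariant_snd_independent W : flow_invariant joint_flow W ->
  forall B, measurable B -> rho (W `&` (setT `*` B)) = (rho W * nu B)%E.
Proof.
move=> [mW iW] B mB; rewrite setTXE.
have fl := joint_flow_pmp.
apply: (factor_independent (flow_map_measurable flowS 1) (pmp_flow_preserving flowS 1)
  (weakly_mixing_ergodic_map flowS wmS (oner_neq0 _))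
  (flow_map_measurable fl 1) (pmp_flow_preserving fl 1) measurable_snd) => //.
by move=> A mA; rewrite -setTXE (joining_snd joining).
Qed.

(** Test functions whose values along two orbits are comparable when the orbits
    are close in both coordinates. *)
Definition lipschitz_unit (f : borel X * borel Y -> R) (C : R) : Prop :=
  [/\ measurable_fun setT f, forall z, 0 <= f z <= 1, 0 <= C &
      forall x x' y y', `|f (x, y) - f (x', y')| <= C * (mdist x x' + mdist y y')].

Lemma lipschitz_unit_onem f C : lipschitz_unit f C -> lipschitz_unit (fun z => 1 - f z) C.
Proof.
move=> [mf f01 C0 fC]; split => //.
- exact: measurable_onem.
- exact: unit_onem.
- move=> x x' y y'; rewrite (_ : _ - _ = f (x', y') - f (x, y)); last by ring.
  by rewrite distrC; exact: fC.
Qed.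

Definition rect_approx (O : set X) (O' : set Y) n (z : borel X * borel Y) : R :=
  open_approx O n z.1 * open_approx O' n z.2.

Lemma rect_approx_lipschitz O O' n : lipschitz_unit (rect_approx O O' n) n.+1%:R.
Proof.
have u1 := open_approx_unit O n; have u2 := open_approx_unit O' n.
split => //.
- apply: measurable_funM.
    exact: (measurableT_comp (lipschitz_borel_measurable (open_approx_lip O n)) measurable_fst).
  exact: (measurableT_comp (lipschitz_borel_measurable (open_approx_lip O' n)) measurable_snd).
- by move=> z; rewrite /rect_approx; have := u1 z.1; have := u2 z.2; nra.
- move=> x x' y y'; rewrite /rect_approx/= mulrDr.
  rewrite (_ : _ - _ = (open_approx O n x - open_approx O n x') * open_approx O' n y +
    open_approx O n x' * (open_approx O' n y - open_approx O' n y')); last by ring.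
  apply: le_trans (ler_normD _ _) _; apply: lerD; rewrite normrM.
    rewrite -[leRHS]mulr1; apply: ler_pM => //; first exact: open_approx_lip.
    by have /andP[? ?] := u2 y; rewrite ger0_norm.
  rewrite -[leRHS]mul1r; apply: ler_pM => //; last exact: open_approx_lip.
  by have /andP[? ?] := u1 x'; rewrite ger0_norm.
Qed.

Lemma rect_approx_cvg O O' z : open O -> open O' ->
  rect_approx O O' n z @[n --> \oo] --> (\1_(O `*` O') z : R).
Proof.
move=> oO oO'; have -> : \1_(O `*` O') z = \1_O z.1 * \1_O' z.2 :> R.
  rewrite !indicE -natrM mulnb; congr (_%:R); congr nat_of_bool.
  apply/idP/andP; first by rewrite inE => -[? ?]; rewrite !inE.
  by rewrite !inE => -[].
by apply: cvgM; exact: open_approx_cvg.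
Qed.

(** If no Lipschitz function distinguishes [rho] restricted to [W] from its
    translate by [T p] in the first coordinate, that restriction is invariant
    under the ergodic map [T p], hence a product. *)
Lemma shift_invariant_product W p : p != 0 -> flow_invariant joint_flow W ->
  (forall f C, lipschitz_unit f C ->
     \int[rho]_(z in W) f z = \int[rho]_(z in W) f (fst_shift p z)) ->
  forall (A : set (borel X)) (O : set Y), measurable A -> open O ->
  rho (W `&` (A `*` O)) = (rho W * mu A * nu O)%E.
Proof.
move=> p0 iW H A O mA oO; have [mW _] := iW.
have mO : measurable (O : set (borel Y)) by exact: open_borel.
pose V := W `&` (setT `*` O).
have mV : measurable V by apply: measurableI => //; exact: measurableX.
have msh := measurable_fst_shift p.
pose m : set (borel X) -> \bar R := pushforward (mrestr rho mV) fst.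
have mE B : m B = rho (W `&` (B `*` O)).
  rewrite /m /pushforward /mrestr; congr (rho _).
  by apply/seteqP; split => [[x y] /= [? [? [? ?]]]|[x y] /= [? [? ?]]].
have mfst : measurable_fun setT (fst : borel X * borel Y -> borel X) by exact: measurable_fst.
pose m' : set (borel X) -> \bar R := pushforward (mrestr rho mV) (fst \o fst_shift p).
have m'E B : m' B = rho (W `&` ((T p @^-1` B) `*` O)).
  rewrite /m' /pushforward /mrestr; congr (rho _).
  by apply/seteqP; split => [[x y] /= [? [? [? ?]]]|[x y] /= [? [? ?]]].
have mfs : measurable_fun setT (fst \o fst_shift p : borel X * borel Y -> borel X).
  exact: measurableT_comp mfst msh.
have moo : (m setT < +oo)%E.
  by rewrite mE -ge0_fin_numE//; apply: fin_num_measure; apply: measurableI => //; exact: measurableX.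
have mopen (U : set X) : open U -> m U = m' U.
  move=> oU; have mU : measurable (U : set (borel X)) by exact: open_borel.
  rewrite mE m'E.
  have mWU : measurable (W `&` (U `*` O)) by apply: measurableI => //; exact: measurableX.
  have mTU : measurable (T p @^-1` U : set (borel X)).
    exact: (flow_preimage_measurable flowT).
  have mWTU : measurable (W `&` ((T p @^-1` U) `*` O)).
    by apply: measurableI => //; exact: measurableX.
  rewrite -(pr_EFin rho mWU) -(pr_EFin rho mWTU); congr EFin.
  have b n z : `|rect_approx U O n z| <= 1.
    by have [_ u _ _] := rect_approx_lipschitz U O n; have /andP[? ?] := u z; rewrite ger0_norm.
  have mr n : measurable_fun setT (rect_approx U O n).
    by have [] := rect_approx_lipschitz U O n.
  have c1 : \int[rho]_(z in W) rect_approx U O n z @[n --> \oo] --> fine (rho (W `&` (U `*` O))).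
    rewrite -Rintegral_indicI//; last exact: measurableX.
    apply: (bounded_Rintegral_cvg mW mr _ b).
      by apply: measurable_indic; exact: measurableX.
    by apply: aeW => z _; exact: rect_approx_cvg.
  have c2 : \int[rho]_(z in W) rect_approx U O n (fst_shift p z) @[n --> \oo] -->
      fine (rho (W `&` ((T p @^-1` U) `*` O))).
    rewrite -Rintegral_indicI//; last exact: measurableX.
    apply: (bounded_Rintegral_cvg mW (fun n => measurableT_comp (mr n) msh) _
      (fun n z => b n (fst_shift p z))).
      by apply: measurable_indic; exact: measurableX.
    apply: aeW => z _.
    have -> : \1_((T p @^-1` U) `*` O) z = \1_(U `*` O) (fst_shift p z) :> R by rewrite !indicE.
    exact: rect_approx_cvg.
  apply: (cvg_unique _ c1) => //.
  rewrite (_ : (fun n => _) = (fun n => \int[rho]_(z in W) rect_approx U O n (fst_shift p z)))//.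
  by apply/funext => n; exact: (H _ _ (rect_approx_lipschitz U O n)).
have minv (B : set (borel X)) : measurable B -> m (T p @^-1` B) = m B.
  move=> mB; rewrite mE -m'E.
  have /(_ mfst mfs) U := @borel_measure_unique R X (pushforward (mrestr rho mV) fst)
    (pushforward (mrestr rho mV) (fst \o fst_shift p)).
  by apply/esym; apply: (U moo mopen).
have mac (B : set (borel X)) : measurable B -> mu B = 0%E -> m B = 0%E.
  move=> mB B0; rewrite mE; apply/eqP; rewrite eq_le measure_ge0 andbT -B0.
  rewrite -(joining_fst joining mB); apply: le_measure; rewrite ?inE.
  - by apply: measurableI => //; exact: measurableX.
  - exact: measurableX.
  - by move=> [x y] [_ [? _]].
have /(_ mfst) EP := @ergodic_proportional _ _ _ mu (T p) (flow_map_measurable flowT p)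
  (pmp_flow_preserving flowT p) (weakly_mixing_ergodic_map flowT wmT p0)
  (pushforward (mrestr rho mV) fst).
have := EP moo minv mac A mA; rewrite -/m => E.
rewrite -mE; transitivity (m setT * mu A)%E; first exact: E.
by rewrite mE invariant_snd_independent// muleAC.
Qed.

(** The sign of [s] is the direction of time in which the averages are taken. *)
Definition separated (s p : R) (W : set (borel X * borel Y)) : Prop :=
  exists (f : borel X * borel Y -> R) (C q r : R),
  [/\ lipschitz_unit f C, q < r &
      forall z, W z -> time_mean (fun t => joint_flow (s * t)) f z < q /\
        r < time_mean (fun t => joint_flow (s * t)) (f \o fst_shift p) z].

Lemma separated_sub s p W V : V `<=` W -> separated s p W -> separated s p V.
Proof.
move=> VW [f [C [q [r [lf qr H]]]]]; exists f, C, q, r; split => // z /VW; exact: H.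
Qed.

(** One rectangle refutes the product formula on all invariant subsets of positive
    measure, so the property is inherited by these. *)
Definition nowhere_product (W : set (borel X * borel Y)) : Prop :=
  exists (A : set (borel X)) (O : set Y), [/\ measurable A, open O &
    forall V, flow_invariant joint_flow V -> V `<=` W -> 0 < fine (rho V) ->
      rho (V `&` (A `*` O)) <> (rho V * mu A * nu O)%E].

(** By [shift_invariant_product] some Lipschitz function distinguishes the measure
    on [W] from its shift; replacing it by [1 - f] if necessary, its integral
    increases.  The time means see the difference on an invariant subset. *)
Lemma refine_separated s p W : s != 0 -> p != 0 ->
  flow_invariant joint_flow W -> 0 < fine (rho W) -> nowhere_product W ->
  exists V, [/\ flow_invariant joint_flow V, V `<=` W, 0 < fine (rho V) & separated s p V].
Proof.
move=> s0 p0 iW W0 [A [U [mA oU nP]]].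
have fl := joint_flow_pmp.
have [f [C [lf fne]]] : exists f C, lipschitz_unit f C /\
    \int[rho]_(z in W) f z <> \int[rho]_(z in W) f (fst_shift p z).
  apply: contrapT => H; apply: (nP W iW (@subset_refl _ _) W0).
  apply: (shift_invariant_product p0 iW) => // f C lf.
  by apply: contrapT => fne; apply: H; exists f, C.
have msh := measurable_fst_shift p.
wlog flt : f lf fne / \int[rho]_(z in W) f z < \int[rho]_(z in W) f (fst_shift p z).
  move=> H; have [lt|gt|eq] := ltgtP (\int[rho]_(z in W) f z) (\int[rho]_(z in W) f (fst_shift p z)).
  - exact: H lt.
  - have [mf f01 _ _] := lf.
    have mW : measurable W by case: iW.
    have Woo : (rho W < +oo)%E by rewrite -ge0_fin_numE// fin_num_measure.
    have lt : \int[rho]_(z in W) (1 - f z) < \int[rho]_(z in W) (1 - f (fst_shift p z)).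
      rewrite (Rintegral_onem mW Woo mf f01).
      have mfs : measurable_fun setT (f \o fst_shift p) by exact: measurableT_comp mf msh.
      by rewrite (Rintegral_onem mW Woo mfs (fun z => f01 _)) ltrD2l ltrN2.
    by apply: (H _ (lipschitz_unit_onem lf)) => //; apply/eqP; rewrite lt_eqF.
  - by [].
have [mf f01 _ _] := lf.
have mfs : measurable_fun setT (f \o fst_shift p) by exact: measurableT_comp mf msh.
have fs01 z : 0 <= (f \o fst_shift p) z <= 1 by exact: f01.
have [q [r [qr pos]]] := time_mean_separates fl s0 mf f01 mfs fs01 iW flt.
exists (W `&` ([set z | time_mean (fun t => joint_flow (s * t)) f z < q] `&`
  [set z | r < time_mean (fun t => joint_flow (s * t)) (f \o fst_shift p) z])).
have iq := time_mean_lt_invariant fl s0 q mf f01.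
have ir := time_mean_gt_invariant fl s0 r mfs fs01.
split; [exact: (flow_invariantI iW (flow_invariantI iq ir))|exact: subIsetl|exact: pos|].
by exists f, C, q, r; split => // z [_ []].
Qed.

(** On the invariant set where the time means of the indicator of the rectangle are
    on one side of the product value, no invariant subset can satisfy the product
    formula. *)
Lemma nonproduct_nowhere_product (A : set (borel X)) (O : set Y) :
  measurable A -> open O -> rho (A `*` O) <> (mu A * nu O)%E ->
  exists W, [/\ flow_invariant joint_flow W, 0 < fine (rho W) & nowhere_product W].
Proof.
move=> mA oO ne; have fl := joint_flow_pmp.
have mO : measurable (O : set (borel Y)) by exact: open_borel.
have mAO : measurable (A `*` O : set (borel X * borel Y)) by exact: measurableX.
pose c := fine (mu A) * fine (nu O).
have cE (V : set (borel X * borel Y)) : measurable V -> fine (rho (V `&` (A `*` O))) <> fine (rho V) * c ->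
    rho (V `&` (A `*` O)) <> (rho V * mu A * nu O)%E.
  move=> mV neV E; apply: neV; rewrite E /c mulrA.
  by rewrite !fineM ?fin_numM ?fin_num_measure.
(* Wherever the time mean of the indicator exceeds [c], resp. is less than [c],
   the rectangle has too much, resp. too little mass. *)
pose f : borel X * borel Y -> R := \1_(A `*` O).
have mf : measurable_fun setT f by exact: measurable_indic.
have f01 z : 0 <= f z <= 1 by rewrite /f indicE; case: (_ \in _); rewrite ?lexx ?ler01.
have iT : flow_invariant joint_flow setT by split => // s; exact: preimage_setT.
have one : (fun t => joint_flow (1 * t)) = joint_flow by apply/funext => t; rewrite mul1r.
have fE : \int[rho]_(z in setT) f z = fine (rho (A `*` O)) by rewrite Rintegral_indicI// setTI.
have key (g : borel X * borel Y -> R) (d : R) : measurable_fun setT g ->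
    (forall z, 0 <= g z <= 1) -> d < \int[rho]_(z in setT) g z ->
    (forall V, measurable V -> d * fine (rho V) < \int[rho]_(z in V) g z ->
      rho (V `&` (A `*` O)) <> (rho V * mu A * nu O)%E) ->
    exists W, [/\ flow_invariant joint_flow W, 0 < fine (rho W) & nowhere_product W].
  move=> mg g01 dg H.
  have := time_mean_exceeds fl (oner_neq0 R) mg g01 iT (c := d).
  rewrite probability_setT/= mulr1 => /(_ dg)[e e0 pos].
  have iW := time_mean_gt_invariant fl (oner_neq0 R) (d + e) mg g01.
  eexists; split; [exact: iW|by rewrite setTI in pos|].
  exists A, O; split => // V [mV iV] VW V0; apply: H => //.
  have flS := scaled_flow 1 fl.
  rewrite -(time_mean_integral flS mg g01 mV); last by move=> t; exact: iV.
  have mt := measurable_time_mean flS mg g01; have bt := time_mean_bounded flS mg g01.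
  apply: (@lt_le_trans _ _ ((d + e) * fine (rho V))).
    by rewrite ltr_pM2r// ltrDl.
  rewrite -Rintegral_cst//; apply: le_Rintegral => //.
  - apply: (@bounded_integrable _ _ _ rho V (cst (d + e)) `|d + e|) => //.
  - exact: bounded_integrable mt bt.
  - by move=> z /VW /= /ltW.
have [lt|gt|eq] := ltgtP (fine (rho (A `*` O))) c.
- apply: (key (fun z => 1 - f z) (1 - c)).
  + exact: measurable_onem.
  + exact: unit_onem.
  + have Too : (rho setT < +oo)%E by rewrite probability_setT ltry.
    rewrite (Rintegral_onem measurableT Too mf f01) [X in _ < _ - X]fE.
    by rewrite [X in _ < X - _](pr_setT rho) ltrD2l ltrN2.
  + move=> V mV; have Voo : (rho V < +oo)%E by rewrite -ge0_fin_numE// fin_num_measure.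
    rewrite Rintegral_onem// Rintegral_indicI// => h; apply: cE => // E.
    by move: h; rewrite E; lra.
- apply: (key f c) => //; first by rewrite fE.
  move=> V mV; rewrite Rintegral_indicI// => h; apply: cE => // E.
  by move: h; rewrite E; lra.
- exfalso; apply: ne; rewrite -(pr_EFin rho mAO) eq /c EFinM.
  by rewrite !fineK ?fin_num_measure.
Qed.

(** For fixed [A], both sides are finite Borel measures in the second factor. *)
Lemma joining_product_open :
  (forall (A : set (borel X)) (O : set Y), measurable A -> open O ->
     rho (A `*` O) = (mu A * nu O)%E) ->
  forall C, measurable C -> rho C = (mu \x nu)%E C.
Proof.
move=> H C mC; apply/esym; apply: product_measure_unique => // A B mA mB.
pose V := A `*` [set: borel Y].
have mV : measurable (V : set (borel X * borel Y)) by exact: measurableX.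
have msnd : measurable_fun setT (snd : borel X * borel Y -> borel Y) by exact: measurable_snd.
pose m : set (borel Y) -> \bar R := pushforward (mrestr rho mV) snd.
have mE D : m D = rho (A `*` D).
  rewrite /m /pushforward /mrestr; congr (rho _).
  by apply/seteqP; split => [[x y] /= [? []]|[x y] /= []].
have a0 : 0 <= fine (mu A) by exact: fine_ge0.
have /(_ msnd) U := @borel_measure_unique R Y (pushforward (mrestr rho mV) snd)
  (mscale (NngNum a0) nu).
rewrite -[LHS]/(rho (A `*` B)) -mE.
transitivity ((fine (mu A))%:E * nu B)%E; last by rewrite fineK ?fin_num_measure.
apply: U => //.
  by rewrite -[ltLHS]/(m setT) mE -ge0_fin_numE//; apply: fin_num_measure; exact: measurableX.
by move=> O oO; rewrite -[LHS]/(m O) mE H// /mscale/= -[in LHS](pr_EFin mu mA).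
Qed.

(** * Separation of time means against shadowing of orbits *)

Lemma refine_separated_all (l : seq (R * R)) W :
  (forall sp, sp \in l -> sp.1 != 0 /\ sp.2 != 0) ->
  flow_invariant joint_flow W -> 0 < fine (rho W) -> nowhere_product W ->
  exists V, [/\ flow_invariant joint_flow V, V `<=` W, 0 < fine (rho V) &
    forall sp, sp \in l -> separated sp.1 sp.2 V].
Proof.
elim: l => [|sp l IH] l0 iW W0 nW.
  by exists W; split => //; exact: subset_refl.
have [|V [iV VW V0 sV]] := IH _ iW W0 nW.
  by move=> u ul; apply: l0; rewrite inE ul orbT.
have [s0 p0] : sp.1 != 0 /\ sp.2 != 0 by apply: l0; rewrite mem_head.
have nV : nowhere_product V.
  case: nW => B [D [mB oD H]]; exists B, D; split => // V' iV' V'V.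
  exact: H iV' (subset_trans V'V VW).
have [V' [iV' V'V V'0 sV']] := refine_separated s0 p0 iV V0 nV.
exists V'; split; [exact: iV'|exact: subset_trans V'V VW|exact: V'0|].
move=> u; rewrite inE => /orP[/eqP->|ul]; first exact: sV'.
by apply: separated_sub (sV _ ul).
Qed.

(** A quantitative form of [separated], with one Lipschitz constant and one gap for
    a whole list of pairs [(s, p)]. *)
Definition separated_by (C eta s p : R) (W : set (borel X * borel Y)) : Prop :=
  exists (f : borel X * borel Y -> R) (q r : R),
  [/\ lipschitz_unit f C, q + eta <= r &
      forall z, W z -> time_mean (fun t => joint_flow (s * t)) f z < q /\
        r < time_mean (fun t => joint_flow (s * t)) (f \o fst_shift p) z].

Lemma separated_by_weaken C C' eta eta' s p W : C <= C' -> eta' <= eta ->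
  separated_by C eta s p W -> separated_by C' eta' s p W.
Proof.
move=> CC ee [f [q [r [[mf f01 C0 fC] qr H]]]]; exists f, q, r; split => //.
  split => //; first exact: le_trans CC.
  move=> x x' y y'; apply: le_trans (fC _ _ _ _) _; apply: ler_wpM2r => //.
  by rewrite addr_ge0 ?mdist_ge0.
by apply: le_trans qr; rewrite lerD2l.
Qed.

Lemma separated_by_uniform (l : seq (R * R)) W :
  (forall sp, sp \in l -> separated sp.1 sp.2 W) ->
  exists C eta : R, [/\ 0 <= C, 0 < eta & forall sp, sp \in l -> separated_by C eta sp.1 sp.2 W].
Proof.
elim: l => [_|sp l IH H]; first by exists 0, 1; split.
have [|C [eta [C0 eta0 HC]]] := IH; first by move=> u ul; apply: H; rewrite inE ul orbT.
have [f [C1 [q [r [lf qr Hf]]]]] := H sp (mem_head _ _).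
exists (Num.max C C1), (Num.min eta (r - q)); split.
- by rewrite le_max C0.
- by rewrite lt_min eta0 subr_gt0.
- move=> u; rewrite inE => /orP[/eqP->|ul]; last first.
    by apply: separated_by_weaken (HC u ul); rewrite ?le_max ?ge_min lexx.
  apply: (@separated_by_weaken C1 _ (r - q)); rewrite ?le_max ?ge_min ?lexx ?orbT//.
  by exists f, q, r; split => //; rewrite subrKC.
Qed.

Definition orbit_avg (s : R) (f : borel X * borel Y -> R) z (n : nat) : R :=
  n%:R^-1 * \int[@lebesgue_measure R]_(t in `[0, n%:R]) f (joint_flow (s * t) z).

(** What remains of [separated_by] when time means are replaced by averages over at
    least [N] units of time. *)
Definition separated_after (C eta th : R) (N : nat) (s p : R)
    (V : set (borel X * borel Y)) : Prop :=
  exists (f : borel X * borel Y -> R) (q r : R),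
  [/\ lipschitz_unit f C, q + eta <= r,
      forall z, V z -> exists2 l, l <= q &
        forall n, (N <= n)%N -> `|orbit_avg s f z n - l| <= th &
      forall z, V z -> exists2 l, r <= l &
        forall n, (N <= n)%N -> `|orbit_avg s (f \o fst_shift p) z n - l| <= th].

Lemma separated_after_uniform (l : seq (R * R)) W C eta th e : 
  0 < th -> 0 < e -> measurable W ->
  (forall sp, sp \in l -> separated_by C eta sp.1 sp.2 W) ->
  exists N V, [/\ measurable V, V `<=` W, fine (rho W) - e < fine (rho V) &
    forall sp, sp \in l -> separated_after C eta th N sp.1 sp.2 V].
Proof.
move=> th0; elim: l e => [|[s p] l IH] e e0 mW H.
  by exists 0%N, W; split => //; rewrite gtrBl.
have e2 : 0 < e / 2 by rewrite divr_gt0.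
have e4 : 0 < e / 4 by rewrite divr_gt0.
have [|N [V [mV VW Ve HV]]] := IH _ e2 mW; first by move=> u ul; apply: H; rewrite inE ul orbT.
have [f [q [r [lf qr Hf]]]] := H _ (mem_head _ _); rewrite /= in Hf.
have [mf f01 _ _] := lf.
have fl := scaled_flow s joint_flow_pmp.
have mfs : measurable_fun setT (f \o fst_shift p).
  exact: measurableT_comp mf (measurable_fst_shift p).
have fs01 z : 0 <= (f \o fst_shift p) z <= 1 by exact: f01.
have [N1 [V1 [mV1 V1e H1]]] := uniform_time_mean fl mf f01 th0 e4.
have [N2 [V2 [mV2 V2e H2]]] := uniform_time_mean fl mfs fs01 th0 e4.
exists (maxn N (maxn N1 N2)), (V `&` (V1 `&` V2)); split.
- by apply: measurableI => //; exact: measurableI.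
- exact: subset_trans (@subIsetl _ _ _) VW.
- have mI : measurable (V `&` (V1 `&` V2)) by apply: measurableI => //; exact: measurableI.
  have mC1 : measurable (~` V1) by exact: measurableC.
  have mC2 : measurable (~` V2) by exact: measurableC.
  have mU : measurable (~` V1 `|` ~` V2) by exact: measurableU.
  have sub : V `<=` (V `&` (V1 `&` V2)) `|` (~` V1 `|` ~` V2).
    move=> z Vz; have [V1z|] := pselect (V1 z); last by right; left.
    by have [V2z|] := pselect (V2 z); [left|right; right].
  have := pr_le rho mV (measurableU _ _ mI mU) sub.
  have := prU2 rho mI mU; have := prU2 rho mC1 mC2.
  rewrite (prC rho mV1) (prC rho mV2); lra.
- move=> u; rewrite inE => /orP[/eqP->/=|ul].
    exists f, q, r; split => //.
      move=> z [Vz [V1z _]]; exists (time_mean (fun t => joint_flow (s * t)) f z).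
        by have [/ltW] := Hf z (VW _ Vz).
      by move=> n; rewrite !geq_max => /and3P[_ n1 _]; exact: H1.
    move=> z [Vz [_ V2z]]; exists (time_mean (fun t => joint_flow (s * t)) (f \o fst_shift p) z).
      by have [_ /ltW] := Hf z (VW _ Vz).
    by move=> n; rewrite !geq_max => /and3P[_ _ n2]; exact: H2.
  have [f' [q' [r' [lf' qr' A1 A2]]]] := HV u ul; exists f', q', r'; split => //.
    move=> z [/A1[m mq Hm] _]; exists m => // n; rewrite geq_max => /andP[? _]; exact: Hm.
  move=> z [/A2[m mq Hm] _]; exists m => // n; rewrite geq_max => /andP[? _]; exact: Hm.
Qed.

(** The sign [s] treats forward and backward shadowing at once, by means of
    [a (- t) = - a t].  As the flow commutes with [fst_shift p], the orbit of
    [z'] is read through [f \o fst_shift p]. *)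
Lemma orbit_comparison (s p C M L c e : R) f a U z z' : s = 1 \/ s = -1 ->
  lipschitz_unit f C -> 0 < L -> 0 < e <= 1 / 2 -> 0 < c < 1 ->
  (forall t, M <= t <= M + L -> a (- t) = - a t) ->
  good_triple M (M + L) a U c e ->
  (forall t, U (s * t) -> Num.max (mdist (T t z.1) (T (a t + p) z'.1))
                                  (mdist (S t z.2) (S (a t) z'.2)) < e) ->
  `|\int[@lebesgue_measure R]_(t in `[M, M + L]) f (joint_flow (s * t) z) -
    \int[@lebesgue_measure R]_(t in `[M, M + L]) f (fst_shift p (joint_flow (s * t) z'))|
  <= (2 * C * e + 8 * (e / c)) * L.
Proof.
move=> s1 lf L0 e01 c01 aN gt close; have [mf f01 C0 fC] := lf.
have fl := scaled_flow s joint_flow_pmp.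
have mfs : measurable_fun setT (f \o fst_shift p).
  exact: measurableT_comp mf (measurable_fst_shift p).
have fs01 w : 0 <= (f \o fst_shift p) w <= 1 by exact: f01.
have e0 : 0 < e by case/andP: e01.
have ML : M < M + L by rewrite ltrDl.
have w0 : 0 <= 2 * C * e by rewrite mulr_ge0 ?(ltW e0)// mulr_ge0.
have := good_triple_compare ML e01 c01 w0 gt (orbit_measurable fl mf z) (fun=> f01 _)
  (orbit_measurable fl mfs z') (fun=> fs01 _).
rewrite (_ : M + L - M = L); last by rewrite addrAC subrr add0r.
apply => t Ut.
have tML : M <= t <= M + L by case: gt => _ _ /(_ _ Ut) + _; rewrite /= in_itv.
have ss : s * s = 1 by case: s1 => ->; rewrite ?mulr1 ?mulrNN ?mulr1.
have as_ : a (s * t) = s * a t.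
  by case: s1 => ->; rewrite ?mul1r ?mulN1r//; exact: aN.
have := close (s * t); rewrite mulrA ss mul1r => /(_ Ut); rewrite as_ gt_max => /andP[d1 d2].
rewrite /= /fst_shift /joint_flow /=.
rewrite -(pmp_flowD flowT) [p + _]addrC.
apply: le_trans (fC _ _ _ _) _; rewrite -mulrA (mulrCA 2) ler_wpM2l//.
by rewrite mulr2n mulrDl mul1r lerD// ltW.
Qed.

(** Shadowing on a window makes the two averages close, whereas each is close to its
    own side of the gap [eta]. *)
Lemma separated_orbits_far (s p C eta th kappa M L c e : R) N N' V a U z z' :
  s = 1 \/ s = -1 -> separated_after C eta th N s p V -> V z -> V z' ->
  (N <= N')%N -> 0 < th <= 1 -> 0 < kappa <= 1 -> 1 <= th * N'%:R ->
  N'%:R <= M -> M * kappa <= L -> 0 < L -> 0 < e <= 1 / 2 -> 0 < c < 1 ->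
  (forall t, M <= t <= M + L -> a (- t) = - a t) ->
  good_triple M (M + L) a U c e ->
  (forall t, U (s * t) -> Num.max (mdist (T t z.1) (T (a t + p) z'.1))
                                  (mdist (S t z.2) (S (a t) z'.2)) < e) ->
  eta <= 24 * th / kappa + (2 * C * e + 8 * (e / c)).
Proof.
move=> s1 [f [q [r [lf qr H1 H2]]]] Vz Vz' NN th01 k01 thN NM ML L0 e01 c01 aN gt close.
have cmp := orbit_comparison s1 lf L0 e01 c01 aN gt close.
have [mf f01 C0 fC] := lf.
have fl := scaled_flow s joint_flow_pmp.
have mfs : measurable_fun setT (f \o fst_shift p).
  exact: measurableT_comp mf (measurable_fst_shift p).
have fs01 w : 0 <= (f \o fst_shift p) w <= 1 by exact: f01.
have [l1 l1q A1] := H1 z Vz; have [l2 rl2 A2] := H2 z' Vz'.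
have W1 := window_mean (orbit_measurable fl mf z) (fun=> f01 _) th01 k01 thN
  (fun n nN => A1 n (leq_trans NN nN)) NM ML.
have W2 := window_mean (orbit_measurable fl mfs z') (fun=> fs01 _) th01 k01 thN
  (fun n nN => A2 n (leq_trans NN nN)) NM ML.
rewrite -(ler_pM2r L0) mulrDl.
have : eta * L <= L * l2 - L * l1 by rewrite -mulrBr mulrC ler_wpM2l ?(ltW L0)//; lra.
move: W1 W2 cmp; rewrite /= !ler_norml => /andP[_ b1] /andP[b2 _] /andP[b3 _].
rewrite (_ : 24 * th / kappa * L = 2 * (12 * th / kappa * L)); last by field; lra.
lra.
Qed.

End Joining.

(** * Disjointness *)

Theorem theorem3p1 (R : realType) (X Y : pointedMetricType R)
  (mu : probability (borel X) R) (nu : probability (borel Y) R)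
  (T : R -> X -> X) (S : R -> Y -> Y)
  (P : set R) (p0 c : R)
  (Xk : nat -> set X) (A : nat -> X -> X)
  (scX : sigma_compact X) (scY : sigma_compact Y)
  (flowT : is_flow mu T) (flowS : is_flow nu S)
  (wmT : weakly_mixing mu T) (wmS : weakly_mixing nu S)
  (p0_neq0 : p0 != 0) (PE : P = [set p0; - p0])
  (c_itv : 0 < c < 1)
  (mXk : forall k, measurable (Xk k : set (borel X)))
  (Xk_cvg : mu (Xk k) @[k --> \oo] --> mu setT)
  (autA : forall k, is_aut mu (Xk k) (A k))
  (A_cvg : forall e : R, 0 < e ->
    \forall k \near \oo, forall x, Xk k x -> mdist (A k x) x < e)
  (main : forall e : R, 0 < e < 1 ->
    exists (E : nat -> set X) (kappa : R),
    [/\ forall k, measurable (E k : set (borel X)),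
        forall k, (c%:E * mu setT <= mu (E k))%E,
        0 < kappa < e &
    forall N : nat, exists (delta : R) (Z : set Y),
    [/\ 0 < delta,
        measurable (Z : set (borel Y)),
        ((1 - e)%:E * nu setT <= nu Z)%E &
    forall (y y' : Y) (k : nat) (x : X),
      Z y -> Z y' -> mdist y y' < delta ->
      (forall z, Xk k z -> mdist (A k z) z < delta) ->
      E k x -> Xk k x ->
      let x' := A k x in
      exists (M L p : R) (a : R -> R) (U : set R),
      [/\ [/\ N%:R <= M, 1 <= L, kappa <= L / M & P p],
          forall t, M <= t <= M + L -> a (- t) = - a t,
          good_triple M (M + L) a U c e &
          (forall t, U t ->
             Num.max (mdist (T t x) (T (a t + p) x'))
                     (mdist (S t y) (S (a t) y')) < e)
          \/
          (forall t, U (- t) ->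
             Num.max (mdist (T t x) (T (a t + p) x'))
                     (mdist (S t y) (S (a t) y')) < e)]]]) :
  disjoint_flows mu nu T S.
Proof.
have /andP[c0 c1] := c_itv.
have fT := is_flow_pmp flowT; have fS := is_flow_pmp flowS.
move=> rho joining.
apply: joining_product_open => B O mB oO.
apply: contrapT => ne.
have [W0 [iW0 W00 nW0]] := nonproduct_nowhere_product fT fS joining mB oO ne.
pose l : seq (R * R) := [:: (1, p0); (1, - p0); (- 1, p0); (- 1, - p0)].
have l0 sp : sp \in l -> sp.1 != 0 /\ sp.2 != 0.
  by rewrite !inE => /or4P[] /eqP-> /=; rewrite ?oppr_eq0 oner_eq0 p0_neq0.
have [W [iW _ Wpos sW]] := refine_separated_all fT fS wmT wmS joining l0 iW0 W00 nW0.
have [mW _] := iW.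
have [C [eta [C0 eta0 sC]]] := separated_by_uniform sW.
have eta2 : eta / 4 + eta / 4 < eta by lra.
pose w := fine (rho W); have w0 : 0 < w by [].
have cw0 : 0 < c * w / 8 by rewrite divr_gt0 ?mulr_gt0.
have D0 : 0 < 2 * C + 8 / c by rewrite ltr_wpDl ?mulr_ge0 ?divr_gt0.
(* With [D := 2 * C + 8 / c], the choice [e <= eta / (4 * D)] makes shadowing
   change averages by at most [eta / 4]; [e <= c * w / 8] makes [Z] large enough
   within [W]. *)
pose e := Num.min (1 / 2) (Num.min (eta / (4 * (2 * C + 8 / c))) (c * w / 8)).
have e0 : 0 < e by rewrite !lt_min cw0 !divr_gt0 ?mulr_gt0.
have e12 : e <= 1 / 2 by rewrite ge_min lexx.
have eD : 2 * C * e + 8 * (e / c) <= eta / 4.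
  rewrite (_ : _ + _ = e * (2 * C + 8 / c)); last by ring.
  rewrite -ler_pdivlMr// -mulrA -invfM ge_min; apply/orP; right.
  by rewrite ge_min lexx.
have ew : e <= c * w / 8 by rewrite !ge_min lexx !orbT.
have [|E [kappa [mE Ec /andP[k0 ke] H]]] := main e; first by rewrite e0; lra.
(* Two windows contribute [2 * (12 * th / kappa) <= eta / 4]. *)
pose th := Num.min 1 (kappa * eta / 96).
have th0 : 0 < th by rewrite lt_min ltr01 divr_gt0 ?mulr_gt0.
have th1 : th <= 1 by rewrite ge_min lexx.
have thk : 24 * th / kappa <= eta / 4.
  rewrite ler_pdivrMr//; have : th <= kappa * eta / 96 by rewrite ge_min lexx orbT.
  by lra.
have [N [V [mV VW Ve sV]]] := separated_after_uniform fT fS joining th0 cw0 mW sC.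
pose N' := maxn N (Num.truncn th^-1).+1.
have thN : 1 <= th * N'%:R.
  rewrite mulrC -ler_pdivrMr// div1r; apply: (@le_trans _ _ (Num.truncn th^-1).+1%:R).
    by apply/ltW/truncnS_gt.
  by rewrite ler_nat leq_max leqnn orbT.
have [delta [Z [d0 mZ Zc HZ]]] := H N'.
pose Q := V `&` (setT `*` Z) : set (borel X * borel Y).
have mTZ : measurable (setT `*` Z : set (borel X * borel Y)) by exact: measurableX.
have mQ : measurable Q by exact: measurableI.
have [_ /(_ _ cw0)[G [cG mG] [GQ QG]]] := product_inner_regular (joining_fst joining)
  (joining_snd joining) scX scY mQ.
have Gw : (1 - c / 2) * w < fine (rho G).
  have nZ : 1 - e <= fine (rho (setT `*` Z)).
    rewrite (joining_snd joining mZ) -lee_fin (pr_EFin nu mZ) -[leLHS]mule1.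
    by rewrite -(probability_setT nu).
  have mCZ : measurable (~` (setT `*` Z) : set (borel X * borel Y)) by exact: measurableC.
  have VQ : V `<=` Q `|` ~` (setT `*` Z).
    by move=> z Vz; have [?|?] := pselect ((setT `*` Z) z); [left|right].
  have := pr_le rho mV (measurableU _ _ mQ mCZ) VQ.
  have := prU2 rho mQ mCZ; rewrite (prC rho mTZ).
  have : fine (rho (Q `\` G)) < c * w / 8.
    by rewrite -lte_fin (pr_EFin rho (measurableD mQ mG)).
  rewrite (prD rho mQ mG GQ); move: Ve; rewrite -/w; lra.
have mK : measurable (fst @` G : set (borel X)).
  apply: compact_borel; apply: continuous_compact => //.
  by apply: continuous_subspaceT => z; exact: cvg_fst.
(* [W] is independent of the first coordinate, so a compact subset of [W] of
   almost full measure has a projection of measure almost 1. *)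
have proj : 1 - c / 2 < fine (mu (fst @` G)).
  rewrite -(ltr_pM2r w0); apply: lt_le_trans Gw _; rewrite mulrC.
  have mKT : measurable ((fst @` G) `*` setT : set (borel X * borel Y)) by exact: measurableX.
  have KE := invariant_fst_independent fT fS wmT joining iW mK.
  rewrite -fineM ?fin_num_measure// -KE; apply: pr_le => //; first exact: measurableI.
  by move=> z Gz; split; [apply: VW; case: (GQ z Gz)|split => //; exists z].
have Ec' k : c <= fine (mu (E k)).
  by rewrite -lee_fin (pr_EFin mu (mE k)) -[leLHS]mule1 -(probability_setT mu).
have ret := compact_fibre_returns mXk Xk_cvg autA A_cvg cG mE Ec' c0 d0 proj.
have [k [[x [y [y' [Ex Xx Gx Gx' dy]]]] Ak]] := filter_ex (filterI ret (A_cvg delta d0)).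
have [Vz [_ /= Zy]] := GQ _ Gx; have [Vz' [_ /= Zy']] := GQ _ Gx'.
have [M [L [p [a [U [[NM L1 kL Pp] aN gt close]]]]]] := HZ y y' k x Zy Zy' dy Ak Ex Xx.
have M0 : 0 < M by apply: lt_le_trans NM; rewrite ltr0n leq_max orbT.
have ML : M * kappa <= L by rewrite mulrC -ler_pdivlMr.
have L0 : 0 < L by exact: lt_le_trans L1.
have NN : (N <= N')%N by rewrite leq_max leqnn.
have th01 : 0 < th <= 1 by rewrite th0.
have k01 : 0 < kappa <= 1 by rewrite k0 (le_trans (ltW ke))// (le_trans e12)// ler_pdivrMr// mul1r ler1n.
have e02 : 0 < e <= 1 / 2 by rewrite e0.
have far s : s = 1 \/ s = -1 -> ~ (forall t, U (s * t) ->
    Num.max (mdist (T t x) (T (a t + p) (A k x))) (mdist (S t y) (S (a t) y')) < e).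
  move=> s1 cl; have spl : (s, p) \in l.
    rewrite !inE; move: Pp; rewrite PE => -[] ->; case: s1 => ->; by rewrite eqxx ?orbT.
  have := separated_orbits_far fT fS joining s1 (sV _ spl) Vz Vz' NN th01 k01 thN NM ML L0
    e02 c_itv aN gt cl.
  by rewrite leNgt (le_lt_trans (lerD thk eD)).
case: close => close; first by apply: (far 1 (or_introl erefl)) => t; rewrite mul1r; exact: close.
by apply: (far (-1) (or_intror erefl)) => t; rewrite mulN1r; exact: close.
Qed.
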